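(* Let $\Sigma$ be a germ at $0$ of a closed subset of $\mathbb{R}^n$ with $0\in\Sigma$, let $r$ be a positive integer, $n\ge p$, and $f\in\mathcal{E}_{[r]}(n,p)$. If $f$ satisfies condition $(\widetilde K_\Sigma)$, i.e. $d(x,\Sigma)\kappa(df(x))+\|f(x)\|\succsim d(x,\Sigma)^r$ in some neighbourhood of $0$, then $j^rf(\Sigma;0)$ is $\Sigma$-$V$-sufficient in $\mathcal{E}_{[r]}(n,p)$.
   Context: $\mathcal{E}_{[s]}(n,p)$ is the set of germs at $0$ of $C^s$ maps $(\mathbb{R}^n,0)\to(\mathbb{R}^p,0)$. $j^rf(\Sigma;0)=j^rg(\Sigma;0)$ means the $r$-jets of $f,g$ coincide at every point of $\Sigma\cap U$ for some neighbourhood $U$ of $0$. Two germs $f,g$ are $\Sigma$-$V$-equivalent if the germs at $0$ of $f^{-1}(0)$ and $g^{-1}(0)$ are homeomorphic by a homeomorphism fixing $f^{-1}(0)\cap\Sigma$ pointwise; the relative jet $w$ is $\Sigma$-$V$-sufficient in $\mathcal{E}_{[s]}(n,p)$ if any two realisations $g,h\in\mathcal{E}_{[s]}(n,p)$ of $w$ are $\Sigma$-$V$-equivalent. $d(x,\Sigma)$ is the distance to $\Sigma$; $\phi\precsim\psi$ means $\phi\le K\psi$ on some closed ball about $0$. $\kappa(df(x))=\min_i\operatorname{dist}(\operatorname{grad}f_i(x),\operatorname{span}\{\operatorname{grad}f_j(x):j\ne i\})$. *)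

(* Defs.v *)
(* classical real numbers. Points of R^n are represented as
   functions nat -> R vanishing at every index >= n. *)
From Stdlib Require Import Reals Lra Lia Arith List Classical ClassicalEpsilon.
Open Scope R_scope.

Definition vec := nat -> R.
Definition vzero : vec := fun _ => 0.
Definition vsub (x y : vec) : vec := fun k => x k - y k.
Definition upd (x : vec) (i : nat) (t : R) : vec :=
  fun j => if Nat.eqb j i then t else x j.

Definition in_Rn (n : nat) (x : vec) : Prop := forall i, (n <= i)%nat -> x i = 0.

Fixpoint sumR (m : nat) (F : nat -> R) : R :=
  match m with O => 0 | S m' => sumR m' F + F m' end.

Definition normv (m : nat) (v : vec) : R := sqrt (sumR m (fun k => v k ^ 2)).

(* infimum of a set of reals (0 if it has no greatest lower bound) *)
Definition is_glb (E : R -> Prop) (m : R) : Prop :=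
  (forall x, E x -> m <= x) /\ (forall m', (forall x, E x -> m' <= x) -> m' <= m).

Definition Rinf (E : R -> Prop) : R :=
  match excluded_middle_informative (exists m, is_glb E m) with
  | left H => proj1_sig (constructive_indefinite_description _ H)
  | right _ => 0
  end.

Definition partial (i : nat) (g : vec -> R) (x : vec) : R :=
  match excluded_middle_informative
          (exists l, derivable_pt_lim (fun t => g (upd x i t)) (x i) l) with
  | left H => proj1_sig (constructive_indefinite_description _ H)
  | right _ => 0
  end.

Fixpoint pdiff (l : list nat) (g : vec -> R) : vec -> R :=
  match l with nil => g | i :: l' => partial i (pdiff l' g) end.

Definition ball (n : nat) (rho : R) (x : vec) : Prop := normv n x < rho.

Definition cont_at (n : nat) (g : vec -> R) (x : vec) : Prop :=
  forall eps, 0 < eps -> exists d, 0 < d /\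
    forall y, in_Rn n y -> normv n (vsub y x) < d -> Rabs (g y - g x) < eps.

Definition Cr_on (n r : nat) (U : vec -> Prop) (g : vec -> R) : Prop :=
  forall l, Forall (fun i => (i < n)%nat) l -> (length l <= r)%nat ->
  forall x, in_Rn n x -> U x ->
    cont_at n (pdiff l g) x /\
    ((length l < r)%nat -> forall i, (i < n)%nat ->
       exists d, derivable_pt_lim (fun t => pdiff l g (upd x i t)) (x i) d).

(* f is (a representative of) a germ in E_[r](n,p) *)
Definition in_E (n p r : nat) (f : vec -> vec) : Prop :=
  (forall j, (j < p)%nat -> f vzero j = 0) /\
  exists rho, 0 < rho /\ forall j, (j < p)%nat -> Cr_on n r (ball n rho) (fun x => f x j).

Definition jet_eq (n p r : nat) (Sigma : vec -> Prop) (f g : vec -> vec) : Prop :=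
  exists rho, 0 < rho /\ forall x, Sigma x -> normv n x < rho ->
    forall l, Forall (fun i => (i < n)%nat) l -> (length l <= r)%nat ->
    forall j, (j < p)%nat -> pdiff l (fun y => f y j) x = pdiff l (fun y => g y j) x.

Definition open_n (n : nat) (U : vec -> Prop) : Prop :=
  forall x, in_Rn n x -> U x -> exists d, 0 < d /\
    forall y, in_Rn n y -> normv n (vsub y x) < d -> U y.

Definition closed_n (n : nat) (S : vec -> Prop) : Prop :=
  forall x, in_Rn n x ->
    (forall eps, 0 < eps -> exists y, S y /\ normv n (vsub y x) < eps) -> S x.

Definition Zset (n p : nat) (g : vec -> vec) (U : vec -> Prop) (x : vec) : Prop :=
  in_Rn n x /\ U x /\ forall j, (j < p)%nat -> g x j = 0.

Definition cont_on (n : nat) (A : vec -> Prop) (h : vec -> vec) : Prop :=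
  forall x, A x -> forall eps, 0 < eps -> exists d, 0 < d /\
    forall y, A y -> normv n (vsub y x) < d -> normv n (vsub (h y) (h x)) < eps.

Definition homeo (n : nat) (A B : vec -> Prop) (h : vec -> vec) : Prop :=
  exists k : vec -> vec,
    (forall x, A x -> B (h x)) /\ (forall y, B y -> A (k y)) /\
    (forall x, A x -> k (h x) = x) /\ (forall y, B y -> h (k y) = y) /\
    cont_on n A h /\ cont_on n B k.

Definition SigmaV_equiv (n p : nat) (Sigma : vec -> Prop) (g h : vec -> vec) : Prop :=
  exists U V, open_n n U /\ U vzero /\ open_n n V /\ V vzero /\
  exists phi, homeo n (Zset n p g U) (Zset n p h V) phi /\
    forall x, Zset n p g U x -> Sigma x -> phi x = x.

Definition V_sufficient (n p r : nat) (Sigma : vec -> Prop) (f : vec -> vec) : Prop :=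
  forall g h, in_E n p r g -> in_E n p r h ->
    jet_eq n p r Sigma f g -> jet_eq n p r Sigma f h -> SigmaV_equiv n p Sigma g h.

Definition distS (n : nat) (Sigma : vec -> Prop) (x : vec) : R :=
  Rinf (fun v => exists y, Sigma y /\ v = normv n (vsub x y)).

Definition grad (f : vec -> vec) (j : nat) (x : vec) : vec :=
  fun k => partial k (fun y => f y j) x.

Definition dist_span (n p : nat) (f : vec -> vec) (i : nat) (x : vec) : R :=
  Rinf (fun v => exists c : nat -> R,
    v = normv n (fun k => grad f i x k -
          sumR p (fun j => if Nat.eqb j i then 0 else c j * grad f j x k))).

Definition kappa (n p : nat) (f : vec -> vec) (x : vec) : R :=
  Rinf (fun v => exists i, (i < p)%nat /\ v = dist_span n p f i x).

Definition cond_K (n p r : nat) (Sigma : vec -> Prop) (f : vec -> vec) : Prop :=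
  exists K rho, 0 < rho /\ forall x, in_Rn n x -> normv n x <= rho ->
    distS n Sigma x ^ r <= K * (distS n Sigma x * kappa n p f x + normv p (f x)).

(* Main.v *)
From Coquelicot Require Import Coquelicot.
From Stdlib Require Import Lra Lia Arith List Classical ClassicalEpsilon FunctionalExtensionality.
Require Import Defs.
From Stdlib Require Import Reals.
Open Scope R_scope.

(** Let [g], [h] realise the jet of [f], put [D = d(x, Sigma)], [F_t = (1-t) g + t h], [A_t = d F_t],
    [u = h - g]. Taylor's formula at an almost nearest point of [Sigma] gives [u = o(D^r)] and
    [du = o(D^(r-1))], so the hypothesis on [f] passes to
    [c D^r |w| <= D |A_t^T w| + |F_t| |w|], uniformly in [t].

    For [r >= 2], the field [X = - A_t^T w] with [(D^2 A_t A_t^T + |F_t|^2) w = D^2 u] is locally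
    Lipschitz off [Sigma] and satisfies [|X| <= C D]. By Gronwall, its trajectories keep their distance
    to every point of [Sigma] up to a constant factor, so that the time-one map extends continuously by
    the identity on [Sigma]; and [|F_t|^2] obeys [|q'| <= C q] along them, so that zeros of [g] are
    carried to zeros of [h].

    For [r = 1] the field is only continuous, and the flow is replaced by a dichotomy. If [kappa(df)]
    is small near [0], the zero sets of [g] and [h] lie in [Sigma] and the identity works.
    Otherwise [A = df(0)] is surjective and [x] is sent to the unique nearby [y] in [x + im A^T]
    with [h y = g x]. *)

(** * Finite sums and Euclidean norms *)

(** The equation [A_t X = - u] need not be solvable off the zero set of [F_t], where [A_t A_t^T] may
    degenerate. Adding [|F_t|^2] to the matrix restores solvability, and the error [|F_t|^2 w / D^2]
    thereby left in the derivative of [F_t] is quadratic in [F_t], hence harmless on zeros. At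
    [Sigma] even this matrix degenerates, so a cutoff [max(0, del - D)] is added. For fixed [del]
    the field is then globally Lipschitz, with a constant that depends on [del], whereas
    [|X| <= C D] does not involve [del]. A trajectory starting at distance [D] is therefore run with
    [del = D / exp C] and never enters the region where the cutoff acts. No single [del] serves all
    points, so the flow is treated as a relation, and fields with different [del] are compared where
    both cutoffs vanish. For order one, [D <= K (D kappa + |f|)] is linear in [D]. A small [kappa]
    is absorbed on the left, and [|f| = o(D)] at zeros of a realisation then forces [D = 0].
    Otherwise [kappa] exceeds a fixed bound at points arbitrarily close to [0], and continuity of
    the gradients carries a lower bound to [df(0)]. *)

Lemma sumR_S (m : nat) (F : nat -> R) : sumR (S m) F = sumR m F + F m.
Proof. reflexivity. Qed.

Lemma sumR_ext (m : nat) (F G : nat -> R) :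
  (forall k, (k < m)%nat -> F k = G k) -> sumR m F = sumR m G.
Proof.
  induction m as [|m IH]; intros H; simpl; [reflexivity|].
  rewrite IH by (intros; apply H; lia). rewrite H by lia. reflexivity.
Qed.

Lemma sumR_plus (m : nat) (F G : nat -> R) :
  sumR m (fun k => F k + G k) = sumR m F + sumR m G.
Proof. induction m; simpl; [ring|]. rewrite IHm. ring. Qed.

Lemma sumR_minus (m : nat) (F G : nat -> R) :
  sumR m (fun k => F k - G k) = sumR m F - sumR m G.
Proof. induction m; simpl; [ring|]. rewrite IHm. ring. Qed.

Lemma sumR_scal (m : nat) (c : R) (F : nat -> R) :
  sumR m (fun k => c * F k) = c * sumR m F.
Proof. induction m; simpl; [ring|]. rewrite IHm. ring. Qed.

Lemma sumR_scal_r (m : nat) (c : R) (F : nat -> R) :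
  sumR m (fun k => F k * c) = sumR m F * c.
Proof. induction m; simpl; [ring|]. rewrite IHm. ring. Qed.

Lemma sumR_zero (m : nat) (F : nat -> R) :
  (forall k, (k < m)%nat -> F k = 0) -> sumR m F = 0.
Proof.
  intros H. induction m; simpl; [reflexivity|].
  rewrite IHm by (intros; apply H; lia). rewrite H by lia. ring.
Qed.

Lemma sumR_le (m : nat) (F G : nat -> R) :
  (forall k, (k < m)%nat -> F k <= G k) -> sumR m F <= sumR m G.
Proof.
  induction m as [|m IH]; intros H; simpl; [lra|].
  apply Rplus_le_compat; [apply IH; intros; apply H; lia | apply H; lia].
Qed.

Lemma sumR_nonneg (m : nat) (F : nat -> R) :
  (forall k, (k < m)%nat -> 0 <= F k) -> 0 <= sumR m F.
Proof.
  intros H. rewrite <- (sumR_zero m (fun _ => 0)) by reflexivity. now apply sumR_le.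
Qed.

Lemma sumR_abs (m : nat) (F : nat -> R) :
  Rabs (sumR m F) <= sumR m (fun k => Rabs (F k)).
Proof.
  induction m; simpl; [rewrite Rabs_R0; lra|].
  eapply Rle_trans; [apply Rabs_triang|]. lra.
Qed.

Lemma sumR_const (m : nat) (c : R) : sumR m (fun _ => c) = INR m * c.
Proof.
  induction m; [simpl; ring|]. rewrite S_INR. simpl sumR. rewrite IHm. ring.
Qed.

Lemma sumR_swap (m q : nat) (F : nat -> nat -> R) :
  sumR m (fun i => sumR q (fun j => F i j)) = sumR q (fun j => sumR m (fun i => F i j)).
Proof.
  induction m; simpl.
  - symmetry; apply sumR_zero; reflexivity.
  - rewrite IHm, <- sumR_plus. reflexivity.
Qed.

Lemma sumR_term_le (m : nat) (F : nat -> R) (k : nat) :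
  (forall i, (i < m)%nat -> 0 <= F i) -> (k < m)%nat -> F k <= sumR m F.
Proof.
  induction m as [|m IH]; intros H Hk; [lia|]. simpl.
  destruct (Nat.eq_dec k m) as [->|Hn].
  - assert (0 <= sumR m F) by (apply sumR_nonneg; intros; apply H; lia). lra.
  - assert (F k <= sumR m F) by (apply IH; [intros; apply H; lia | lia]).
    assert (0 <= F m) by (apply H; lia). lra.
Qed.

Lemma sumR_delta (m j : nat) (F : nat -> R) : (j < m)%nat ->
  sumR m (fun k => if Nat.eqb k j then F k else 0) = F j.
Proof.
  induction m as [|m IH]; intros H; [lia|]. simpl.
  destruct (Nat.eq_dec j m) as [->|Hn].
  - rewrite Nat.eqb_refl, sumR_zero; [ring|].
    intros k Hk. destruct (Nat.eqb_spec k m); [lia|reflexivity].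
  - rewrite IH by lia. destruct (Nat.eqb_spec m j); [lia|ring].
Qed.

Definition dot (m : nat) (a b : vec) : R := sumR m (fun k => a k * b k).

Lemma sumsq_nonneg (m : nat) (v : vec) : 0 <= sumR m (fun k => v k ^ 2).
Proof. apply sumR_nonneg; intros; apply pow2_ge_0. Qed.

Lemma normv_nonneg (m : nat) (v : vec) : 0 <= normv m v.
Proof. apply sqrt_pos. Qed.

Lemma normv_sqr (m : nat) (v : vec) : normv m v ^ 2 = sumR m (fun k => v k ^ 2).
Proof. unfold normv. rewrite pow2_sqrt; [reflexivity|apply sumsq_nonneg]. Qed.

Lemma normv_dot (m : nat) (v : vec) : normv m v ^ 2 = dot m v v.
Proof. rewrite normv_sqr. apply sumR_ext; intros; ring. Qed.

Lemma normv_ext (m : nat) (v w : vec) :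
  (forall k, (k < m)%nat -> v k = w k) -> normv m v = normv m w.
Proof.
  intros H. unfold normv. f_equal. apply sumR_ext. intros k Hk. now rewrite H.
Qed.

Lemma normv_zero (m : nat) (v : vec) :
  (forall k, (k < m)%nat -> v k = 0) -> normv m v = 0.
Proof.
  intros H. unfold normv. rewrite sumR_zero; [apply sqrt_0|].
  intros k Hk. rewrite H by assumption. ring.
Qed.

Lemma sqr_le_reg (a b : R) : 0 <= b -> a ^ 2 <= b ^ 2 -> a <= b.
Proof. intros. destruct (Rle_or_lt a b); [assumption|]. nra. Qed.

Lemma coord_le_normv (m : nat) (v : vec) (k : nat) : (k < m)%nat -> Rabs (v k) <= normv m v.
Proof.
  intros Hk. apply sqr_le_reg; [apply normv_nonneg|].
  rewrite normv_sqr, pow2_abs.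
  apply (sumR_term_le m (fun k => v k ^ 2)); [intros; apply pow2_ge_0 | assumption].
Qed.

Lemma normv_eq0 (m : nat) (v : vec) :
  normv m v <= 0 -> forall k, (k < m)%nat -> v k = 0.
Proof.
  intros H k Hk. pose proof (coord_le_normv m v k Hk). pose proof (Rabs_pos (v k)).
  destruct (Req_dec (v k) 0) as [E|E]; [exact E|].
  apply Rabs_pos_lt in E. lra.
Qed.

(** Cauchy-Schwarz: expanding the sum of the squares of [|b| a_k - |a| b_k] gives
    [2 |a| |b| (|a| |b| - a.b)]. Dividing by [|a| |b|] is why vanishing norms are treated apart. *)
Lemma dot_le (m : nat) (a b : vec) : dot m a b <= normv m a * normv m b.
Proof.
  set (x := normv m a). set (y := normv m b).
  assert (Hx : 0 <= x) by apply normv_nonneg. assert (Hy : 0 <= y) by apply normv_nonneg.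
  assert (Q : 0 <= 2 * (x * y) * (x * y - dot m a b)).
  { replace (2 * (x * y) * (x * y - dot m a b))
      with (sumR m (fun k => (y * a k - x * b k) ^ 2)).
    - apply sumR_nonneg; intros; apply pow2_ge_0.
    - rewrite (sumR_ext m _ (fun k => (y ^ 2 * (a k ^ 2) + x ^ 2 * (b k ^ 2)) - (2 * x * y) * (a k * b k)))
        by (intros; ring).
      rewrite sumR_minus, sumR_plus, !sumR_scal, <- !normv_sqr.
      fold x y. fold (dot m a b). ring. }
  destruct (Req_dec x 0) as [E|E]; [|destruct (Req_dec y 0) as [E'|E']].
  - unfold dot. rewrite sumR_zero; [nra|]. intros k Hk.
    rewrite (normv_eq0 m a) by (try assumption; fold x; lra). ring.
  - unfold dot. rewrite sumR_zero; [nra|]. intros k Hk.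
    rewrite (normv_eq0 m b) by (try assumption; fold y; lra). ring.
  - assert (0 < x * y) by nra. nra.
Qed.

Lemma dot_abs_le (m : nat) (a b : vec) : Rabs (dot m a b) <= normv m a * normv m b.
Proof.
  apply Rabs_le. split; [|apply dot_le].
  assert (H := dot_le m (fun k => - a k) b).
  assert (E : normv m (fun k => - a k) = normv m a).
  { unfold normv. f_equal. apply sumR_ext; intros; ring. }
  rewrite E in H.
  assert (E2 : dot m (fun k => - a k) b = - dot m a b).
  { unfold dot. rewrite (sumR_ext m _ (fun k => (-1) * (a k * b k))) by (intros; ring).
    rewrite sumR_scal. ring. }
  lra.
Qed.

Lemma normv_triang (m : nat) (a b : vec) :
  normv m (fun k => a k + b k) <= normv m a + normv m b.
Proof.
  pose proof (normv_nonneg m a). pose proof (normv_nonneg m b).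
  apply sqr_le_reg; [lra|].
  rewrite normv_sqr.
  rewrite (sumR_ext m _ (fun k => (a k ^ 2 + b k ^ 2) + 2 * (a k * b k))) by (intros; ring).
  rewrite !sumR_plus, sumR_scal, <- !normv_sqr.
  pose proof (dot_le m a b). unfold dot in *. nra.
Qed.

Lemma normv_scal (m : nat) (c : R) (a : vec) :
  normv m (fun k => c * a k) = Rabs c * normv m a.
Proof.
  unfold normv. rewrite (sumR_ext m _ (fun k => c ^ 2 * (a k ^ 2))) by (intros; ring).
  rewrite sumR_scal, sqrt_mult_alt by apply pow2_ge_0.
  f_equal. replace (c ^ 2) with (Rsqr c) by (unfold Rsqr; ring). apply sqrt_Rsqr_abs.
Qed.

Lemma normv_sub_triang (m : nat) (x y z : vec) :
  normv m (vsub x z) <= normv m (vsub x y) + normv m (vsub y z).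
Proof.
  eapply Rle_trans; [|apply normv_triang]. right. apply normv_ext.
  intros; unfold vsub; ring.
Qed.

Lemma normv_sub_sym (m : nat) (x y : vec) : normv m (vsub x y) = normv m (vsub y x).
Proof.
  unfold normv, vsub. f_equal. apply sumR_ext; intros; ring.
Qed.

Lemma normv_sub_zero (m : nat) (x : vec) : normv m (vsub x vzero) = normv m x.
Proof. apply normv_ext; intros; unfold vsub, vzero; ring. Qed.

Lemma normv_le_sub (m : nat) (x y : vec) : normv m x <= normv m (vsub x y) + normv m y.
Proof.
  eapply Rle_trans; [|apply normv_triang]. right. apply normv_ext.
  intros; unfold vsub; ring.
Qed.

Lemma normv_sub_self (m : nat) (x : vec) : normv m (vsub x x) = 0.
Proof. apply normv_zero; intros; unfold vsub; ring. Qed.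

Lemma normv_vzero (m : nat) : normv m vzero = 0.
Proof. apply normv_zero; reflexivity. Qed.

Lemma normv_le_sum (m : nat) (v : vec) : normv m v <= sumR m (fun k => Rabs (v k)).
Proof.
  induction m as [|m IH].
  - right. apply normv_zero; intros; lia.
  - assert (H0 : 0 <= sumR m (fun k => Rabs (v k))) by (apply sumR_nonneg; intros; apply Rabs_pos).
    pose proof (Rabs_pos (v m)). rewrite sumR_S.
    apply sqr_le_reg; [lra|]. rewrite normv_sqr, sumR_S. rewrite <- normv_sqr.
    pose proof (normv_nonneg m v). rewrite <- (pow2_abs (v m)). nra.
Qed.

Lemma normv_le_coord (m : nat) (v : vec) (e : R) :
  (forall k, (k < m)%nat -> Rabs (v k) <= e) -> normv m v <= INR m * e.
Proof.
  intros H. eapply Rle_trans; [apply normv_le_sum|].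
  rewrite <- sumR_const. apply sumR_le. exact H.
Qed.

Lemma normv_mono (m : nat) (v w : vec) :
  (forall k, (k < m)%nat -> Rabs (v k) <= Rabs (w k)) -> normv m v <= normv m w.
Proof.
  intros H. apply sqrt_le_1_alt. apply sumR_le. intros k Hk.
  rewrite <- (pow2_abs (v k)), <- (pow2_abs (w k)).
  apply pow_incr. split; [apply Rabs_pos|now apply H].
Qed.

Lemma in_Rn_eq (n : nat) (x y : vec) :
  in_Rn n x -> in_Rn n y -> normv n (vsub x y) <= 0 -> x = y.
Proof.
  intros Hx Hy H. apply functional_extensionality. intros k.
  destruct (Nat.lt_ge_cases k n) as [Hk|Hk].
  - pose proof (normv_eq0 _ _ H k Hk) as E. unfold vsub in E. lra.
  - rewrite Hx, Hy by assumption. reflexivity.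
Qed.

Lemma in_Rn_vzero (n : nat) : in_Rn n vzero.
Proof. intros i _. reflexivity. Qed.

Lemma Rle_of_le_eps (a b : R) : (forall e, 0 < e -> a <= b + e) -> a <= b.
Proof. intros H. apply Rnot_lt_le. intros C. specialize (H ((a - b) / 2)). lra. Qed.

(** * Uniform choice of constants over finite index sets *)

(** Minimum of finitely many radii. Monotonicity of [P] is a hypothesis so that any property that
    survives shrinking can be plugged in, including existential ones. *)
Lemma finite_radius (m : nat) (P : nat -> R -> Prop) :
  (forall k a b, P k b -> 0 < a -> a <= b -> P k a) ->
  (forall k, (k < m)%nat -> exists d, 0 < d /\ P k d) ->
  exists d, 0 < d /\ forall k, (k < m)%nat -> P k d.
Proof.
  intros Hmon. induction m as [|m IH]; intros H.
  - exists 1. split; [lra|]. intros; lia.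
  - destruct IH as [d [Hd H1]]; [intros; apply H; lia|].
    destruct (H m) as [e [He H2]]; [lia|].
    exists (Rmin d e). assert (0 < Rmin d e) by now apply Rmin_pos.
    split; [assumption|]. intros k Hk. destruct (Nat.eq_dec k m) as [->|Hn].
    + eapply Hmon; [exact H2|assumption|apply Rmin_r].
    + eapply Hmon; [apply H1; lia|assumption|apply Rmin_l].
Qed.

Lemma finite_bound (m : nat) (P : nat -> R -> Prop) :
  (forall k a b, P k a -> a <= b -> P k b) ->
  (forall k, (k < m)%nat -> exists c, P k c) ->
  exists c, 0 <= c /\ forall k, (k < m)%nat -> P k c.
Proof.
  intros Hmon. induction m as [|m IH]; intros H.
  - exists 0. split; [lra|]. intros; lia.
  - destruct IH as [d [Hd H1]]; [intros; apply H; lia|].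
    destruct (H m) as [e H2]; [lia|].
    exists (Rmax d e). split; [eapply Rle_trans; [exact Hd|apply Rmax_l]|].
    intros k Hk. destruct (Nat.eq_dec k m) as [->|Hn].
    + eapply Hmon; [exact H2|apply Rmax_r].
    + eapply Hmon; [apply H1; lia|apply Rmax_l].
Qed.

Lemma finite_radius_list (n r : nat) (P : list nat -> R -> Prop) :
  (forall l a b, P l b -> 0 < a -> a <= b -> P l a) ->
  (forall l, Forall (fun i => (i < n)%nat) l -> length l = r -> exists d, 0 < d /\ P l d) ->
  exists d, 0 < d /\
    forall l, Forall (fun i => (i < n)%nat) l -> length l = r -> P l d.
Proof.
  revert P. induction r as [|r IH]; intros P Hmon H.
  - destruct (H nil) as [d [Hd H1]]; [constructor|reflexivity|].
    exists d. split; [assumption|]. intros l _ Hl. destruct l; [assumption|discriminate].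
  (* The head index is quantified inside the predicate: [finite_radius] treats the head and the
     induction hypothesis the tail. *)
  - destruct (IH (fun l d => forall i, (i < n)%nat -> P (i :: l) d)) as [d [Hd H1]].
    + intros l a b Hb Ha Hab i Hi. eapply Hmon; eauto.
    + intros l Hl Hlen. apply finite_radius.
      * intros; eapply Hmon; eauto.
      * intros k Hk. apply H; [now constructor|simpl; now rewrite Hlen].
    + exists d. split; [assumption|]. intros l Hl Hlen. destruct l as [|i l]; [discriminate|].
      inversion Hl; subst. apply H1; auto.
Qed.

(** * Functions of class C1 with a prescribed gradient *)

(** The gradient is a parameter rather than [partial], so that the same lemmas apply to iterated
    derivatives and to differences of two functions. *)
Definition C1grad (n : nat) (rho : R) (g : vec -> R) (Dg : nat -> vec -> R) : Prop :=
  forall x, in_Rn n x -> ball n rho x -> forall i, (i < n)%nat ->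
    derivable_pt_lim (fun t => g (upd x i t)) (x i) (Dg i x) /\ cont_at n (Dg i) x.

Lemma partial_eq (i : nat) (g : vec -> R) (x : vec) (l : R) :
  derivable_pt_lim (fun t => g (upd x i t)) (x i) l -> partial i g x = l.
Proof.
  intros H. unfold partial. destruct (excluded_middle_informative _) as [E|E].
  - destruct (constructive_indefinite_description _ E) as [l' H']. simpl.
    eapply uniqueness_limite; eassumption.
  - exfalso. apply E. now exists l.
Qed.

Lemma C1grad_pdiff (n r : nat) (rho : R) (g : vec -> R) (l : list nat) :
  Cr_on n r (ball n rho) g -> Forall (fun i => (i < n)%nat) l -> (length l < r)%nat ->
  C1grad n rho (pdiff l g) (fun i => pdiff (i :: l) g).
Proof.
  intros H Hl Hlen x Hx Hb i Hi. split.
  - destruct (H l Hl (Nat.lt_le_incl _ _ Hlen) x Hx Hb) as [_ H1].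
    destruct (H1 Hlen i Hi) as [d Hd]. simpl. rewrite (partial_eq _ _ _ _ Hd). exact Hd.
  - apply (H (i :: l)); auto.
Qed.

Lemma upd_same (x : vec) (i : nat) : upd x i (x i) = x.
Proof.
  apply functional_extensionality. intros j. unfold upd.
  destruct (Nat.eqb_spec j i); congruence.
Qed.

Lemma upd_upd (x : vec) (i : nat) (s t : R) : upd (upd x i s) i t = upd x i t.
Proof.
  apply functional_extensionality. intros j. unfold upd.
  destruct (Nat.eqb_spec j i); reflexivity.
Qed.

Lemma upd_eq (x : vec) (i : nat) (s : R) : upd x i s i = s.
Proof. unfold upd. now rewrite Nat.eqb_refl. Qed.

(** Corner number [k] of the staircase from [x] to [y] that changes one coordinate at a time. *)
Definition mix (x y : vec) (k : nat) : vec := fun j => if Nat.ltb j k then y j else x j.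

(** Continuous partial derivatives give total differentiability: the one-variable mean value theorem
    is applied on each leg of the staircase [mix]. Every coordinate of a point on a leg lies between
    those of [x] and [y], so the point is no farther from [x] than [y] is and continuity at [x]
    controls the derivative there. *)
Lemma C1grad_diff (n : nat) (rho : R) (g : vec -> R) (Dg : nat -> vec -> R) (x : vec) :
  C1grad n rho g Dg -> in_Rn n x -> ball n rho x ->
  forall eps, 0 < eps -> exists d, 0 < d /\ forall y, in_Rn n y -> normv n (vsub y x) < d ->
    Rabs (g y - g x - sumR n (fun i => Dg i x * (y i - x i)))
      <= eps * sumR n (fun i => Rabs (y i - x i)).
Proof.
  intros H Hx Hb eps Heps.
  destruct (finite_radius n (fun i d => forall y, in_Rn n y -> normv n (vsub y x) < d ->
              Rabs (Dg i y - Dg i x) < eps)) as [d [Hd Hcont]].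
  { intros k a b Hk _ Hab y Hy Hn. apply Hk; [assumption|lra]. }
  { intros k Hk. destruct (H x Hx Hb k Hk) as [_ Hc].
    destruct (Hc eps Heps) as [d [Hd Hd']]. exists d. auto. }
  unfold ball in Hb.
  exists (Rmin d (rho - normv n x)). split; [apply Rmin_pos; lra|].
  intros y Hy Hn.
  assert (Hn1 := Rlt_le_trans _ _ _ Hn (Rmin_l _ _)).
  assert (Hn2 := Rlt_le_trans _ _ _ Hn (Rmin_r _ _)).
  assert (Hmix : forall k, (k <= n)%nat ->
    Rabs (g (mix x y k) - g x - sumR k (fun i => Dg i x * (y i - x i)))
      <= eps * sumR k (fun i => Rabs (y i - x i))).
  { induction k as [|k IH]; intros Hk.
    - simpl. replace (mix x y 0) with x by (apply functional_extensionality; reflexivity).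
      replace (g x - g x - 0) with 0 by ring. rewrite Rabs_R0. lra.
    - assert (IH' := IH ltac:(lia)). rewrite !sumR_S.
      assert (E1 : mix x y (S k) = upd (mix x y k) k (y k)).
      { apply functional_extensionality. intros j. unfold mix, upd.
        destruct (Nat.eqb_spec j k) as [->|]; [now destruct (Nat.ltb_spec k (S k)); [|lia]|].
        destruct (Nat.ltb_spec j (S k)), (Nat.ltb_spec j k); try reflexivity; lia. }
      assert (E2 : mix x y k = upd (mix x y k) k (x k)).
      { rewrite <- (upd_same (mix x y k) k) at 1. f_equal. unfold mix.
        destruct (Nat.ltb_spec k k); [lia|reflexivity]. }
      assert (Hz : forall t, Rmin (x k) (y k) <= t <= Rmax (x k) (y k) ->
                 in_Rn n (upd (mix x y k) k t) /\
                 normv n (vsub (upd (mix x y k) k t) x) <= normv n (vsub y x)).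
      { intros t Ht. split.
        - intros i Hi. unfold upd, mix. destruct (Nat.eqb_spec i k); [lia|].
          destruct (Nat.ltb_spec i k); [lia|]. now apply Hx.
        - apply normv_mono. intros i Hi. unfold vsub, upd, mix.
          destruct (Nat.eqb_spec i k) as [->|].
          + unfold Rmin, Rmax in Ht. destruct (Rle_dec (x k) (y k));
            unfold Rabs; repeat destruct Rcase_abs; lra.
          + destruct (Nat.ltb_spec i k); [lra|].
            replace (x i - x i) with 0 by ring. rewrite Rabs_R0. apply Rabs_pos. }
      assert (Hder : forall t, Rmin (x k) (y k) <= t <= Rmax (x k) (y k) ->
         derivable_pt_lim (fun t => g (upd (mix x y k) k t)) t (Dg k (upd (mix x y k) k t))).
      { intros t Ht. destruct (Hz t Ht) as [Z1 Z2].
        destruct (H _ Z1) with (i := k) as [D _]; [|lia|].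
        - unfold ball. pose proof (normv_le_sub n (upd (mix x y k) k t) x). lra.
        - rewrite upd_eq in D.
          replace (fun t0 : R => g (upd (upd (mix x y k) k t) k t0))
            with (fun t0 : R => g (upd (mix x y k) k t0)) in D; [exact D|].
          apply functional_extensionality. intros s. now rewrite upd_upd. }
      destruct (MVT_gen (fun t => g (upd (mix x y k) k t)) (x k) (y k)
                  (fun t => Dg k (upd (mix x y k) k t))) as [c [Hc Hmv]].
      { intros t Ht. apply is_derive_Reals. apply Hder. lra. }
      { intros t Ht. apply derivable_continuous_pt. eexists. apply Hder. exact Ht. }
      rewrite <- E1, <- E2 in Hmv.
      destruct (Hz c Hc) as [Z1 Z2].
      assert (Hk1 := Hcont k ltac:(lia) _ Z1 ltac:(lra)).
      replace (g (mix x y (S k)) - g x - (sumR k (fun i => Dg i x * (y i - x i)) + Dg k x * (y k - x k)))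
        with ((g (mix x y k) - g x - sumR k (fun i => Dg i x * (y i - x i)))
              + (Dg k (upd (mix x y k) k c) - Dg k x) * (y k - x k)) by lra.
      eapply Rle_trans; [apply Rabs_triang|]. rewrite Rabs_mult.
      pose proof (Rabs_pos (y k - x k)). nra. }
  specialize (Hmix n (Nat.le_refl _)).
  replace (mix x y n) with y in Hmix; [exact Hmix|].
  apply functional_extensionality. intros j. unfold mix.
  destruct (Nat.ltb_spec j n); [reflexivity|]. now rewrite Hx, Hy.
Qed.

Lemma derivable_pt_lim_sumR (m : nat) (F : nat -> R -> R) (t : R) (l : nat -> R) :
  (forall i, (i < m)%nat -> derivable_pt_lim (F i) t (l i)) ->
  derivable_pt_lim (fun s => sumR m (fun i => F i s)) t (sumR m l).
Proof.
  induction m as [|m IH]; intros H.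
  - apply (derivable_pt_lim_const 0).
  - apply (derivable_pt_lim_plus (fun s => sumR m (fun i => F i s)) (F m));
      [apply IH; intros; apply H; lia | apply H; lia].
Qed.

Lemma derivable_pt_lim_increment (F : R -> R) (t l : R) :
  derivable_pt_lim F t l -> exists d, 0 < d /\ forall s, Rabs s < d ->
    Rabs (F (t + s) - F t) <= (Rabs l + 1) * Rabs s.
Proof.
  intros H. destruct (H 1 Rlt_0_1) as [d Hd]. exists d. split; [apply cond_pos|].
  intros s Hs. destruct (Req_dec s 0) as [->|Hn].
  - rewrite Rplus_0_r, Rminus_diag, Rabs_R0. lra.
  - specialize (Hd s Hn Hs).
    replace (F (t + s) - F t) with ((((F (t + s) - F t) / s - l) + l) * s) by (field; exact Hn).
    rewrite Rabs_mult. apply Rmult_le_compat_r; [apply Rabs_pos|].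
    eapply Rle_trans; [apply Rabs_triang|]. lra.
Qed.

Lemma chain_rule (n : nat) (rho : R) (g : vec -> R) (Dg : nat -> vec -> R)
    (gam : R -> vec) (t : R) (v : vec) :
  C1grad n rho g Dg -> (forall s, in_Rn n (gam s)) -> ball n rho (gam t) ->
  (forall i, (i < n)%nat -> derivable_pt_lim (fun s => gam s i) t (v i)) ->
  derivable_pt_lim (fun s => g (gam s)) t (sumR n (fun i => Dg i (gam t) * v i)).
Proof.
  intros H HR Hb Hv eps Heps.
  assert (Hlin : derivable_pt_lim (fun s => sumR n (fun i => Dg i (gam t) * gam s i)) t
                   (sumR n (fun i => Dg i (gam t) * v i))).
  { apply (derivable_pt_lim_sumR n (fun i s => Dg i (gam t) * gam s i)).
    intros i Hi. apply (derivable_pt_lim_scal (fun s => gam s i)). now apply Hv. }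
  destruct (Hlin (eps / 2)) as [d1 Hd1]; [lra|].
  destruct (finite_radius n (fun i d => forall s, Rabs s < d ->
     Rabs (gam (t + s) i - gam t i) <= (Rabs (v i) + 1) * Rabs s)) as [d2 [Hd2 Hinc]].
  { intros k a b Hk _ Hab s Hs. apply Hk. lra. }
  { intros k Hk. apply (derivable_pt_lim_increment (fun s => gam s k)). now apply Hv. }
  (* [V |s|] bounds the total increment of the curve over a short time [s], so a tolerance
     [eps / (2 (V + 1))] in the differentiability of [g] costs at most [eps / 2]. The other half
     goes to the linear part [Hlin]. *)
  set (V := sumR n (fun i => Rabs (v i) + 1)).
  assert (HV : 0 <= V).
  { apply sumR_nonneg. intros i _. pose proof (Rabs_pos (v i)). lra. }
  destruct (C1grad_diff n rho g Dg (gam t) H (HR t) Hb (eps / (2 * (V + 1)))) as [d3 [Hd3 Hdiff]].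
  { apply Rdiv_lt_0_compat; lra. }
  assert (P1 : 0 < Rmin d1 (Rmin d2 (d3 / (V + 1)))).
  { apply Rmin_pos; [apply cond_pos|]. apply Rmin_pos; [exact Hd2|]. apply Rdiv_lt_0_compat; lra. }
  exists (mkposreal _ P1). simpl. intros s Hs Hlt.
  assert (L1 := Rlt_le_trans _ _ _ Hlt (Rmin_l _ _)).
  assert (L2 := Rlt_le_trans _ _ _ Hlt (Rmin_r _ _)).
  assert (L3 := Rlt_le_trans _ _ _ L2 (Rmin_r _ _)).
  apply Rlt_le_trans with (2 := Rmin_l _ _) in L2.
  specialize (Hd1 s Hs L1).
  assert (Hsum : sumR n (fun i => Rabs (gam (t + s) i - gam t i)) <= V * Rabs s).
  { unfold V. rewrite <- sumR_scal_r. apply sumR_le. intros i Hi. now apply Hinc. }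
  assert (Hs0 : 0 < Rabs s) by now apply Rabs_pos_lt.
  assert (Hns : normv n (vsub (gam (t + s)) (gam t)) < d3).
  { eapply Rle_lt_trans; [apply normv_le_sum|]. unfold vsub.
    eapply Rle_lt_trans; [exact Hsum|].
    apply (Rmult_lt_compat_l (V + 1)) in L3; [|lra].
    replace ((V + 1) * (d3 / (V + 1))) with d3 in L3 by (field; lra). nra. }
  specialize (Hdiff _ (HR (t + s)) Hns).
  set (e' := eps / (2 * (V + 1))) in *.
  assert (Ee : eps / 2 = e' * (V + 1)) by (unfold e'; field; lra).
  assert (He' : 0 < e') by (unfold e'; apply Rdiv_lt_0_compat; lra).
  set (S1 := sumR n (fun i => Dg i (gam t) * v i)) in *.
  set (D := g (gam (t + s)) - g (gam t) - sumR n (fun i => Dg i (gam t) * (gam (t + s) i - gam t i))) in *.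
  assert (Edec : (g (gam (t + s)) - g (gam t)) / s - S1 = D / s +
    ((sumR n (fun i => Dg i (gam t) * gam (t + s) i) - sumR n (fun i => Dg i (gam t) * gam t i)) / s - S1)).
  { unfold D. rewrite <- sumR_minus.
    rewrite (sumR_ext n (fun i => Dg i (gam t) * (gam (t + s) i - gam t i))
              (fun k => Dg k (gam t) * gam (t + s) k - Dg k (gam t) * gam t k)) by (intros; ring).
    field. exact Hs. }
  rewrite Edec. eapply Rle_lt_trans; [apply Rabs_triang|].
  assert (HD : Rabs (D / s) <= e' * V).
  { unfold Rdiv. rewrite Rabs_mult, Rabs_inv. apply (Rmult_le_reg_r (Rabs s)); [exact Hs0|].
    rewrite Rmult_assoc, Rinv_l, Rmult_1_r by lra.
    eapply Rle_trans; [exact Hdiff|]. rewrite Rmult_assoc. apply Rmult_le_compat_l; lra. }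
  lra.
Qed.

(** * Mean values along segments *)

Definition seg (x y : vec) (t : R) : vec := fun k => x k + t * (y k - x k).

Lemma seg_in_Rn (n : nat) (x y : vec) (t : R) : in_Rn n x -> in_Rn n y -> in_Rn n (seg x y t).
Proof. intros Hx Hy i Hi. unfold seg. rewrite Hx, Hy by assumption. ring. Qed.

Lemma seg_ball (n : nat) (rho : R) (x y : vec) (t : R) :
  ball n rho x -> ball n rho y -> 0 <= t <= 1 -> ball n rho (seg x y t).
Proof.
  unfold ball. intros Hx Hy Ht.
  assert (E : normv n (seg x y t) = normv n (fun k => (1 - t) * x k + t * y k)).
  { apply normv_ext. intros; unfold seg; ring. }
  rewrite E. eapply Rle_lt_trans; [apply normv_triang|].
  rewrite !normv_scal, !Rabs_pos_eq by lra.
  apply Rle_lt_trans with (Rmax (normv n x) (normv n y)); [|now apply Rmax_lub_lt].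
  pose proof (Rmax_l (normv n x) (normv n y)). pose proof (Rmax_r (normv n x) (normv n y)). nra.
Qed.

Lemma seg_near (n : nat) (x y : vec) (t : R) :
  0 <= t <= 1 -> normv n (vsub (seg x y t) x) <= normv n (vsub y x).
Proof.
  intros Ht. rewrite (normv_ext n _ (fun k => t * vsub y x k)) by (intros; unfold vsub, seg; ring).
  rewrite normv_scal, Rabs_pos_eq by lra. pose proof (normv_nonneg n (vsub y x)). nra.
Qed.

(** The bound on the distance from [z] to [x] is recorded because the Taylor estimate controls
    derivatives at [z] by powers of that distance. *)
Lemma C1grad_MVT (n : nat) (rho : R) (g : vec -> R) (Dg : nat -> vec -> R) (x y : vec) :
  C1grad n rho g Dg -> in_Rn n x -> in_Rn n y -> ball n rho x -> ball n rho y ->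
  exists z, in_Rn n z /\ ball n rho z /\ normv n (vsub z x) <= normv n (vsub y x) /\
    g y - g x = sumR n (fun i => Dg i z * (y i - x i)).
Proof.
  intros H Hx Hy Bx By.
  assert (Hder : forall t, 0 <= t <= 1 -> derivable_pt_lim (fun s => g (seg x y s)) t
            (sumR n (fun i => Dg i (seg x y t) * (y i - x i)))).
  { intros t Ht. apply (chain_rule n rho g Dg (seg x y) t (fun i => y i - x i)); auto.
    - intros; now apply seg_in_Rn.
    - now apply seg_ball.
    - intros i Hi. unfold seg.
      apply is_derive_Reals. auto_derive; [trivial|ring]. }
  destruct (MVT_gen (fun s => g (seg x y s)) 0 1
             (fun t => sumR n (fun i => Dg i (seg x y t) * (y i - x i)))) as [c [Hc Hmv]].
  - rewrite Rmin_left, Rmax_right by lra. intros t Ht. apply is_derive_Reals, Hder. lra.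
  - rewrite Rmin_left, Rmax_right by lra. intros t Ht.
    apply derivable_continuous_pt. eexists. apply Hder. lra.
  - rewrite Rmin_left, Rmax_right in Hc by lra.
    exists (seg x y c). repeat split.
    + now apply seg_in_Rn.
    + now apply seg_ball.
    + now apply seg_near.
    + assert (E0 : seg x y 0 = x) by (apply functional_extensionality; intros; unfold seg; ring).
      assert (E1 : seg x y 1 = y) by (apply functional_extensionality; intros; unfold seg; ring).
      rewrite E0, E1 in Hmv. lra.
Qed.

Lemma C1grad_increment (n : nat) (rho : R) (g : vec -> R) (Dg : nat -> vec -> R)
    (x y : vec) (M : R) :
  C1grad n rho g Dg -> in_Rn n x -> in_Rn n y -> ball n rho x -> ball n rho y ->
  (forall z i, in_Rn n z -> ball n rho z -> normv n (vsub z x) <= normv n (vsub y x) ->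
     (i < n)%nat -> Rabs (Dg i z) <= M) ->
  Rabs (g y - g x) <= INR n * M * normv n (vsub y x).
Proof.
  intros H Hx Hy Bx By HM.
  destruct (C1grad_MVT n rho g Dg x y H Hx Hy Bx By) as [z [Z1 [Z2 [Z3 Z4]]]].
  rewrite Z4. eapply Rle_trans; [apply sumR_abs|].
  rewrite Rmult_assoc, <- sumR_const. apply sumR_le. intros i Hi. rewrite Rabs_mult.
  apply Rmult_le_compat; try apply Rabs_pos; [now apply HM|].
  apply (coord_le_normv n (vsub y x)); assumption.
Qed.

Lemma cont_at_bounded (n : nat) (g : vec -> R) :
  cont_at n g vzero -> exists M d, 0 < d /\ forall x, in_Rn n x -> normv n x < d -> Rabs (g x) <= M.
Proof.
  intros H. destruct (H 1 Rlt_0_1) as [d [Hd Hc]]. exists (Rabs (g vzero) + 1), d.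
  split; [assumption|]. intros x Hx Hn. rewrite <- normv_sub_zero in Hn.
  specialize (Hc x Hx Hn).
  replace (g x) with (g vzero + (g x - g vzero)) by ring.
  eapply Rle_trans; [apply Rabs_triang|]. lra.
Qed.

(** * Distance to a closed set *)

(** A nonempty set of nonnegative numbers has an infimum, the negative of the supremum of its
    reflection, so the default branch of [Rinf] is not taken. *)
Lemma Rinf_glb (E : R -> Prop) :
  (exists v, E v) -> (forall v, E v -> 0 <= v) -> is_glb E (Rinf E).
Proof.
  intros [v Hv] Hpos.
  assert (Hex : exists m, is_glb E m).
  { destruct (completeness (fun x => E (- x))) as [s [Hs1 Hs2]].
    - exists 0. intros x Hx. apply Hpos in Hx. lra.
    - exists (- v). now rewrite Ropp_involutive.
    - exists (- s). split.
      + intros x Hx. assert (- x <= s); [|lra]. apply Hs1. now rewrite Ropp_involutive.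
      + intros m Hm. assert (s <= - m); [|lra]. apply Hs2. intros x Hx. apply Hm in Hx. lra. }
  unfold Rinf. destruct (excluded_middle_informative _) as [H|H]; [|contradiction].
  exact (proj2_sig (constructive_indefinite_description _ H)).
Qed.

Lemma distS_glb (n : nat) (Sigma : vec -> Prop) (x : vec) : Sigma vzero ->
  is_glb (fun v => exists y, Sigma y /\ v = normv n (vsub x y)) (distS n Sigma x).
Proof.
  intros H0. apply Rinf_glb.
  - eexists. exists vzero. split; [assumption|reflexivity].
  - intros v [y [_ ->]]. apply normv_nonneg.
Qed.

Lemma distS_le (n : nat) (Sigma : vec -> Prop) (x y : vec) :
  Sigma vzero -> Sigma y -> distS n Sigma x <= normv n (vsub x y).
Proof. intros H0 Hy. apply (distS_glb n Sigma x H0). now exists y. Qed.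

Lemma distS_ge (n : nat) (Sigma : vec -> Prop) (x : vec) (m : R) : Sigma vzero ->
  (forall y, Sigma y -> m <= normv n (vsub x y)) -> m <= distS n Sigma x.
Proof. intros H0 Hy. apply (distS_glb n Sigma x H0). intros v [y [H ->]]. now apply Hy. Qed.

Lemma distS_nonneg (n : nat) (Sigma : vec -> Prop) (x : vec) : Sigma vzero -> 0 <= distS n Sigma x.
Proof. intros H0. apply distS_ge; [assumption|]. intros; apply normv_nonneg. Qed.

Lemma distS_le_norm (n : nat) (Sigma : vec -> Prop) (x : vec) :
  Sigma vzero -> distS n Sigma x <= normv n x.
Proof. intros H0. rewrite <- normv_sub_zero. now apply distS_le. Qed.

Lemma distS_approx (n : nat) (Sigma : vec -> Prop) (x : vec) (e : R) :
  Sigma vzero -> 0 < e -> exists y, Sigma y /\ normv n (vsub x y) < distS n Sigma x + e.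
Proof.
  intros H0 He. apply NNPP. intros C.
  assert (distS n Sigma x + e <= distS n Sigma x); [|lra].
  apply distS_ge; [assumption|]. intros y Hy.
  destruct (Rle_or_lt (distS n Sigma x + e) (normv n (vsub x y))); [assumption|].
  exfalso. apply C. now exists y.
Qed.

Lemma distS_lip (n : nat) (Sigma : vec -> Prop) (x y : vec) :
  Sigma vzero -> distS n Sigma x <= distS n Sigma y + normv n (vsub x y).
Proof.
  intros H0. assert (distS n Sigma x - normv n (vsub x y) <= distS n Sigma y); [|lra].
  apply distS_ge; [assumption|]. intros z Hz.
  pose proof (distS_le n Sigma x z H0 Hz). pose proof (normv_sub_triang n x y z). lra.
Qed.

Lemma distS_zero (n : nat) (Sigma : vec -> Prop) (x : vec) :
  Sigma vzero -> closed_n n Sigma -> in_Rn n x -> distS n Sigma x <= 0 -> Sigma x.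
Proof.
  intros H0 Hc Hx Hd. apply Hc; [assumption|]. intros eps Heps.
  destruct (distS_approx n Sigma x eps H0 Heps) as [y [Hy Hl]].
  exists y. split; [assumption|]. rewrite normv_sub_sym. lra.
Qed.

Lemma distS_Sigma (n : nat) (Sigma : vec -> Prop) (x : vec) :
  Sigma vzero -> Sigma x -> distS n Sigma x = 0.
Proof.
  intros H0 Hx. pose proof (distS_nonneg n Sigma x H0).
  pose proof (distS_le n Sigma x x H0 Hx). rewrite normv_sub_self in *. lra.
Qed.

(** The factor 2 spares a compactness argument for a nearest point; at distance zero, closedness
    makes [x] itself available. *)
Lemma distS_almost_nearest (n : nat) (Sigma : vec -> Prop) (x : vec) :
  Sigma vzero -> closed_n n Sigma -> in_Rn n x ->
  exists y, Sigma y /\ normv n (vsub x y) <= 2 * distS n Sigma x.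
Proof.
  intros H0 Hc Hx. destruct (Rle_or_lt (distS n Sigma x) 0) as [H|H].
  - exists x. rewrite normv_sub_self. pose proof (distS_nonneg n Sigma x H0).
    split; [now apply (distS_zero n)|lra].
  - destruct (distS_approx n Sigma x _ H0 H) as [y [Hy Hl]]. exists y. split; [assumption|lra].
Qed.

(** * Contractions and positive definite linear systems *)

Lemma functional_choice {A B : Type} (P : A -> B -> Prop) :
  (forall a, exists b, P a b) -> exists f, forall a, P a (f a).
Proof.
  intros H. exists (fun a => proj1_sig (constructive_indefinite_description _ (H a))).
  intros a. exact (proj2_sig (constructive_indefinite_description _ (H a))).
Qed.

Lemma geometric_eventually_small (q c e : R) :
  0 <= q < 1 -> 0 <= c -> 0 < e -> exists N, forall m, (N <= m)%nat -> c * q ^ m < e.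
Proof.
  intros Hq Hc He.
  destruct (pow_lt_1_zero q) with (y := e / (c + 1)) as [N HN].
  - rewrite Rabs_pos_eq; lra.
  - apply Rdiv_lt_0_compat; lra.
  - exists N. intros m Hm. specialize (HN m Hm).
    assert (P : 0 <= q ^ m) by (apply pow_le; lra).
    rewrite Rabs_pos_eq in HN by assumption.
    apply (Rmult_lt_compat_l (c + 1)) in HN; [|lra].
    replace ((c + 1) * (e / (c + 1))) with e in HN by (field; lra). nra.
Qed.

Lemma geometric_limit (a : nat -> R) (C q : R) :
  0 <= C -> 0 <= q < 1 -> (forall m, Rabs (a (S m) - a m) <= C * q ^ m) ->
  exists l, forall m, Rabs (a m - l) <= C * q ^ m / (1 - q).
Proof.
  intros HC Hq H.
  assert (Htail : forall m k, Rabs (a (m + k)%nat - a m) <= C * q ^ m * (1 - q ^ k) / (1 - q)).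
  { intros m k. induction k as [|k IH].
    - rewrite Nat.add_0_r, Rminus_diag, Rabs_R0. simpl. unfold Rdiv. rewrite Rminus_diag. lra.
    - replace (a (m + S k)%nat - a m) with ((a (S (m + k)) - a (m + k)%nat) + (a (m + k)%nat - a m))
        by (rewrite Nat.add_succ_r; ring).
      eapply Rle_trans; [apply Rabs_triang|]. specialize (H (m + k)%nat).
      replace (C * q ^ m * (1 - q ^ S k) / (1 - q))
        with (C * q ^ (m + k) + C * q ^ m * (1 - q ^ k) / (1 - q)); [lra|].
      rewrite pow_add. simpl. field. lra. }
  assert (Htail' : forall m k, Rabs (a (m + k)%nat - a m) <= C * q ^ m / (1 - q)).
  { intros m k. eapply Rle_trans; [apply Htail|].
    unfold Rdiv. apply Rmult_le_compat_r; [left; apply Rinv_0_lt_compat; lra|].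
    assert (0 <= q ^ m) by (apply pow_le; lra). assert (0 <= q ^ k) by (apply pow_le; lra).
    assert (0 <= C * q ^ m) by now apply Rmult_le_pos. nra. }
  destruct (R_complete a) as [l Hl].
  - intros e He.
    destruct (geometric_eventually_small q (C / (1 - q)) (e / 2)) as [N HN]; try lra.
    { apply Rdiv_le_0_compat; lra. }
    assert (HB : forall m, (N <= m)%nat -> Rabs (a m - a N) < e / 2).
    { intros m Hm. replace m with (N + (m - N))%nat by lia.
      eapply Rle_lt_trans; [apply Htail'|].
      replace (C * q ^ N / (1 - q)) with (C / (1 - q) * q ^ N) by (field; lra). apply HN; lia. }
    exists N. intros k m Hk Hm. unfold Rdist.
    replace (a k - a m) with ((a k - a N) - (a m - a N)) by ring.
    eapply Rle_lt_trans; [apply Rabs_triang|]. rewrite Rabs_Ropp.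
    specialize (HB k Hk) as H1. specialize (HB m Hm) as H2. lra.
  - exists l. intros m. apply Rle_of_le_eps. intros e He.
    destruct (Hl e He) as [N HN].
    replace (a m - l) with ((a (m + N)%nat - l) - (a (m + N)%nat - a m)) by ring.
    eapply Rle_trans; [apply Rabs_triang|]. rewrite Rabs_Ropp.
    assert (H1 : Rabs (a (m + N)%nat - l) < e) by (apply HN; lia).
    specialize (Htail' m N). lra.
Qed.

(** [T] contracts only on a ball; the smallness of [T vzero] keeps the iterates from [vzero] inside
    it. The fixed point equation is limited to [k < p] because the norm does not see the other
    coordinates. *)
Lemma contraction_fixed_point (p : nat) (T : vec -> vec) (rad q : R) :
  0 <= rad -> 0 <= q < 1 ->
  (forall s s', normv p s <= rad -> normv p s' <= rad ->
     normv p (vsub (T s) (T s')) <= q * normv p (vsub s s')) ->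
  normv p (T vzero) <= (1 - q) * rad ->
  exists s, normv p s <= rad /\ forall k, (k < p)%nat -> T s k = s k.
Proof.
  intros Hrad Hq HT H0.
  set (s := fun m => Nat.iter m T vzero).
  assert (Hs : forall m, normv p (s m) <= rad).
  { induction m as [|m IH].
    - simpl. rewrite normv_vzero. assumption.
    - change (s (S m)) with (T (s m)).
      pose proof (normv_le_sub p (T (s m)) (T vzero)).
      assert (K := HT (s m) vzero IH ltac:(rewrite normv_vzero; assumption)).
      rewrite normv_sub_zero in K.
      assert (q * normv p (s m) <= q * rad) by (apply Rmult_le_compat_l; lra). lra. }
  assert (Hstep : forall m, normv p (vsub (s (S m)) (s m)) <= normv p (T vzero) * q ^ m).
  { induction m as [|m IH].
    - simpl. rewrite normv_sub_zero. lra.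
    - apply Rle_trans with (q * normv p (vsub (s (S m)) (s m))); [apply HT; apply Hs|].
      replace (normv p (T vzero) * q ^ S m) with (q * (normv p (T vzero) * q ^ m)) by (simpl; ring).
      apply Rmult_le_compat_l; lra. }
  set (C := normv p (T vzero)) in *.
  assert (HC : 0 <= C) by apply normv_nonneg.
  assert (Hlim : forall k, exists l, (k < p)%nat -> forall m, Rabs (s m k - l) <= C * q ^ m / (1 - q)).
  { intros k. destruct (Nat.lt_ge_cases k p) as [Hk|Hk]; [|exists 0; lia].
    destruct (geometric_limit (fun m => s m k) C q HC Hq) as [l Hl].
    - intros m. eapply Rle_trans; [|apply Hstep]. apply (coord_le_normv p (vsub (s (S m)) (s m)) k Hk).
    - exists l. intros _. exact Hl. }
  apply functional_choice in Hlim. destruct Hlim as [l Hl].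
  assert (Hnl : forall m, normv p (vsub (s m) l) <= INR p * (C / (1 - q)) * q ^ m).
  { intros m. rewrite Rmult_assoc. apply normv_le_coord. intros k Hk.
    replace (C / (1 - q) * q ^ m) with (C * q ^ m / (1 - q)) by (field; lra). now apply Hl. }
  assert (Hc' : 0 <= INR p * (C / (1 - q))).
  { apply Rmult_le_pos; [apply pos_INR|apply Rdiv_le_0_compat; lra]. }
  assert (Hlr : normv p l <= rad).
  { apply Rle_of_le_eps. intros e He.
    destruct (geometric_eventually_small q _ e Hq Hc' He) as [N HN].
    specialize (HN N (Nat.le_refl _)). specialize (Hnl N). specialize (Hs N).
    pose proof (normv_le_sub p l (s N)). rewrite normv_sub_sym in H. lra. }
  exists l. split; [exact Hlr|].
  assert (Hz : normv p (vsub (T l) l) <= 0).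
  { apply Rle_of_le_eps. intros e He.
    destruct (geometric_eventually_small q _ (e / 2) Hq Hc' ltac:(lra)) as [N HN].
    pose proof (HN N (Nat.le_refl _)). pose proof (HN (S N) ltac:(lia)).
    pose proof (Hnl N). pose proof (Hnl (S N)).
    pose proof (normv_sub_triang p (T l) (s (S N)) l) as K1.
    assert (K2 := HT l (s N) Hlr (Hs N)). change (T (s N)) with (s (S N)) in K2.
    rewrite (normv_sub_sym p l) in K2.
    pose proof (normv_nonneg p (vsub (s N) l)). nra. }
  intros k Hk. pose proof (normv_eq0 p _ Hz k Hk) as E. unfold vsub in E. lra.
Qed.

Definition mulv (p : nat) (b : nat -> nat -> R) (w : vec) : vec :=
  fun j => sumR p (fun k => b j k * w k).

Lemma mulv_sub (p : nat) (b : nat -> nat -> R) (w w' : vec) (j : nat) :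
  mulv p b (vsub w w') j = mulv p b w j - mulv p b w' j.
Proof.
  unfold mulv, vsub. rewrite <- sumR_minus. apply sumR_ext; intros; ring.
Qed.

Lemma mulv_bound (m p : nat) (b : nat -> nat -> R) :
  exists Lam, 0 <= Lam /\ forall w, normv m (mulv p b w) <= Lam * normv p w.
Proof.
  exists (sumR m (fun j => sumR p (fun k => Rabs (b j k)))). split.
  - apply sumR_nonneg; intros. apply sumR_nonneg; intros. apply Rabs_pos.
  - intros w. eapply Rle_trans; [apply normv_le_sum|].
    rewrite <- sumR_scal_r. apply sumR_le. intros j Hj.
    unfold mulv. eapply Rle_trans; [apply sumR_abs|].
    rewrite <- sumR_scal_r. apply sumR_le. intros k Hk.
    rewrite Rabs_mult. apply Rmult_le_compat_l; [apply Rabs_pos|].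
    now apply coord_le_normv.
Qed.

Definition coercive (p : nat) (b : nat -> nat -> R) (m : R) : Prop :=
  forall w, m * normv p w ^ 2 <= dot p (mulv p b w) w.

Lemma coercive_lower (p : nat) (b : nat -> nat -> R) (m : R) (w : vec) :
  coercive p b m -> m * normv p w <= normv p (mulv p b w).
Proof.
  intros H. specialize (H w). pose proof (dot_le p (mulv p b w) w).
  pose proof (normv_nonneg p w). pose proof (normv_nonneg p (mulv p b w)).
  destruct (Req_dec (normv p w) 0) as [E|E]; [rewrite E in *; lra|].
  assert (0 < normv p w) by lra. nra.
Qed.

(* With [tau = m / Lam^2], [|z - tau B z|^2 <= (1 - 2 tau m + tau^2 Lam^2) |z|^2]. *)
Lemma coercive_contract (p : nat) (b : nat -> nat -> R) (m : R) :
  0 < m -> coercive p b m ->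
  exists tau q, 0 < tau /\ 0 <= q < 1 /\
    forall z, normv p (fun j => z j - tau * mulv p b z j) <= q * normv p z.
Proof.
  intros Hm H.
  destruct (mulv_bound p p b) as [L0 [HL0 HL]].
  (* Enlarging the operator bound to at least [2 m] gives [tau m <= 1/4], so that [1 - tau m] is
     positive and its square root is a ratio below 1. *)
  set (Lam := Rmax L0 (2 * m)).
  assert (HLam : 2 * m <= Lam) by apply Rmax_r.
  assert (HL' : forall w, normv p (mulv p b w) <= Lam * normv p w).
  { intros w. eapply Rle_trans; [apply HL|].
    apply Rmult_le_compat_r; [apply normv_nonneg|apply Rmax_l]. }
  set (tau := m / Lam ^ 2).
  assert (Ht : 0 < tau) by (unfold tau; apply Rdiv_lt_0_compat; nra).
  assert (Et : tau * Lam ^ 2 = m) by (unfold tau; field; lra).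
  assert (Htm : tau * m <= 1 / 4) by (assert (4 * (m * m) <= Lam ^ 2) by nra; nra).
  assert (Hpos : 0 < tau * m) by nra.
  exists tau, (sqrt (1 - tau * m)). split; [assumption|].
  assert (Hsq : sqrt (1 - tau * m) ^ 2 = 1 - tau * m) by (rewrite pow2_sqrt; lra).
  pose proof (sqrt_pos (1 - tau * m)) as Hs.
  split; [split; [assumption|nra]|].
  intros z. apply sqr_le_reg; [apply Rmult_le_pos; [assumption|apply normv_nonneg]|].
  rewrite Rpow_mult_distr, Hsq, normv_sqr.
  rewrite (sumR_ext p _ (fun k => (z k ^ 2 + tau ^ 2 * (mulv p b z k ^ 2))
             - (2 * tau) * (mulv p b z k * z k))) by (intros; ring).
  rewrite sumR_minus, sumR_plus, !sumR_scal, <- !normv_sqr.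
  specialize (H z). unfold dot in H. specialize (HL' z).
  pose proof (normv_nonneg p (mulv p b z)). pose proof (normv_nonneg p z).
  assert (K : normv p (mulv p b z) ^ 2 <= Lam ^ 2 * normv p z ^ 2).
  { rewrite <- Rpow_mult_distr. apply pow_incr. lra. }
  assert (K2 : tau ^ 2 * normv p (mulv p b z) ^ 2 <= tau * m * normv p z ^ 2).
  { apply Rle_trans with (tau ^ 2 * (Lam ^ 2 * normv p z ^ 2)).
    - apply Rmult_le_compat_l; [apply pow2_ge_0|assumption].
    - right. rewrite <- Et. ring. }
  nra.
Qed.

(** Richardson iteration [w - tau (B w - v)], a contraction by [coercive_contract]. Since it
    contracts globally, the radius is simply taken large enough for the first step. *)
Lemma coercive_solve (p : nat) (b : nat -> nat -> R) (m : R) (v : vec) :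
  0 < m -> coercive p b m ->
  exists w, forall j, (j < p)%nat -> mulv p b w j = v j.
Proof.
  intros Hm H. destruct (coercive_contract p b m Hm H) as [tau [q [Ht [Hq Hc]]]].
  set (T := fun w : vec => fun j => w j - tau * (mulv p b w j - v j)).
  destruct (contraction_fixed_point p T (normv p (T vzero) / (1 - q)) q) as [w [_ Hw]].
  - apply Rdiv_le_0_compat; [apply normv_nonneg|lra].
  - assumption.
  - intros s s' _ _. eapply Rle_trans; [|apply Hc]. right. apply normv_ext.
    intros k Hk. rewrite mulv_sub. unfold vsub, T. ring.
  - right. field. lra.
  - exists w. intros j Hj. specialize (Hw j Hj). unfold T in Hw.
    assert (tau * (mulv p b w j - v j) = 0) by lra. nra.
Qed.

(** * Gronwall's inequality and the Picard theorem on the unit interval *)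

Lemma gronwall_one_sided (q dq : R -> R) (K s t : R) :
  (forall x, 0 <= x <= 1 -> continuity_pt q x) ->
  (forall x, 0 < x < 1 -> derivable_pt_lim q x (dq x)) ->
  (forall x, 0 < x < 1 -> dq x <= K * q x) ->
  0 <= s <= t -> t <= 1 -> q t <= exp (K * (t - s)) * q s.
Proof.
  intros Hcont Hder Hb Hst Ht.
  (* The mean value theorem returns a point of the closed interval, possibly an endpoint where [dq]
     is uncontrolled. Redefining the derivative there as [K * q] makes the inequality valid
     everywhere. *)
  set (dq' := fun x => if Rlt_dec 0 x then if Rlt_dec x 1 then dq x else K * q x else K * q x).
  assert (Hb' : forall x, dq' x <= K * q x).
  { intros x. unfold dq'. destruct (Rlt_dec 0 x), (Rlt_dec x 1); try lra. apply Hb; lra. }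
  destruct (MVT_gen (fun x => q x * exp (- K * x)) s t
      (fun x => dq' x * exp (- K * x) + q x * (- K * exp (- K * x)))) as [c [Hc Hmv]].
  - rewrite Rmin_left, Rmax_right by lra. intros x Hx. apply is_derive_Reals.
    apply (derivable_pt_lim_mult q (fun x => exp (- K * x))).
    + unfold dq'. destruct (Rlt_dec 0 x), (Rlt_dec x 1); try lra. apply Hder; lra.
    + apply is_derive_Reals. auto_derive; [trivial|ring].
  - rewrite Rmin_left, Rmax_right by lra. intros x Hx.
    apply (continuity_pt_mult q (fun x => exp (- K * x))).
    + apply Hcont; lra.
    + apply derivable_continuous_pt. eexists. apply is_derive_Reals.
      auto_derive; [trivial|reflexivity].
  - specialize (Hb' c). pose proof (exp_pos (- K * c)) as Hec.
    assert (Hle : q t * exp (- K * t) <= q s * exp (- K * s)).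
    { assert (0 <= exp (- K * c) * (t - s)) by (apply Rmult_le_pos; lra). nra. }
    replace (exp (K * (t - s))) with (exp (K * t) * exp (- K * s))
      by (rewrite <- exp_plus; f_equal; ring).
    apply (Rmult_le_compat_l (exp (K * t))) in Hle; [|left; apply exp_pos].
    assert (E : exp (K * t) * exp (- K * t) = 1).
    { rewrite <- exp_plus. replace (K * t + - K * t) with 0 by ring. apply exp_0. }
    replace (exp (K * t) * (q t * exp (- K * t))) with (q t * (exp (K * t) * exp (- K * t))) in Hle by ring.
    rewrite E in Hle. lra.
Qed.

(** The times may come in either order, because estimates are needed from both ends of a trajectory.
    For [t < s] the one-sided inequality is applied to [- q] with rate [- C]. *)
Lemma gronwall (q dq : R -> R) (C s t : R) :
  0 <= C -> (forall x, 0 <= q x) ->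
  (forall x, 0 <= x <= 1 -> continuity_pt q x) ->
  (forall x, 0 < x < 1 -> derivable_pt_lim q x (dq x)) ->
  (forall x, 0 < x < 1 -> Rabs (dq x) <= C * q x) ->
  0 <= s <= 1 -> 0 <= t <= 1 -> q t <= exp C * q s.
Proof.
  intros HC Hpos Hcont Hder Hb Hs Ht.
  assert (Hexp : forall a, 0 <= a <= 1 -> exp (C * a) * q s <= exp C * q s).
  { intros a Ha. apply Rmult_le_compat_r; [apply Hpos|].
    destruct (Req_dec (C * a) C) as [->|E]; [lra|]. left. apply exp_increasing. nra. }
  destruct (Rle_or_lt s t) as [H|H].
  - eapply Rle_trans; [|apply (Hexp (t - s)); lra].
    apply gronwall_one_sided with dq; auto; [|lra|lra].
    intros x Hx. specialize (Hb x Hx). apply Rabs_le_between in Hb. lra.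
  - eapply Rle_trans; [|apply (Hexp (s - t)); lra].
    assert (K : - q s <= exp (- C * (s - t)) * (- q t)).
    { apply gronwall_one_sided with (q := fun x => - q x) (dq := fun x => - dq x); [| | |lra|lra].
      - intros x Hx. apply continuity_pt_opp. now apply Hcont.
      - intros x Hx. apply (derivable_pt_lim_opp q). now apply Hder.
      - intros x Hx. specialize (Hb x Hx). apply Rabs_le_between in Hb. lra. }
    apply (Rmult_le_compat_l (exp (C * (s - t)))) in K; [|left; apply exp_pos].
    assert (E : exp (C * (s - t)) * exp (- C * (s - t)) = 1).
    { rewrite <- exp_plus. replace (C * (s - t) + - C * (s - t)) with 0 by ring. apply exp_0. }
    replace (exp (C * (s - t)) * (exp (- C * (s - t)) * - q t))
      with ((exp (C * (s - t)) * exp (- C * (s - t))) * - q t) in K by ring.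
    rewrite E in K. lra.
Qed.

(** The 1-Lipschitz retraction of the line onto [[a, b]]; composing with it extends data from an
    interval or a cube without loss in the Lipschitz constant. *)
Definition clamp (a b t : R) : R := Rmax a (Rmin t b).

Lemma clamp_in (a b t : R) : a <= b -> a <= clamp a b t <= b.
Proof. intros H. unfold clamp, Rmax, Rmin. repeat destruct Rle_dec; lra. Qed.

Lemma clamp_id (a b t : R) : a <= t <= b -> clamp a b t = t.
Proof. intros H. unfold clamp, Rmax, Rmin. repeat destruct Rle_dec; lra. Qed.

Lemma clamp_lip (a b t s : R) : Rabs (clamp a b t - clamp a b s) <= Rabs (t - s).
Proof.
  unfold clamp, Rmax, Rmin. repeat destruct Rle_dec; unfold Rabs; repeat destruct Rcase_abs; lra.
Qed.

Lemma continuity_pt_squeeze (F G : R -> R) (t : R) :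
  (forall s, Rabs (F s - F t) <= G s) -> continuity_pt G t -> G t = 0 -> continuity_pt F t.
Proof.
  intros H HG G0 eps Heps. destruct (HG eps Heps) as [d [Hd K]]. exists d. split; [assumption|].
  intros s Hs. specialize (K s Hs). simpl in *. unfold Rdist in *.
  rewrite G0, Rminus_0_r in K. eapply Rle_lt_trans; [apply H|].
  eapply Rle_lt_trans; [apply Rle_abs|exact K].
Qed.

Lemma continuity_pt_sumR (m : nat) (F : nat -> R -> R) (t : R) :
  (forall i, (i < m)%nat -> continuity_pt (F i) t) ->
  continuity_pt (fun s => sumR m (fun i => F i s)) t.
Proof.
  induction m as [|m IH]; intros H.
  - apply continuity_pt_const. intros a b. reflexivity.
  - apply (continuity_pt_plus (fun s => sumR m (fun i => F i s)) (F m));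
      [apply IH; intros; apply H; lia | apply H; lia].
Qed.

Lemma continuity_pt_dist (F : R -> R) (t : R) :
  continuity_pt F t -> continuity_pt (fun s => Rabs (F s - F t)) t.
Proof.
  intros H. apply (continuity_pt_comp (fun s => F s - F t) Rabs); [|apply Rcontinuity_abs].
  apply (continuity_pt_minus F (fun _ => F t)); [assumption|].
  apply continuity_pt_const. intros a b. reflexivity.
Qed.

Lemma clamp_continuous (a b t : R) : continuity_pt (clamp a b) t.
Proof.
  apply continuity_pt_squeeze with (G := fun s => Rabs (s - t)).
  - intros s. apply clamp_lip.
  - apply (continuity_pt_dist (fun s => s)). apply derivable_continuous_pt, derivable_pt_id.
  - now rewrite Rminus_diag, Rabs_R0.
Qed.

(** Lipschitz jointly in time and space and on the whole space: one bound gives both the continuity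
    of the integrand along a curve and the contraction, with no domain to stay in. *)
Definition lip_field (n : nat) (X : R -> vec -> vec) (L : R) : Prop :=
  forall t x t' x', normv n (vsub (X t x) (X t' x')) <= L * (Rabs (t - t') + normv n (vsub x x')).

Lemma lip_field_continuous (n : nat) (X : R -> vec -> vec) (L : R) (gam : R -> vec) (t : R) (i : nat) :
  0 <= L -> lip_field n X L -> (i < n)%nat ->
  (forall k, (k < n)%nat -> continuity_pt (fun s => gam s k) t) ->
  continuity_pt (fun s => X s (gam s) i) t.
Proof.
  intros HL0 HL Hi Hg.
  apply continuity_pt_squeeze with
    (G := fun s => L * (Rabs (s - t) + sumR n (fun k => Rabs (gam s k - gam t k)))).
  - intros s. eapply Rle_trans; [apply (coord_le_normv n (vsub (X s (gam s)) (X t (gam t)))); exact Hi|].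
    eapply Rle_trans; [apply HL|]. apply Rmult_le_compat_l; [assumption|].
    apply Rplus_le_compat_l. apply (normv_le_sum n (vsub (gam s) (gam t))).
  - apply (continuity_pt_scal (fun s => Rabs (s - t) + sumR n (fun k => Rabs (gam s k - gam t k)))).
    apply (continuity_pt_plus (fun s => Rabs (s - t))).
    + apply (continuity_pt_dist (fun s => s)). apply derivable_continuous_pt, derivable_pt_id.
    + apply (continuity_pt_sumR n (fun k s => Rabs (gam s k - gam t k))).
      intros k Hk. apply (continuity_pt_dist (fun s => gam s k)). now apply Hg.
  - rewrite Rminus_diag, Rabs_R0, sumR_zero; [ring|].
    intros k _. now rewrite Rminus_diag, Rabs_R0.
Qed.

Lemma ex_RInt_continuity (F : R -> R) (a b : R) :
  (forall t, continuity_pt F t) -> ex_RInt F a b.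
Proof.
  intros H. apply (ex_RInt_continuous F). intros z _. apply continuity_pt_filterlim, H.
Qed.

Lemma RInt_exp_bound (F G : R -> R) (Lam E b : R) :
  0 < Lam -> 0 <= E -> 0 <= b ->
  (forall t, continuity_pt F t) -> (forall t, continuity_pt G t) ->
  (forall s, 0 <= s <= b -> Rabs (F s - G s) <= Lam * E * exp (2 * Lam * s)) ->
  Rabs (RInt F 0 b - RInt G 0 b) <= E / 2 * exp (2 * Lam * b).
Proof.
  intros HL HE Hb HF HG H.
  assert (CF : ex_RInt F 0 b) by now apply ex_RInt_continuity.
  assert (CG : ex_RInt G 0 b) by now apply ex_RInt_continuity.
  assert (CD : forall t, continuity_pt (fun s => F s - G s) t)
    by (intros t; now apply (continuity_pt_minus F G)).
  replace (RInt F 0 b - RInt G 0 b) with (RInt (fun s => F s - G s) 0 b)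
    by (apply (RInt_minus F G); assumption).
  eapply Rle_trans; [apply abs_RInt_le; [assumption|now apply ex_RInt_continuity]|].
  assert (HI : is_RInt (fun s => Lam * E * exp (2 * Lam * s)) 0 b
            (E / 2 * exp (2 * Lam * b) - E / 2 * exp (2 * Lam * 0))).
  { apply (is_RInt_derive (fun s => E / 2 * exp (2 * Lam * s))).
    - intros x _. auto_derive; [trivial|field].
    - intros x _. apply continuity_pt_filterlim, derivable_continuous_pt. eexists.
      apply is_derive_Reals. auto_derive; [trivial|reflexivity]. }
  apply Rle_trans with (RInt (fun s => Lam * E * exp (2 * Lam * s)) 0 b).
  - apply RInt_le; [assumption| |eexists; exact HI|].
    + apply ex_RInt_continuity. intros t.
      apply (continuity_pt_comp (fun s => F s - G s) Rabs); [apply CD|apply Rcontinuity_abs].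
    + intros x Hx. apply H. lra.
  - rewrite (is_RInt_unique _ _ _ _ HI), Rmult_0_r, exp_0. lra.
Qed.

(** Clamping the upper limit makes every iterate continuous on the whole line, constant outside the
    unit interval. This is why the differential equation is later stated only for [0 < t < 1]. *)
Definition picard_map (n : nat) (X : R -> vec -> vec) (x0 : vec) (gam : R -> vec) : R -> vec :=
  fun t i => if Nat.ltb i n then x0 i + RInt (fun s => X s (gam s) i) 0 (clamp 0 1 t) else 0.

Definition cont_curve (n : nat) (gam : R -> vec) : Prop :=
  forall i t, (i < n)%nat -> continuity_pt (fun s => gam s i) t.

Lemma picard_map_continuous (n : nat) (X : R -> vec -> vec) (L : R) (x0 : vec) (gam : R -> vec) :
  0 <= L -> lip_field n X L -> cont_curve n gam -> cont_curve n (picard_map n X x0 gam).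
Proof.
  intros HL0 HL Hg i t Hi. unfold picard_map.
  destruct (Nat.ltb_spec i n); [|lia].
  apply (continuity_pt_plus (fun _ => x0 i)).
  - apply continuity_pt_const. intros a b. reflexivity.
  - apply (continuity_pt_comp (clamp 0 1) (fun b => RInt (fun s => X s (gam s) i) 0 b));
      [apply clamp_continuous|].
    apply derivable_continuous_pt. eexists. apply is_derive_Reals.
    apply (is_derive_RInt (fun s => X s (gam s) i) _ 0).
    + apply filter_forall. intros b. apply (@RInt_correct R_CompleteNormedModule).
      apply ex_RInt_continuity. intros s. apply lip_field_continuous with n L; auto.
    + apply continuity_pt_filterlim. apply lip_field_continuous with n L; auto.
Qed.

(* The weight [exp (2 Lam t)] makes the Picard map a contraction of ratio 1/2 on the whole
   interval, without iterating over short times. *)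
Lemma picard_map_contract (n : nat) (X : R -> vec -> vec) (L Lam E : R) (x0 : vec)
    (gam bet : R -> vec) :
  0 <= L -> lip_field n X L -> 0 < Lam -> L * INR n <= Lam -> 0 <= E ->
  cont_curve n gam -> cont_curve n bet ->
  (forall t i, (i < n)%nat -> Rabs (gam t i - bet t i) <= E * exp (2 * Lam * clamp 0 1 t)) ->
  forall t i, (i < n)%nat ->
    Rabs (picard_map n X x0 gam t i - picard_map n X x0 bet t i) <= E / 2 * exp (2 * Lam * clamp 0 1 t).
Proof.
  intros HL0 HL HLam HLn HE Hg Hb H t i Hi. unfold picard_map.
  destruct (Nat.ltb_spec i n); [|lia].
  match goal with |- Rabs (?a + ?b - (?a + ?c)) <= _ => replace (a + b - (a + c)) with (b - c) by ring end.
  pose proof (clamp_in 0 1 t ltac:(lra)).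
  apply RInt_exp_bound; try assumption; try lra.
  - intros s. apply lip_field_continuous with n L; auto.
  - intros s. apply lip_field_continuous with n L; auto.
  - intros s Hs.
    eapply Rle_trans; [apply (coord_le_normv n (vsub (X s (gam s)) (X s (bet s)))); exact Hi|].
    eapply Rle_trans; [apply HL|]. rewrite Rminus_diag, Rabs_R0, Rplus_0_l.
    apply Rle_trans with (L * (INR n * (E * exp (2 * Lam * s)))).
    + apply Rmult_le_compat_l; [assumption|]. apply normv_le_coord. intros k Hk.
      eapply Rle_trans; [apply H; assumption|]. rewrite clamp_id by lra. lra.
    + replace (L * (INR n * (E * exp (2 * Lam * s)))) with ((L * INR n) * (E * exp (2 * Lam * s))) by ring.
      rewrite (Rmult_assoc Lam). apply Rmult_le_compat_r; [|assumption].
      apply Rmult_le_pos; [assumption|left; apply exp_pos].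
Qed.

Lemma picard (n : nat) (X : R -> vec -> vec) (L : R) (x0 : vec) :
  0 <= L -> lip_field n X L -> in_Rn n x0 ->
  exists gam : R -> vec, (forall t, in_Rn n (gam t)) /\ cont_curve n gam /\ gam 0 = x0 /\
    forall t i, 0 < t < 1 -> (i < n)%nat -> derivable_pt_lim (fun s => gam s i) t (X t (gam t) i).
Proof.
  intros HL0 HL Hx0.
  set (Lam := L * INR n + 1).
  assert (HLn : 0 <= L * INR n) by (apply Rmult_le_pos; [assumption|apply pos_INR]).
  assert (HLam : 0 < Lam) by (unfold Lam; lra).
  set (gm := fun m => Nat.iter m (picard_map n X x0) (fun _ => x0)).
  assert (Hc : forall m, cont_curve n (gm m)).
  { induction m as [|m IH].
    - intros i t Hi. apply continuity_pt_const. intros a b. reflexivity.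
    - apply picard_map_continuous with L; assumption. }
  (* Chosen so that [Lam * E] bounds [|X s x0|] for [s] in the unit interval, which controls the
     first Picard step. *)
  set (E := (normv n (X 0 x0) + L) / Lam).
  assert (HE : 0 <= E).
  { apply Rdiv_le_0_compat; [|assumption]. pose proof (normv_nonneg n (X 0 x0)). lra. }
  assert (HE' : Lam * E = normv n (X 0 x0) + L) by (unfold E; field; lra).
  assert (Hexp1 : forall s, 0 <= s -> 1 <= exp (2 * Lam * s)).
  { intros s Hs. destruct (Req_dec s 0) as [->|Hn].
    - rewrite Rmult_0_r, exp_0. lra.
    - rewrite <- exp_0. left. apply exp_increasing.
      apply Rmult_lt_0_compat; lra. }
  assert (Hstep : forall m t i, (i < n)%nat ->
    Rabs (gm (S m) t i - gm m t i) <= E * exp (2 * Lam * clamp 0 1 t) * (/ 2) ^ m).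
  { induction m as [|m IH]; intros t i Hi.
    - simpl. rewrite Rmult_1_r. unfold picard_map. destruct (Nat.ltb_spec i n); [|lia].
      (* Subtracting the integral of zero puts the first step in the form treated by
         [RInt_exp_bound]. *)
      match goal with |- Rabs (?a + ?b - ?a) <= _ => replace (a + b - a) with (b - RInt (fun _ => 0) 0 (clamp 0 1 t)) end.
      2:{ rewrite RInt_const. unfold scal; simpl; unfold mult; simpl. ring. }
      pose proof (clamp_in 0 1 t ltac:(lra)).
      eapply Rle_trans; [apply (RInt_exp_bound _ _ Lam E)|]; try assumption; try lra.
      + intros s. apply (lip_field_continuous n X L (fun _ => x0)); auto.
        intros k _. apply continuity_pt_const. intros a b. reflexivity.
      + intros s. apply continuity_pt_const. intros a b. reflexivity.
      + intros s Hs. rewrite Rminus_0_r.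
        eapply Rle_trans; [apply (coord_le_normv n (X s x0)); exact Hi|].
        pose proof (normv_le_sub n (X s x0) (X 0 x0)) as K.
        pose proof (HL s x0 0 x0) as K2. rewrite normv_sub_self, Rminus_0_r, Rabs_pos_eq, Rplus_0_r in K2 by lra.
        specialize (Hexp1 s ltac:(lra)). rewrite HE'.
        pose proof (normv_nonneg n (X 0 x0)). assert (L * s <= L) by nra. nra.
      + pose proof (exp_pos (2 * Lam * clamp 0 1 t)). nra.
    - change (gm (S (S m))) with (picard_map n X x0 (gm (S m))).
      change (gm (S m)) with (picard_map n X x0 (gm m)) at 2.
      replace (E * exp (2 * Lam * clamp 0 1 t) * (/ 2) ^ S m)
        with (E * (/ 2) ^ m / 2 * exp (2 * Lam * clamp 0 1 t)) by (simpl; field).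
      apply picard_map_contract with L; auto.
      + unfold Lam; lra.
      + apply Rmult_le_pos; [assumption|]. apply pow_le. lra.
      + intros s k Hk. eapply Rle_trans; [now apply IH|]. right; ring. }
  assert (Hlim : forall ti : R * nat, exists l, (snd ti < n)%nat -> forall m,
     Rabs (gm m (fst ti) (snd ti) - l) <= E * exp (2 * Lam * clamp 0 1 (fst ti)) * (/ 2) ^ m / (1 - / 2)).
  { intros [t i]. simpl. destruct (Nat.lt_ge_cases i n) as [Hi|Hi]; [|exists 0; lia].
    destruct (geometric_limit (fun m => gm m t i) (E * exp (2 * Lam * clamp 0 1 t)) (/ 2)) as [l Hl].
    - apply Rmult_le_pos; [assumption|left; apply exp_pos].
    - lra.
    - intros m. now apply Hstep.
    - exists l. intros _. exact Hl. }
  apply functional_choice in Hlim. destruct Hlim as [l Hl].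
  set (gam := fun t i => if Nat.ltb i n then l (t, i) else 0).
  assert (Hgam : forall m t i, (i < n)%nat ->
     Rabs (gm m t i - gam t i) <= (2 * E * (/ 2) ^ m) * exp (2 * Lam * clamp 0 1 t)).
  { intros m t i Hi. unfold gam. destruct (Nat.ltb_spec i n); [|lia].
    eapply Rle_trans; [apply (Hl (t, i)); assumption|]. simpl. right. field. }
  set (M := exp (2 * Lam)).
  assert (HM : forall t, exp (2 * Lam * clamp 0 1 t) <= M).
  { intros t. pose proof (clamp_in 0 1 t ltac:(lra)). unfold M.
    destruct (Req_dec (clamp 0 1 t) 1) as [->|Hn]; [rewrite Rmult_1_r; lra|].
    left. apply exp_increasing. nra. }
  assert (HM0 : 0 < M) by apply exp_pos.
  assert (Hunif : forall e, 0 < e -> exists N, forall m t i, (N <= m)%nat -> (i < n)%nat ->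
            Rabs (gm m t i - gam t i) < e).
  { intros e He. destruct (geometric_eventually_small (/ 2) (2 * E * M) e) as [N HN]; try lra.
    - apply Rmult_le_pos; lra.
    - exists N. intros m t i Hm Hi. eapply Rle_lt_trans; [now apply Hgam|].
      eapply Rle_lt_trans; [|apply (HN m Hm)].
      replace (2 * E * M * (/ 2) ^ m) with (2 * E * (/ 2) ^ m * M) by ring.
      apply Rmult_le_compat_l; [|apply HM].
      apply Rmult_le_pos; [lra|]. apply pow_le. lra. }
  assert (Hcg : cont_curve n gam).
  { intros i t Hi eps Heps. destruct (Hunif (eps / 3)) as [N HN]; [lra|].
    destruct (Hc N i t Hi (eps / 3)) as [d [Hd K]]; [lra|].
    exists d. split; [assumption|]. intros s Hs. specialize (K s Hs). simpl in *. unfold Rdist in *.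
    pose proof (HN N s i (Nat.le_refl _) Hi) as K1. pose proof (HN N t i (Nat.le_refl _) Hi) as K2.
    rewrite Rabs_minus_sym in K1.
    replace (gam s i - gam t i) with ((gam s i - gm N s i) + (gm N s i - gm N t i) + (gm N t i - gam t i)) by ring.
    eapply Rle_lt_trans; [apply Rabs_triang|].
    eapply Rle_lt_trans; [apply Rplus_le_compat_r, Rabs_triang|]. lra. }
  (* The convergence rate [Hgam] has the weighted form required by [picard_map_contract], so the
     images of the iterates converge to the image of the limit. *)
  assert (Hfix : forall t i, (i < n)%nat -> gam t i = picard_map n X x0 gam t i).
  { intros t i Hi. assert (Z : Rabs (gam t i - picard_map n X x0 gam t i) <= 0).
    { apply Rle_of_le_eps. intros e He. destruct (Hunif (e / 2)) as [N HN]; [lra|].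
      destruct (geometric_eventually_small (/ 2) (E * M) (e / 2)) as [N' HN']; try lra.
      { apply Rmult_le_pos; lra. }
      set (m := max N N').
      pose proof (HN (S m) t i ltac:(lia) Hi) as K1. rewrite Rabs_minus_sym in K1.
      pose proof (HN' m ltac:(lia)) as K2.
      assert (K3 : Rabs (gm (S m) t i - picard_map n X x0 gam t i)
                 <= 2 * E * (/ 2) ^ m / 2 * exp (2 * Lam * clamp 0 1 t)).
      { change (gm (S m)) with (picard_map n X x0 (gm m)).
        apply picard_map_contract with L; auto.
        - unfold Lam; lra.
        - apply Rmult_le_pos; [lra|]. apply pow_le. lra. }
      assert (K4 : 2 * E * (/ 2) ^ m / 2 * exp (2 * Lam * clamp 0 1 t) <= E * M * (/ 2) ^ m).
      { replace (E * M * (/ 2) ^ m) with (2 * E * (/ 2) ^ m / 2 * M) by field.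
        apply Rmult_le_compat_l; [|apply HM].
        apply Rdiv_le_0_compat; [|lra]. apply Rmult_le_pos; [lra|]. apply pow_le. lra. }
      replace (gam t i - picard_map n X x0 gam t i)
        with ((gam t i - gm (S m) t i) + (gm (S m) t i - picard_map n X x0 gam t i)) by ring.
      eapply Rle_trans; [apply Rabs_triang|]. lra. }
    pose proof (Rabs_pos (gam t i - picard_map n X x0 gam t i)).
    destruct (Req_dec (gam t i - picard_map n X x0 gam t i) 0) as [Q|Q]; [lra|].
    apply Rabs_pos_lt in Q. lra. }
  exists gam. split; [|split; [assumption|split]].
  - intros t i Hi. unfold gam. destruct (Nat.ltb_spec i n); [lia|reflexivity].
  - apply functional_extensionality. intros i. destruct (Nat.lt_ge_cases i n) as [Hi|Hi].
    + rewrite Hfix by assumption. unfold picard_map. destruct (Nat.ltb_spec i n); [|lia].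
      rewrite clamp_id by lra. rewrite RInt_point. unfold zero; simpl. ring.
    + unfold gam. destruct (Nat.ltb_spec i n); [lia|]. symmetry. now apply Hx0.
  - intros t i Ht Hi.
    assert (Hci : forall s, continuity_pt (fun s => X s (gam s) i) s).
    { intros s. apply lip_field_continuous with n L; auto. }
    assert (D : derivable_pt_lim (fun b => x0 i + RInt (fun s => X s (gam s) i) 0 b) t (X t (gam t) i)).
    { rewrite <- (Rplus_0_l (X t (gam t) i)).
      apply (derivable_pt_lim_plus (fun _ => x0 i)); [apply derivable_pt_lim_const|].
      apply is_derive_Reals. apply (is_derive_RInt (fun s => X s (gam s) i) _ 0).
      - apply filter_forall. intros b. apply (@RInt_correct R_CompleteNormedModule).
        now apply ex_RInt_continuity.
      - apply continuity_pt_filterlim. apply Hci. }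
    apply is_derive_Reals. apply is_derive_Reals in D.
    eapply is_derive_ext_loc; [|exact D].
    assert (P : 0 < Rmin t (1 - t)) by (apply Rmin_pos; lra).
    exists (mkposreal _ P). intros s Hs.
    assert (Hs' : Rabs (s - t) < Rmin t (1 - t)) by exact Hs.
    pose proof (Rlt_le_trans _ _ _ Hs' (Rmin_l _ _)) as B1.
    pose proof (Rlt_le_trans _ _ _ Hs' (Rmin_r _ _)) as B2.
    apply Rabs_lt_between in B1. apply Rabs_lt_between in B2.
    rewrite Hfix by assumption. unfold picard_map. destruct (Nat.ltb_spec i n); [|lia].
    rewrite clamp_id by lra. reflexivity.
Qed.

(** * Equivalence of zero sets from a bicontinuous relation *)

(** A relation instead of a map lets the direct and the inverse map be treated symmetrically. It
    need not be assumed functional: continuity at a pair, applied with the same first point, already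
    forces the second points to agree. *)
Lemma SigmaV_equiv_of_rel (n p : nat) (Sigma : vec -> Prop) (g h : vec -> vec)
    (Rl : vec -> vec -> Prop) (rho : R) :
  0 < rho -> Sigma vzero ->
  (forall x y, Rl x y -> in_Rn n x /\ in_Rn n y) ->
  (forall x, in_Rn n x -> normv n x < rho -> exists y, Rl x y) ->
  (forall y, in_Rn n y -> normv n y < rho -> exists x, Rl x y) ->
  (forall x y, Rl x y -> normv n x < rho -> forall eps, 0 < eps -> exists d, 0 < d /\
     forall x' y', Rl x' y' -> normv n x' < rho ->
       normv n (vsub x' x) < d -> normv n (vsub y' y) < eps) ->
  (forall x y, Rl x y -> normv n y < rho -> forall eps, 0 < eps -> exists d, 0 < d /\
     forall x' y', Rl x' y' -> normv n y' < rho ->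
       normv n (vsub y' y) < d -> normv n (vsub x' x) < eps) ->
  (forall x y, Rl x y -> normv n x < rho -> normv n y < rho ->
     ((forall j, (j < p)%nat -> g x j = 0) <-> (forall j, (j < p)%nat -> h y j = 0))) ->
  (forall x, Sigma x -> in_Rn n x -> normv n x < rho -> Rl x x) ->
  SigmaV_equiv n p Sigma g h.
Proof.
  intros Hrho H0 HR Hex1 Hex2 Hc1 Hc2 Hz Hid.
  assert (U1 : forall x y y', Rl x y -> Rl x y' -> normv n x < rho -> y = y').
  { intros x y y' H H' Hx. apply (in_Rn_eq n); [apply (HR x y H)|apply (HR x y' H')|].
    apply Rle_of_le_eps. intros e He. rewrite Rplus_0_l.
    destruct (Hc1 x y H Hx e He) as [d [Hd K]]. rewrite normv_sub_sym. left.
    apply (K x y' H' Hx). now rewrite normv_sub_self. }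
  assert (U2 : forall x x' y, Rl x y -> Rl x' y -> normv n y < rho -> x = x').
  { intros x x' y H H' Hy. apply (in_Rn_eq n); [apply (HR x y H)|apply (HR x' y H')|].
    apply Rle_of_le_eps. intros e He. rewrite Rplus_0_l.
    destruct (Hc2 x y H Hy e He) as [d [Hd K]]. rewrite normv_sub_sym. left.
    apply (K x' y H' Hy). now rewrite normv_sub_self. }
  assert (Hphi : exists phi, forall x, in_Rn n x -> normv n x < rho -> Rl x (phi x)).
  { apply (functional_choice (fun x y => in_Rn n x -> normv n x < rho -> Rl x y)).
    intros x. destruct (classic (in_Rn n x /\ normv n x < rho)) as [[A B]|N].
    - destruct (Hex1 x A B) as [y Hy]. now exists y.
    - exists x. intros A B. exfalso. tauto. }
  assert (Hk : exists k, forall y, in_Rn n y -> normv n y < rho -> Rl (k y) y).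
  { apply (functional_choice (fun y x => in_Rn n y -> normv n y < rho -> Rl x y)).
    intros y. destruct (classic (in_Rn n y /\ normv n y < rho)) as [[A B]|N].
    - destruct (Hex2 y A B) as [x Hx]. now exists x.
    - exists y. intros A B. exfalso. tauto. }
  destruct Hphi as [phi Hphi], Hk as [k Hk].
  pose proof (in_Rn_vzero n) as Z0. pose proof (normv_vzero n) as N0.
  assert (R00 : Rl vzero vzero) by (apply Hid; auto; lra).
  destruct (Hc1 vzero vzero R00 ltac:(lra) rho Hrho) as [d0 [Hd0 K0]].
  (* The source ball is shrunk, by continuity at the origin, so that its image lies in the ball
     where the inverse is known. *)
  set (rho1 := Rmin d0 rho). assert (Hrho1 : 0 < rho1) by now apply Rmin_pos.
  assert (B1 : rho1 <= rho) by apply Rmin_r.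
  assert (Bphi : forall x, in_Rn n x -> normv n x < rho1 -> normv n (phi x) < rho).
  { intros x Hx Hn. rewrite <- normv_sub_zero. apply (K0 x); [apply Hphi; [assumption|lra]|lra|].
    rewrite normv_sub_zero. eapply Rlt_le_trans; [exact Hn|apply Rmin_l]. }
  (* The target neighbourhood is cut out through [k], so that it corresponds exactly to the source
     ball; it is open because [k] is continuous. *)
  exists (ball n rho1), (fun y => normv n y < rho /\ normv n (k y) < rho1).
  split; [|split; [|split; [|split]]].
  - intros x Hx Hb. unfold ball in *. exists (rho1 - normv n x). split; [lra|].
    intros y Hy Hn. pose proof (normv_le_sub n y x). lra.
  - unfold ball. lra.
  - intros y Hy [Hb1 Hb2].
    destruct (Hc2 (k y) y (Hk y Hy Hb1) Hb1 (rho1 - normv n (k y)) ltac:(lra)) as [d [Hd K]].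
    exists (Rmin d (rho - normv n y)). split; [apply Rmin_pos; lra|].
    intros z Hz' Hn.
    pose proof (Rlt_le_trans _ _ _ Hn (Rmin_l _ _)). pose proof (Rlt_le_trans _ _ _ Hn (Rmin_r _ _)).
    pose proof (normv_le_sub n z y).
    assert (Hzr : normv n z < rho) by lra.
    split; [assumption|].
    assert (normv n (vsub (k z) (k y)) < rho1 - normv n (k y)) by (apply (K (k z) z); auto).
    pose proof (normv_le_sub n (k z) (k y)). lra.
  - rewrite N0. split; [assumption|].
    rewrite (U2 (k vzero) vzero vzero); [lra|apply Hk; auto; lra|assumption|lra].
  - assert (Hkphi : forall x, in_Rn n x -> normv n x < rho1 -> k (phi x) = x).
    { intros x Hx Hn. assert (Rx : Rl x (phi x)) by (apply Hphi; [assumption|lra]).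
      apply (U2 _ _ (phi x)); [|assumption|now apply Bphi].
      apply Hk; [apply (HR _ _ Rx)|now apply Bphi]. }
    assert (Hphik : forall y, in_Rn n y -> normv n y < rho -> normv n (k y) < rho1 -> phi (k y) = y).
    { intros y Hy Hn Hn2. assert (Ry : Rl (k y) y) by now apply Hk.
      apply (U1 (k y)); [|assumption|lra]. apply Hphi; [apply (HR _ _ Ry)|lra]. }
    exists phi. split.
    + exists k. split; [|split; [|split; [|split; [|split]]]].
      * intros x [Hx [Hb Hg]]. unfold ball in Hb.
        assert (Rx : Rl x (phi x)) by (apply Hphi; [assumption|lra]).
        split; [apply (HR _ _ Rx)|]. split; [split|].
        -- now apply Bphi.
        -- now rewrite Hkphi.
        -- apply (Hz _ _ Rx); [lra|now apply Bphi|assumption].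
      * intros y [Hy [[Hb1 Hb2] Hh]]. assert (Ry : Rl (k y) y) by now apply Hk.
        split; [apply (HR _ _ Ry)|]. split; [assumption|].
        apply (Hz _ _ Ry); [lra|assumption|assumption].
      * intros x [Hx [Hb _]]. now apply Hkphi.
      * intros y [Hy [[Hb1 Hb2] _]]. now apply Hphik.
      * intros x [Hx [Hb _]] eps Heps. unfold ball in Hb.
        destruct (Hc1 x (phi x) (Hphi x Hx ltac:(lra)) ltac:(lra) eps Heps) as [d [Hd K]].
        exists d. split; [assumption|]. intros y [Hy [Hb' _]] Hn. unfold ball in Hb'.
        apply (K y); [apply Hphi; [assumption|lra]|lra|assumption].
      * intros x [Hx [[Hb1 Hb2] _]] eps Heps.
        destruct (Hc2 (k x) x (Hk x Hx Hb1) Hb1 eps Heps) as [d [Hd K]].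
        exists d. split; [assumption|]. intros y [Hy [[Hb1' Hb2'] _]] Hn.
        apply (K _ y); [now apply Hk|assumption|assumption].
    + intros x [Hx [Hb _]] HS. unfold ball in Hb. symmetry.
      apply (U1 x); [apply Hid; [assumption|assumption|lra]|apply Hphi; [assumption|lra]|lra].
Qed.

(** * Realisations of a relative jet are close to order r along Sigma *)

(** Downward induction on the order of the derivative: as it vanishes at [y], the mean value
    inequality gains one factor [n |x - y|] over the bound for its own partial derivatives. At order
    [r] only smallness is required, not vanishing at [y]. *)
Lemma taylor_flat (n r : nat) (rho eps : R) (G : list nat -> vec -> R) (y : vec) :
  (forall l, Forall (fun i => (i < n)%nat) l -> (length l < r)%nat ->
     C1grad n rho (G l) (fun i => G (i :: l))) ->
  (forall l z, Forall (fun i => (i < n)%nat) l -> length l = r -> in_Rn n z -> ball n rho z ->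
     Rabs (G l z) <= eps) ->
  in_Rn n y -> ball n rho y ->
  (forall l, Forall (fun i => (i < n)%nat) l -> (length l < r)%nat -> G l y = 0) ->
  forall k l x, Forall (fun i => (i < n)%nat) l -> (length l + k = r)%nat ->
    in_Rn n x -> ball n rho x ->
    Rabs (G l x) <= INR n ^ k * eps * normv n (vsub x y) ^ k.
Proof.
  intros HG Hr Hy By Hy0. induction k as [|k IH]; intros l x Hl Hlen Hx Bx.
  - simpl. rewrite Rmult_1_l, Rmult_1_r. apply Hr; try assumption. lia.
  - replace (G l x) with (G l x - G l y) by (rewrite (Hy0 l) by (try assumption; lia); ring).
    eapply Rle_trans; [apply (C1grad_increment n rho (G l) (fun i => G (i :: l)) y x
       (INR n ^ k * eps * normv n (vsub x y) ^ k))|]; try assumption.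
    + apply HG; [assumption|lia].
    + intros z i Hz Bz Hzy Hi.
      eapply Rle_trans; [apply IH; [now constructor|simpl; lia|assumption|assumption]|].
      (* [eps >= 0] is read off from the bound on order [r]; the index [i < n] supplies a list of
         that length. *)
      assert (He : 0 <= INR n ^ k * eps).
      { assert (He0 : 0 <= eps).
        { eapply Rle_trans; [apply Rabs_pos|apply (Hr (repeat i r) x)]; try assumption.
          - clear - Hi. induction r; simpl; constructor; auto.
          - apply repeat_length. }
        apply Rmult_le_pos; [apply pow_le, pos_INR|assumption]. }
      apply Rmult_le_compat_l; [assumption|]. apply pow_incr.
      split; [apply normv_nonneg|assumption].
    + right. simpl. ring.
Qed.

(** The derivatives of order [r] of [g - f] are continuous and vanish at [0], a point of [Sigma],
    hence are small nearby. Taylor expansion at an almost nearest point of [Sigma] integrates this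
    up to orders 1 and 0. *)
Lemma flat_estimate (n p r : nat) (Sigma : vec -> Prop) (f g : vec -> vec) :
  (forall x, Sigma x -> in_Rn n x) -> closed_n n Sigma -> Sigma vzero -> (1 <= r)%nat ->
  in_E n p r f -> in_E n p r g -> jet_eq n p r Sigma f g ->
  forall eps, 0 < eps -> exists rho, 0 < rho /\
    forall x, in_Rn n x -> normv n x < rho -> forall j, (j < p)%nat ->
      Rabs (g x j - f x j) <= eps * distS n Sigma x ^ r /\
      forall i, (i < n)%nat -> Rabs (grad g j x i - grad f j x i) <= eps * distS n Sigma x ^ (r - 1).
Proof.
  intros HS Hcl H0 Hr [_ [rf [Hrf Hf]]] [_ [rg [Hrg Hg]]] [rj [Hrj Hj]] eps Heps.
  set (G := fun j l x => pdiff l (fun y => g y j) x - pdiff l (fun y => f y j) x).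
  (* The denominator absorbs the factors [n^k] of the expansion and [2^k] from [|x - y| <= 2 D]. *)
  set (eps0 := eps / ((INR n + 1) ^ r * 2 ^ r)).
  assert (Hn1 : 1 <= INR n + 1) by (pose proof (pos_INR n); lra).
  assert (Hpn : 0 < (INR n + 1) ^ r) by (apply pow_lt; lra).
  assert (Hp2 : 0 < 2 ^ r) by (apply pow_lt; lra).
  assert (Heps0 : 0 < eps0).
  { apply Rdiv_lt_0_compat; [assumption|now apply Rmult_lt_0_compat]. }
  assert (Hsmall : exists d, 0 < d /\ forall j, (j < p)%nat ->
     forall l, Forall (fun i => (i < n)%nat) l -> length l = r ->
     forall z, in_Rn n z -> normv n z < d -> Rabs (G j l z) <= eps0).
  { apply (finite_radius p (fun j d => forall l, Forall (fun i => (i < n)%nat) l -> length l = r ->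
     forall z, in_Rn n z -> normv n z < d -> Rabs (G j l z) <= eps0)).
    - intros j a b H _ Hab l Hl Hlen z Hz Hzn. apply H; auto. lra.
    - intros j Hjp.
      apply (finite_radius_list n r (fun l d => forall z, in_Rn n z -> normv n z < d -> Rabs (G j l z) <= eps0)).
      + intros l a b H _ Hab z Hz Hzn. apply H; auto. lra.
      + intros l Hl Hlen.
        destruct (Hf j Hjp l Hl ltac:(lia) vzero (in_Rn_vzero n)) as [Cf _];
          [unfold ball; now rewrite normv_vzero|].
        destruct (Hg j Hjp l Hl ltac:(lia) vzero (in_Rn_vzero n)) as [Cg _];
          [unfold ball; now rewrite normv_vzero|].
        destruct (Cf (eps0 / 2) ltac:(lra)) as [d1 [Hd1 K1]].
        destruct (Cg (eps0 / 2) ltac:(lra)) as [d2 [Hd2 K2]].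
        exists (Rmin d1 d2). split; [now apply Rmin_pos|]. intros z Hz Hzn.
        rewrite <- normv_sub_zero in Hzn.
        specialize (K1 z Hz (Rlt_le_trans _ _ _ Hzn (Rmin_l _ _))).
        specialize (K2 z Hz (Rlt_le_trans _ _ _ Hzn (Rmin_r _ _))).
        assert (E : pdiff l (fun y => f y j) vzero = pdiff l (fun y => g y j) vzero).
        { apply Hj; auto; [now rewrite normv_vzero|lia]. }
        unfold G. rewrite Rabs_minus_sym in K1. left.
        match goal with |- Rabs (?a - ?b) < _ =>
          replace (a - b) with ((a - pdiff l (fun y => g y j) vzero)
             + (pdiff l (fun y => f y j) vzero - b)) by (rewrite E; ring) end.
        eapply Rle_lt_trans; [apply Rabs_triang|]. lra. }
  destruct Hsmall as [d [Hd Hsmall]].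
  set (rho := Rmin (Rmin rf rg) (Rmin rj d)).
  assert (Hrho : 0 < rho) by (repeat apply Rmin_pos; assumption).
  assert (Bf : rho <= rf) by (eapply Rle_trans; [apply Rmin_l|apply Rmin_l]).
  assert (Bg : rho <= rg) by (eapply Rle_trans; [apply Rmin_l|apply Rmin_r]).
  assert (Bj : rho <= rj) by (eapply Rle_trans; [apply Rmin_r|apply Rmin_l]).
  assert (Bd : rho <= d) by (eapply Rle_trans; [apply Rmin_r|apply Rmin_r]).
  (* From [|x - y| <= 2 D <= 2 |x|] one gets [|y| <= 3 |x|], so the base point stays in the ball of
     radius [rho]. *)
  exists (rho / 4). split; [lra|]. intros x Hx Hxn j Hjp.
  destruct (distS_almost_nearest n Sigma x H0 Hcl Hx) as [y [Hy Hyx]].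
  pose proof (distS_le_norm n Sigma x H0) as Hdx.
  assert (Hyn : normv n y < rho).
  { pose proof (normv_le_sub n y x). rewrite normv_sub_sym in H. lra. }
  assert (HT := taylor_flat n r rho eps0 (G j) y).
  assert (HC1 : forall l, Forall (fun i => (i < n)%nat) l -> (length l < r)%nat ->
     C1grad n rho (G j l) (fun i => G j (i :: l))).
  { intros l Hl Hlen z Hz Bz i Hi. unfold ball in Bz.
    destruct (C1grad_pdiff n r rf (fun y => f y j) l (Hf j Hjp) Hl Hlen z Hz ltac:(unfold ball; lra) i Hi) as [F1 F2].
    destruct (C1grad_pdiff n r rg (fun y => g y j) l (Hg j Hjp) Hl Hlen z Hz ltac:(unfold ball; lra) i Hi) as [G1 G2].
    split.
    - apply (derivable_pt_lim_minus (fun t => pdiff l (fun y => g y j) (upd z i t))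
              (fun t => pdiff l (fun y => f y j) (upd z i t))); assumption.
    - intros e He. destruct (F2 (e / 2) ltac:(lra)) as [d1 [Hd1 K1]].
      destruct (G2 (e / 2) ltac:(lra)) as [d2 [Hd2 K2]].
      exists (Rmin d1 d2). split; [now apply Rmin_pos|]. intros w Hw Hwn.
      specialize (K1 w Hw (Rlt_le_trans _ _ _ Hwn (Rmin_l _ _))).
      specialize (K2 w Hw (Rlt_le_trans _ _ _ Hwn (Rmin_r _ _))).
      unfold G. rewrite Rabs_minus_sym in K1.
      match goal with |- Rabs (?a - ?b - (?c - ?e')) < _ =>
        replace (a - b - (c - e')) with ((a - c) + (e' - b)) by ring end.
      eapply Rle_lt_trans; [apply Rabs_triang|]. lra. }
  specialize (HT HC1).
  assert (HT2 : forall k l, Forall (fun i => (i < n)%nat) l -> (length l + k = r)%nat ->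
     Rabs (G j l x) <= eps * distS n Sigma x ^ k).
  { intros k l Hl Hlen.
    eapply Rle_trans; [apply (HT) with (k := k)|]; try assumption; unfold ball; try lra.
    - intros l' z Hl' Hlen' Hz Bz. unfold ball in Bz. apply Hsmall; auto. lra.
    - now apply HS.
    - intros l' Hl' Hlen'. unfold G. rewrite (Hj y) by (auto; try lra; lia). ring.
    - apply Rle_trans with (INR n ^ k * eps0 * (2 * distS n Sigma x) ^ k).
      + apply Rmult_le_compat_l.
        * apply Rmult_le_pos; [apply pow_le, pos_INR|lra].
        * apply pow_incr. split; [apply normv_nonneg|assumption].
      + rewrite Rpow_mult_distr.
        replace eps with (((INR n + 1) ^ r * 2 ^ r) * eps0) by (unfold eps0; field; lra).
        assert (Hdk : 0 <= distS n Sigma x ^ k) by (apply pow_le, distS_nonneg; assumption).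
        assert (A1 : INR n ^ k <= (INR n + 1) ^ r).
        { apply Rle_trans with ((INR n + 1) ^ k).
          - apply pow_incr. pose proof (pos_INR n). lra.
          - apply Rle_pow; [assumption|lia]. }
        assert (A2 : 2 ^ k <= 2 ^ r) by (apply Rle_pow; [lra|lia]).
        assert (A3 : INR n ^ k * 2 ^ k <= (INR n + 1) ^ r * 2 ^ r).
        { apply Rmult_le_compat; try assumption; apply pow_le; [apply pos_INR|lra]. }
        replace (INR n ^ k * eps0 * (2 ^ k * distS n Sigma x ^ k))
          with ((INR n ^ k * 2 ^ k) * (eps0 * distS n Sigma x ^ k)) by ring.
        rewrite (Rmult_assoc ((INR n + 1) ^ r * 2 ^ r)). apply Rmult_le_compat_r; [|assumption].
        apply Rmult_le_pos; lra. }
  split.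
  - apply (HT2 r nil); [constructor|reflexivity].
  - intros i Hi. apply (HT2 (r - 1)%nat (i :: nil)); [now repeat constructor|simpl; lia].
Qed.

(** * The condition on f in terms of the transposed differential, and its stability *)

(** The transposed product [a^T w]; for a differential it is the combination of the gradients with
    weights [w]. *)
Definition trv (p : nat) (a : nat -> nat -> R) (w : vec) : vec :=
  fun k => sumR p (fun j => a j k * w j).

Lemma argmax_abs (p : nat) (v : vec) : (0 < p)%nat ->
  exists i, (i < p)%nat /\ forall j, (j < p)%nat -> Rabs (v j) <= Rabs (v i).
Proof.
  induction p as [|p IH]; intros Hp; [lia|].
  destruct (Nat.eq_dec p 0) as [->|Hp0].
  - exists 0%nat. split; [lia|]. intros j Hj. replace j with 0%nat by lia. lra.
  - destruct IH as [i [Hi H]]; [lia|].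
    destruct (Rle_or_lt (Rabs (v p)) (Rabs (v i))) as [L|L].
    + exists i. split; [lia|]. intros j Hj. destruct (Nat.eq_dec j p) as [->|]; [assumption|].
      apply H; lia.
    + exists p. split; [lia|]. intros j Hj. destruct (Nat.eq_dec j p) as [->|]; [lra|].
      specialize (H j ltac:(lia)). lra.
Qed.

Lemma dist_span_glb (n p : nat) (f : vec -> vec) (i : nat) (x : vec) :
  is_glb (fun v => exists c : nat -> R, v = normv n (fun k => grad f i x k -
    sumR p (fun j => if Nat.eqb j i then 0 else c j * grad f j x k))) (dist_span n p f i x).
Proof.
  apply Rinf_glb.
  - eexists. exists (fun _ => 0). reflexivity.
  - intros v [c ->]. apply normv_nonneg.
Qed.

Lemma dist_span_nonneg (n p : nat) (f : vec -> vec) (i : nat) (x : vec) :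
  0 <= dist_span n p f i x.
Proof. apply (dist_span_glb n p f i x). intros v [c ->]. apply normv_nonneg. Qed.

Lemma kappa_glb (n p : nat) (f : vec -> vec) (x : vec) : (0 < p)%nat ->
  is_glb (fun v => exists i, (i < p)%nat /\ v = dist_span n p f i x) (kappa n p f x).
Proof.
  intros Hp. apply Rinf_glb.
  - eexists. exists 0%nat. split; [assumption|reflexivity].
  - intros v [i [_ ->]]. apply dist_span_nonneg.
Qed.

Lemma kappa_nonneg (n p : nat) (f : vec -> vec) (x : vec) : 0 <= kappa n p f x.
Proof.
  destruct p as [|p].
  (* For [p = 0] the set is empty and has no greatest lower bound, so [Rinf] returns its default
     value 0. *)
  - unfold kappa, Rinf. destruct (excluded_middle_informative _) as [E|_]; [|lra].
    exfalso. destruct E as [m [_ H]]. assert (m + 1 <= m); [|lra]. apply H. intros v [i [Hi _]]. lia.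
  - apply (kappa_glb n (S p) f x ltac:(lia)). intros v [i [_ ->]]. apply dist_span_nonneg.
Qed.

(** Dividing the combination of gradients by its largest weight [w_i] gives [grad f_i] minus an
    element of the span of the others, so its norm is at least [kappa]. The factor [p] comes from
    [|w| <= p |w_i|]. *)
Lemma kappa_lower (n p : nat) (f : vec -> vec) (x : vec) (w : vec) :
  kappa n p f x * normv p w <= INR p * normv n (trv p (fun j k => grad f j x k) w).
Proof.
  destruct (Rle_or_lt (normv p w) 0) as [Z|Z].
  - pose proof (normv_nonneg p w). replace (normv p w) with 0 by lra. rewrite Rmult_0_r.
    apply Rmult_le_pos; [apply pos_INR|apply normv_nonneg].
  - destruct (Nat.eq_dec p 0) as [->|Hp0].
    { exfalso. rewrite normv_zero in Z; [lra|intros; lia]. }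
    destruct (argmax_abs p w ltac:(lia)) as [i [Hi Hmax]].
    pose proof (normv_le_coord p w _ Hmax) as Hwi.
    pose proof (kappa_nonneg n p f x) as Hk0.
    assert (Hwi0 : w i <> 0).
    { intros E. rewrite E, Rabs_R0, Rmult_0_r in Hwi. lra. }
    assert (Hki : kappa n p f x <= dist_span n p f i x).
    { apply (proj1 (kappa_glb n p f x ltac:(lia))). now exists i. }
    assert (Hsp : dist_span n p f i x <= / Rabs (w i) * normv n (trv p (fun j k => grad f j x k) w)).
    { eapply Rle_trans; [apply (proj1 (dist_span_glb n p f i x)); exists (fun j => - (w j / w i)); reflexivity|].
      rewrite <- Rabs_inv, <- normv_scal. right. apply normv_ext. intros k Hk'.
      unfold trv. rewrite <- sumR_scal.
      rewrite <- (sumR_delta p i (fun j => grad f j x k)) by assumption.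
      rewrite <- sumR_minus. apply sumR_ext. intros j Hj.
      destruct (Nat.eqb_spec j i) as [->|]; field; assumption. }
    assert (Hpos : 0 < Rabs (w i)) by now apply Rabs_pos_lt.
    set (N := normv n (trv p (fun j k => grad f j x k) w)) in *.
    apply Rle_trans with (kappa n p f x * (INR p * Rabs (w i))).
    + now apply Rmult_le_compat_l.
    + replace (INR p * N) with ((/ Rabs (w i) * N) * (INR p * Rabs (w i))) by (field; lra).
      apply Rmult_le_compat_r; [|lra]. apply Rmult_le_pos; [apply pos_INR|lra].
Qed.

(** Tested on covectors, the condition changes by an explicit amount when [a] and [F] are perturbed,
    which is not visible from the infima defining [kappa]. *)
Definition nondeg_at (n p r : nat) (c D : R) (a : nat -> nat -> R) (F : vec) : Prop :=
  forall w, c * D ^ r * normv p w <= D * normv n (trv p a w) + normv p F * normv p w.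

Lemma cond_K_nondeg (n p r : nat) (Sigma : vec -> Prop) (f : vec -> vec) :
  Sigma vzero -> cond_K n p r Sigma f ->
  exists c rho, 0 < c /\ 0 < rho /\ forall x, in_Rn n x -> normv n x <= rho ->
    nondeg_at n p r c (distS n Sigma x) (fun j k => grad f j x k) (f x).
Proof.
  intros H0 [K [rho [Hrho HK]]].
  (* [K] has no prescribed sign, so it is replaced by a positive bound; [INR p + 1] absorbs the
     factor of [kappa_lower]. *)
  set (K1 := (Rabs K + 1) * (INR p + 1)).
  assert (Hp0 := pos_INR p). assert (HKa := Rabs_pos K).
  assert (HK1 : 0 < K1) by (apply Rmult_lt_0_compat; lra).
  exists (/ K1), rho. split; [now apply Rinv_0_lt_compat|]. split; [assumption|].
  intros x Hx Hn w. specialize (HK x Hx Hn).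
  pose proof (kappa_lower n p f x w) as Hkl.
  pose proof (distS_nonneg n Sigma x H0) as HD.
  set (D := distS n Sigma x) in *. set (N := normv n (trv p (fun j k => grad f j x k) w)) in *.
  pose proof (normv_nonneg p (f x)) as HF. pose proof (normv_nonneg p w) as Hw.
  assert (HN : 0 <= N) by apply normv_nonneg.
  set (W := normv p w) in *. set (F := normv p (f x)) in *. set (kp := kappa n p f x) in *.
  assert (HKle : K <= Rabs K + 1) by (pose proof (Rle_abs K); lra).
  assert (HkpW : D * (kp * W) <= D * (INR p * N)) by now apply Rmult_le_compat_l.
  assert (HDr : D ^ r * W <= K1 * (D * N + F * W)).
  { assert (Hs : 0 <= D ^ r * W) by (apply Rmult_le_pos; [now apply pow_le|assumption]).
    assert (H1 : D ^ r * W <= K * (D * (kp * W) + F * W)).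
    { replace (K * (D * (kp * W) + F * W)) with ((K * (D * kp + F)) * W) by ring.
      now apply Rmult_le_compat_r. }
    assert (HFW : 0 <= F * W) by now apply Rmult_le_pos.
    assert (HDN : 0 <= D * N) by now apply Rmult_le_pos.
    assert (Hup : D * (kp * W) + F * W <= (INR p + 1) * (D * N + F * W)) by nra.
    destruct (Rle_or_lt 0 (D * (kp * W) + F * W)) as [P|P].
    - apply Rle_trans with ((Rabs K + 1) * (D * (kp * W) + F * W)); [nra|].
      unfold K1. rewrite Rmult_assoc. apply Rmult_le_compat_l; lra.
    - exfalso. assert (0 <= D * (kp * W)); [|lra].
      repeat apply Rmult_le_pos; try assumption. apply kappa_nonneg. }
  rewrite Rmult_assoc. apply (Rmult_le_reg_l K1); [assumption|].
  rewrite <- Rmult_assoc, Rinv_r by lra. lra.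
Qed.

Lemma trv_close (n p : nat) (a a' : nat -> nat -> R) (e : R) (w : vec) :
  (forall j k, (j < p)%nat -> (k < n)%nat -> Rabs (a j k - a' j k) <= e) ->
  normv n (trv p a w) <= normv n (trv p a' w) + INR n * (INR p * e) * normv p w.
Proof.
  intros H. eapply Rle_trans; [apply (normv_le_sub n _ (trv p a' w))|]. rewrite Rplus_comm.
  apply Rplus_le_compat_l. rewrite Rmult_assoc. apply normv_le_coord. intros k Hk.
  unfold vsub, trv. rewrite <- sumR_minus. eapply Rle_trans; [apply sumR_abs|].
  rewrite Rmult_assoc, <- sumR_const. apply sumR_le. intros j Hj.
  rewrite <- Rmult_minus_distr_r, Rabs_mult.
  apply Rmult_le_compat; try apply Rabs_pos; [now apply H|now apply coord_le_normv].
Qed.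

(** The error in the differential is one power of [D] worse than that in the values, but [|a^T w|]
    enters with a factor [D]; both losses are therefore of size [e D^r |w|]. *)
Lemma nondeg_perturb (n p r : nat) (c D e : R) (a a' : nat -> nat -> R) (F F' : vec) :
  (1 <= r)%nat -> 0 <= D ->
  nondeg_at n p r c D a F ->
  (forall j, (j < p)%nat -> Rabs (F j - F' j) <= e * D ^ r) ->
  (forall j k, (j < p)%nat -> (k < n)%nat -> Rabs (a j k - a' j k) <= e * D ^ (r - 1)) ->
  nondeg_at n p r (c - (INR n * INR p + INR p) * e) D a' F'.
Proof.
  intros Hr HD H HF Ha w. specialize (H w).
  pose proof (trv_close n p a a' _ w Ha) as H1.
  assert (H2 : normv p F <= normv p F' + INR p * (e * D ^ r)).
  { eapply Rle_trans; [apply (normv_le_sub p F F')|]. rewrite Rplus_comm.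
    apply Rplus_le_compat_l. now apply normv_le_coord. }
  pose proof (normv_nonneg p w).
  assert (E : D ^ r = D * D ^ (r - 1)).
  { replace r with (S (r - 1)) at 1 by lia. reflexivity. }
  apply (Rmult_le_compat_l D) in H1; [|assumption].
  apply (Rmult_le_compat_r (normv p w)) in H2; [|assumption].
  assert (E2 : D * (normv n (trv p a' w) + INR n * (INR p * (e * D ^ (r - 1))) * normv p w)
    = D * normv n (trv p a' w) + INR n * INR p * e * D ^ r * normv p w) by (rewrite E; ring).
  rewrite E2 in H1. lra.
Qed.

Definition interp (t : R) (a b : R) : R := (1 - t) * a + t * b.

Lemma interp_close (t a b c e : R) : 0 <= t <= 1 ->
  Rabs (a - c) <= e -> Rabs (b - c) <= e -> Rabs (c - interp t a b) <= e.
Proof.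
  intros Ht Ha Hb. apply Rabs_le_between in Ha. apply Rabs_le_between in Hb.
  unfold interp. apply Rabs_le. nra.
Qed.

(** * The Gram matrix [a a^T] *)

Definition gram (n : nat) (a : nat -> nat -> R) : nat -> nat -> R := fun j l => dot n (a j) (a l).

Lemma mulv_gram (n p : nat) (a : nat -> nat -> R) (w : vec) (j : nat) :
  mulv p (gram n a) w j = dot n (a j) (trv p a w).
Proof.
  unfold mulv, gram, dot, trv.
  rewrite (sumR_ext p _ (fun l => sumR n (fun k => a j k * (a l k * w l)))).
  - rewrite sumR_swap. apply sumR_ext. intros k _. now rewrite sumR_scal.
  - intros l _. rewrite <- sumR_scal_r. apply sumR_ext. intros; ring.
Qed.

Lemma dot_gram (n p : nat) (a : nat -> nat -> R) (w : vec) :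
  dot p (mulv p (gram n a) w) w = normv n (trv p a w) ^ 2.
Proof.
  rewrite normv_dot. unfold dot at 1.
  rewrite (sumR_ext p _ (fun j => sumR n (fun k => a j k * w j * trv p a w k))).
  - rewrite sumR_swap. unfold dot. apply sumR_ext. intros k _. rewrite sumR_scal_r. reflexivity.
  - intros j _. rewrite mulv_gram. unfold dot. rewrite <- sumR_scal_r. apply sumR_ext. intros; ring.
Qed.

Lemma trv_bound (n p : nat) (a : nat -> nat -> R) :
  exists Lam, 0 <= Lam /\ forall w, normv n (trv p a w) <= Lam * normv p w.
Proof. exact (mulv_bound n p (fun k j => a j k)). Qed.

Lemma trv_sub (p : nat) (a : nat -> nat -> R) (w w' : vec) (k : nat) :
  trv p a (vsub w w') k = trv p a w k - trv p a w' k.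
Proof. exact (mulv_sub p (fun k j => a j k) w w' k). Qed.

(** * The case of a submersion *)

(** Strict differentiability at the origin with a fixed tolerance: each component of [g - a] is
    [eta]-Lipschitz on the ball. *)
Definition strict_diff (n p : nat) (a : nat -> nat -> R) (eta rho : R) (g : vec -> vec) : Prop :=
  forall x y, in_Rn n x -> in_Rn n y -> normv n x < rho -> normv n y < rho ->
  forall j, (j < p)%nat ->
    Rabs (g x j - g y j - dot n (a j) (vsub x y)) <= eta * normv n (vsub x y).

(** The displacement [a^T s] is transversal to the fibres when [a] is surjective. The relation is
    symmetric under exchanging both the points and the functions, so each estimate also serves the
    inverse. *)
Definition slide (n p : nat) (a : nat -> nat -> R) (rho : R) (g h : vec -> vec) (x y : vec) : Prop :=
  in_Rn n x /\ in_Rn n y /\ normv n x < rho /\ normv n y < rho /\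
  (exists s, forall k, (k < n)%nat -> y k = x k + trv p a s k) /\
  forall j, (j < p)%nat -> h y j = g x j.

Lemma slide_sym (n p : nat) (a : nat -> nat -> R) (rho : R) (g h : vec -> vec) (x y : vec) :
  slide n p a rho g h x y -> slide n p a rho h g y x.
Proof.
  intros [Hx [Hy [Bx [By [[s Hs] He]]]]]. repeat (split; [assumption|]). split.
  - exists (vsub vzero s). intros k Hk. rewrite Hs by assumption. rewrite trv_sub.
    replace (trv p a vzero k) with 0; [ring|].
    symmetry. apply sumR_zero. intros; unfold vzero; ring.
  - intros j Hj. symmetry. now apply He.
Qed.

(** For two slides with [z = s' - s], the equations [h y = g x] cancel the values and leave
    [a a^T z] as a difference of two strict differentiability remainders. Coercivity gives
    [m |z| <= p eta (2 dx + Lam |z|)]; absorbing the last term costs [m / 2] and yields the factor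
    4. *)
Lemma slide_lip (n p : nat) (a : nat -> nat -> R) (m Lam eta rho : R) (g h : vec -> vec) :
  0 < m -> 0 <= Lam -> 0 <= eta ->
  coercive p (gram n a) m -> (forall w, normv n (trv p a w) <= Lam * normv p w) ->
  INR p * eta * Lam <= m / 2 ->
  strict_diff n p a eta rho g -> strict_diff n p a eta rho h ->
  forall x y x' y', slide n p a rho g h x y -> slide n p a rho g h x' y' ->
    normv n (vsub y' y) <= (1 + Lam * (4 * INR p * eta / m)) * normv n (vsub x' x).
Proof.
  intros Hm HLam Heta Hco HL Hsm Hg Hh x y x' y'
    [Hx [Hy [Bx [By [[s Hs] He]]]]] [Hx' [Hy' [Bx' [By' [[s' Hs'] He']]]]].
  set (z := vsub s' s). set (dx := normv n (vsub x' x)).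
  assert (Hdy : forall k, (k < n)%nat -> vsub y' y k = vsub x' x k + trv p a z k).
  { intros k Hk. unfold z. rewrite trv_sub. unfold vsub. rewrite Hs, Hs' by assumption. ring. }
  assert (Hndy : normv n (vsub y' y) <= dx + Lam * normv p z).
  { rewrite (normv_ext n _ (fun k => vsub x' x k + trv p a z k)) by assumption.
    eapply Rle_trans; [apply normv_triang|]. specialize (HL z). unfold dx. lra. }
  assert (HB : normv p (mulv p (gram n a) z) <= INR p * (eta * (2 * dx + Lam * normv p z))).
  { apply normv_le_coord. intros j Hj.
    pose proof (Hh y' y Hy' Hy By' By j Hj) as E1. pose proof (Hg x' x Hx' Hx Bx' Bx j Hj) as E2.
    rewrite He, He' in E1 by assumption.
    assert (Ed : dot n (a j) (vsub y' y) = dot n (a j) (vsub x' x) + mulv p (gram n a) z j).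
    { rewrite mulv_gram. unfold dot. rewrite <- sumR_plus. apply sumR_ext. intros k Hk.
      rewrite Hdy by assumption. ring. }
    rewrite Ed in E1. fold dx in E2.
    replace (mulv p (gram n a) z j) with
      ((g x' j - g x j - dot n (a j) (vsub x' x)) -
       (g x' j - g x j - (dot n (a j) (vsub x' x) + mulv p (gram n a) z j))) by ring.
    eapply Rle_trans; [apply Rabs_triang|]. rewrite Rabs_Ropp.
    assert (eta * normv n (vsub y' y) <= eta * (dx + Lam * normv p z))
      by (apply Rmult_le_compat_l; assumption).
    lra. }
  pose proof (coercive_lower p (gram n a) m z Hco) as Hlow.
  pose proof (normv_nonneg p z) as Hz.
  assert (Hzb : normv p z <= 4 * INR p * eta / m * dx).
  { apply (Rmult_le_reg_l (m / 2)); [lra|].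
    replace (m / 2 * (4 * INR p * eta / m * dx)) with (INR p * eta * (2 * dx)) by (field; lra).
    assert (INR p * eta * Lam * normv p z <= m / 2 * normv p z) by now apply Rmult_le_compat_r.
    lra. }
  apply (Rmult_le_compat_l Lam) in Hzb; [|assumption]. lra.
Qed.

(** Simplified Newton iteration [s - tau (h (x + a^T s) - g x)]: its linear part [1 - tau a a^T] has
    ratio [q], and the nonlinear remainder uses at most half of the gap [1 - q]. *)
Lemma slide_exists (n p : nat) (a : nat -> nat -> R) (Lam eta tau q rho : R) (g h : vec -> vec) :
  0 <= Lam -> 0 <= eta -> 0 < rho -> 0 < tau -> 0 <= q < 1 ->
  (forall w, normv n (trv p a w) <= Lam * normv p w) ->
  (forall z, normv p (fun j => z j - tau * mulv p (gram n a) z j) <= q * normv p z) ->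
  tau * (INR p * (eta * Lam)) <= (1 - q) / 2 ->
  strict_diff n p a eta rho g -> strict_diff n p a eta rho h ->
  (forall j, (j < p)%nat -> g vzero j = 0) -> (forall j, (j < p)%nat -> h vzero j = 0) ->
  exists rho', 0 < rho' /\ rho' <= rho /\ forall x, in_Rn n x -> normv n x < rho' ->
    exists y, slide n p a rho g h x y.
Proof.
  intros HLam Heta Hrho Htau Hq HL Hc Hsm Hg Hh Hg0 Hh0.
  (* With [|s| <= sig] the displacement stays below [rho / 2], so [x + a^T s] remains in the
     ball. *)
  set (sig := rho / (2 * (Lam + 1))).
  assert (Hsig : 0 < sig) by (apply Rdiv_lt_0_compat; lra).
  assert (HLs : Lam * sig < rho / 2).
  { assert (E : (Lam + 1) * sig = rho / 2) by (unfold sig; field; lra). lra. }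
  set (q' := (1 + q) / 2).
  set (den := tau * (INR p * (2 * eta)) + 1).
  assert (Hden : 0 < den).
  { unfold den. assert (0 <= tau * (INR p * (2 * eta))); [|lra].
    apply Rmult_le_pos; [lra|]. apply Rmult_le_pos; [apply pos_INR|lra]. }
  (* The second bound makes the first iterate, of size at most [tau p 2 eta |x|], fit into
     [(1 - q') sig]. *)
  exists (Rmin (rho / 2) ((1 - q') * sig / den)).
  split; [apply Rmin_pos; [lra|]; apply Rdiv_lt_0_compat; [|assumption]; apply Rmult_lt_0_compat; unfold q'; lra|].
  split; [eapply Rle_trans; [apply Rmin_l|lra]|].
  intros x Hx Hxn.
  pose proof (Rlt_le_trans _ _ _ Hxn (Rmin_l _ _)) as B1.
  pose proof (Rlt_le_trans _ _ _ Hxn (Rmin_r _ _)) as B2.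
  set (pt := fun s : vec => fun k => if Nat.ltb k n then x k + trv p a s k else 0).
  assert (Hpt : forall s, in_Rn n (pt s)).
  { intros s k Hk. unfold pt. destruct (Nat.ltb_spec k n); [lia|reflexivity]. }
  assert (Hptk : forall s k, (k < n)%nat -> pt s k = x k + trv p a s k).
  { intros s k Hk. unfold pt. destruct (Nat.ltb_spec k n); [reflexivity|lia]. }
  assert (Bpt : forall s, normv p s <= sig -> normv n (pt s) < rho).
  { intros s Hs. rewrite (normv_ext n _ (fun k => x k + trv p a s k)) by apply Hptk.
    eapply Rle_lt_trans; [apply normv_triang|]. specialize (HL s).
    assert (Lam * normv p s <= Lam * sig) by now apply Rmult_le_compat_l. lra. }
  set (T := fun s : vec => fun j => s j - tau * (h (pt s) j - g x j)).
  destruct (contraction_fixed_point p T sig q') as [s [Hs Hfix]].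
  - lra.
  - unfold q'; lra.
  - intros s s' Hs Hs'. set (z := vsub s s').
    assert (Hdp : forall k, (k < n)%nat -> vsub (pt s) (pt s') k = trv p a z k).
    { intros k Hk. unfold z. rewrite trv_sub. unfold vsub. rewrite !Hptk by assumption. ring. }
    rewrite (normv_ext p _ (fun j => (z j - tau * mulv p (gram n a) z j)
       + (- tau) * (h (pt s) j - h (pt s') j - mulv p (gram n a) z j)))
      by (intros; unfold z, T, vsub; ring).
    eapply Rle_trans; [apply normv_triang|]. rewrite normv_scal, Rabs_Ropp, (Rabs_pos_eq tau) by lra.
    assert (He : normv p (fun j => h (pt s) j - h (pt s') j - mulv p (gram n a) z j)
              <= INR p * (eta * Lam * normv p z)).
    { apply normv_le_coord. intros j Hj.
      pose proof (Hh (pt s) (pt s') (Hpt s) (Hpt s') (Bpt s Hs) (Bpt s' Hs') j Hj) as E.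
      rewrite (normv_ext n _ _ Hdp) in E.
      replace (dot n (a j) (vsub (pt s) (pt s'))) with (mulv p (gram n a) z j) in E.
      - eapply Rle_trans; [exact E|]. rewrite Rmult_assoc. apply Rmult_le_compat_l; [assumption|apply HL].
      - rewrite mulv_gram. apply sumR_ext. intros k Hk. now rewrite Hdp. }
    apply (Rmult_le_compat_l tau) in He; [|lra].
    apply (Rmult_le_compat_r (normv p z)) in Hsm; [|apply normv_nonneg].
    specialize (Hc z). fold z. unfold q'. lra.
  - assert (E0 : pt vzero = x).
    { apply functional_extensionality. intros k. unfold pt.
      destruct (Nat.ltb_spec k n) as [Hk|Hk]; [|symmetry; now apply Hx].
      replace (trv p a vzero k) with 0; [ring|].
      symmetry. apply sumR_zero. intros; unfold vzero; ring. }
    unfold T. rewrite E0.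
    rewrite (normv_ext p _ (fun j => (- tau) * (h x j - g x j))) by (intros; unfold vzero; ring).
    rewrite normv_scal, Rabs_Ropp, (Rabs_pos_eq tau) by lra.
    assert (He : normv p (fun j => h x j - g x j) <= INR p * (2 * eta * normv n x)).
    { apply normv_le_coord. intros j Hj.
      pose proof (Hh x vzero Hx (in_Rn_vzero n) ltac:(lra) ltac:(rewrite normv_vzero; lra) j Hj) as E1.
      pose proof (Hg x vzero Hx (in_Rn_vzero n) ltac:(lra) ltac:(rewrite normv_vzero; lra) j Hj) as E2.
      rewrite normv_sub_zero in E1, E2. rewrite Hh0 in E1 by assumption. rewrite Hg0 in E2 by assumption.
      replace (h x j - g x j) with ((h x j - 0 - dot n (a j) (vsub x vzero))
        - (g x j - 0 - dot n (a j) (vsub x vzero))) by ring.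
      eapply Rle_trans; [apply Rabs_triang|]. rewrite Rabs_Ropp. lra. }
    apply (Rmult_le_compat_l tau) in He; [|lra].
    apply (Rmult_lt_compat_l den) in B2; [|assumption].
    replace (den * ((1 - q') * sig / den)) with ((1 - q') * sig) in B2 by (field; lra).
    unfold den in B2. pose proof (normv_nonneg n x). lra.
  - exists (pt s). split; [assumption|]. split; [apply Hpt|]. split; [lra|]. split; [now apply Bpt|].
    split; [exists s; apply Hptk|].
    intros j Hj. specialize (Hfix j Hj). unfold T in Hfix.
    assert (tau * (h (pt s) j - g x j) = 0) by lra. nra.
Qed.

Lemma SigmaV_equiv_submersion (n p : nat) (Sigma : vec -> Prop) (a : nat -> nat -> R) (m rj : R)
    (g h : vec -> vec) :
  0 < m -> Sigma vzero -> coercive p (gram n a) m ->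
  (forall eta, 0 < eta -> exists rho, 0 < rho /\ strict_diff n p a eta rho g) ->
  (forall eta, 0 < eta -> exists rho, 0 < rho /\ strict_diff n p a eta rho h) ->
  (forall j, (j < p)%nat -> g vzero j = 0) ->
  0 < rj -> (forall x, Sigma x -> normv n x < rj -> forall j, (j < p)%nat -> g x j = h x j) ->
  SigmaV_equiv n p Sigma g h.
Proof.
  intros Hm H0 Hco Hg Hh Hg0 Hrj Hgh.
  assert (Hh0 : forall j, (j < p)%nat -> h vzero j = 0).
  { intros j Hj. rewrite <- (Hgh vzero H0) by (try assumption; now rewrite normv_vzero). now apply Hg0. }
  destruct (coercive_contract p (gram n a) m Hm Hco) as [tau [q [Htau [Hq Hc]]]].
  destruct (trv_bound n p a) as [Lam [HLam HL]].
  assert (Hp := pos_INR p).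
  assert (Hex : forall A B, 0 <= A -> 0 < B -> exists e, 0 < e /\ A * e <= B).
  { intros A B HA HB. exists (B / (A + 1)). split; [apply Rdiv_lt_0_compat; lra|].
    assert (E : (A + 1) * (B / (A + 1)) = B) by (field; lra).
    assert (0 < B / (A + 1)) by (apply Rdiv_lt_0_compat; lra). lra. }
  destruct (Hex (INR p * Lam) (m / 2)) as [e1 [He1 K1]]; [now apply Rmult_le_pos|lra|].
  destruct (Hex (tau * (INR p * Lam)) ((1 - q) / 2)) as [e2 [He2 K2]];
    [apply Rmult_le_pos; [lra|now apply Rmult_le_pos]|lra|].
  set (eta := Rmin e1 e2). assert (Heta : 0 < eta) by now apply Rmin_pos.
  assert (L1 : INR p * eta * Lam <= m / 2).
  { assert (INR p * Lam * eta <= INR p * Lam * e1); [|lra].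
    apply Rmult_le_compat_l; [now apply Rmult_le_pos|apply Rmin_l]. }
  assert (L2 : tau * (INR p * (eta * Lam)) <= (1 - q) / 2).
  { assert (tau * (INR p * Lam) * eta <= tau * (INR p * Lam) * e2); [|lra].
    apply Rmult_le_compat_l; [apply Rmult_le_pos; [lra|now apply Rmult_le_pos]|apply Rmin_r]. }
  destruct (Hg eta Heta) as [r1 [Hr1 D1]]. destruct (Hh eta Heta) as [r2 [Hr2 D2]].
  set (rho := Rmin r1 r2). assert (Hrho : 0 < rho) by now apply Rmin_pos.
  assert (Dg : strict_diff n p a eta rho g).
  { intros x y Hx Hy Bx By. apply D1; auto; (eapply Rlt_le_trans; [eassumption|apply Rmin_l]). }
  assert (Dh : strict_diff n p a eta rho h).
  { intros x y Hx Hy Bx By. apply D2; auto; (eapply Rlt_le_trans; [eassumption|apply Rmin_r]). }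
  destruct (slide_exists n p a Lam eta tau q rho g h) as [s1 [Hs1 [Bs1 X1]]]; auto; [lra|].
  destruct (slide_exists n p a Lam eta tau q rho h g) as [s2 [Hs2 [Bs2 X2]]]; auto; [lra|].
  set (rf := Rmin (Rmin s1 s2) rj).
  assert (F1 : rf <= s1) by (eapply Rle_trans; [apply Rmin_l|apply Rmin_l]).
  assert (F2 : rf <= s2) by (eapply Rle_trans; [apply Rmin_l|apply Rmin_r]).
  assert (F3 : rf <= rj) by apply Rmin_r.
  set (Cst := 1 + Lam * (4 * INR p * eta / m)).
  assert (HCst : 0 < Cst).
  { unfold Cst. assert (0 <= Lam * (4 * INR p * eta / m)); [|lra].
    apply Rmult_le_pos; [assumption|]. apply Rdiv_le_0_compat; [|assumption].
    apply Rmult_le_pos; lra. }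
  assert (Hcont : forall g h, strict_diff n p a eta rho g -> strict_diff n p a eta rho h ->
    forall x y, slide n p a rho g h x y -> forall eps, 0 < eps -> exists d, 0 < d /\
     forall x' y', slide n p a rho g h x' y' ->
       normv n (vsub x' x) < d -> normv n (vsub y' y) < eps).
  { clear - Hm Hco HL HLam Heta L1 HCst. intros g h Dg Dh x y HR eps Heps. exists (eps / Cst).
    split; [now apply Rdiv_lt_0_compat|]. intros x' y' HR' Hd.
    eapply Rle_lt_trans; [apply (slide_lip n p a m Lam eta rho g h) with (x := x) (x' := x'); auto; lra|].
    fold Cst. apply (Rmult_lt_compat_l Cst) in Hd; [|assumption].
    replace (Cst * (eps / Cst)) with eps in Hd by (field; lra). exact Hd. }
  apply (SigmaV_equiv_of_rel n p Sigma g h (slide n p a rho g h) rf).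
  - unfold rf. repeat apply Rmin_pos; assumption.
  - assumption.
  - intros x y [Hx [Hy _]]. now split.
  - intros x Hx Hn. apply X1; [assumption|lra].
  - intros y Hy Hn. destruct (X2 y Hy ltac:(lra)) as [x Hx]. exists x. now apply slide_sym.
  - intros x y HR _ eps Heps. destruct (Hcont g h Dg Dh x y HR eps Heps) as [d [Hd K]].
    exists d. split; [assumption|]. intros x' y' HR' _. now apply K.
  - intros x y HR _ eps Heps.
    destruct (Hcont h g Dh Dg y x (slide_sym _ _ _ _ _ _ _ _ HR) eps Heps) as [d [Hd K]].
    exists d. split; [assumption|]. intros x' y' HR' _. apply K. now apply slide_sym.
  - intros x y HR _ _. destruct HR as [_ [_ [_ [_ [_ He]]]]].
    split; intros H j Hj; [rewrite He by assumption|rewrite <- He by assumption]; now apply H.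
  - intros x HS Hx Hn. split; [assumption|]. split; [assumption|]. split; [lra|]. split; [lra|]. split.
    + exists vzero. intros k Hk.
      replace (trv p a vzero k) with 0; [ring|].
      symmetry. apply sumR_zero. intros; unfold vzero; ring.
    + intros j Hj. symmetry. apply Hgh; auto. lra.
Qed.

Lemma C1_strict_diff (n p r : nat) (a : nat -> nat -> R) (g : vec -> vec) :
  (1 <= r)%nat -> in_E n p r g ->
  (forall j k, (j < p)%nat -> (k < n)%nat -> grad g j vzero k = a j k) ->
  forall eta, 0 < eta -> exists rho, 0 < rho /\ strict_diff n p a eta rho g.
Proof.
  intros Hr [_ [rg [Hrg Hg]]] Ha eta Heta.
  set (e := eta / (INR n + 1)). assert (Hn := pos_INR n).
  assert (He : 0 < e) by (apply Rdiv_lt_0_compat; lra).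
  assert (Ee : INR n * e <= eta).
  { assert ((INR n + 1) * e = eta) by (unfold e; field; lra). lra. }
  assert (Hgrad : forall j, (j < p)%nat -> C1grad n rg (fun x => g x j) (fun k x => grad g j x k)).
  { intros j Hj. apply (C1grad_pdiff n r rg (fun x => g x j) nil); auto; simpl; lia. }
  destruct (finite_radius p (fun j d => forall k, (k < n)%nat -> forall z, in_Rn n z -> normv n z < d ->
     Rabs (grad g j z k - a j k) <= e)) as [d [Hd K]].
  - intros j u v H _ Huv k Hk z Hz Hzn. apply H; auto. lra.
  - intros j Hj.
    apply (finite_radius n (fun k d => forall z, in_Rn n z -> normv n z < d ->
     Rabs (grad g j z k - a j k) <= e)).
    + intros k u v H _ Huv z Hz Hzn. apply H; auto. lra.
    + intros k Hk.
      destruct (Hgrad j Hj vzero (in_Rn_vzero n) ltac:(unfold ball; now rewrite normv_vzero) k Hk) as [_ Hc].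
      destruct (Hc e He) as [d [Hd K]]. exists d. split; [assumption|].
      intros z Hz Hzn. rewrite <- Ha by assumption. left. apply K; [assumption|].
      now rewrite normv_sub_zero.
  - exists (Rmin d rg). split; [now apply Rmin_pos|]. intros x y Hx Hy Bx By j Hj.
    assert (HC : C1grad n (Rmin d rg) (fun x => g x j) (fun k x => grad g j x k)).
    { intros z Hz Bz. apply Hgrad; [assumption|assumption|].
      eapply Rlt_le_trans; [exact Bz|apply Rmin_r]. }
    destruct (C1grad_MVT n _ _ _ y x HC Hy Hx By Bx) as [z [Hz [Bz [_ E]]]].
    rewrite E. unfold dot. rewrite <- sumR_minus.
    eapply Rle_trans; [apply sumR_abs|].
    apply Rle_trans with (INR n * (e * normv n (vsub x y))).
    + rewrite <- sumR_const. apply sumR_le. intros k Hk.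
      unfold vsub at 1. rewrite <- Rmult_minus_distr_r, Rabs_mult.
      apply Rmult_le_compat; try apply Rabs_pos.
      * apply K; auto. eapply Rlt_le_trans; [exact Bz|apply Rmin_l].
      * apply (coord_le_normv n (vsub x y)); assumption.
    + rewrite <- Rmult_assoc. apply Rmult_le_compat_r; [apply normv_nonneg|assumption].
Qed.

Lemma V_sufficient_order_one (n p : nat) (Sigma : vec -> Prop) (f : vec -> vec) :
  (forall x, Sigma x -> in_Rn n x) -> closed_n n Sigma -> Sigma vzero ->
  in_E n p 1 f -> cond_K n p 1 Sigma f -> V_sufficient n p 1 Sigma f.
Proof.
  intros HS Hcl H0 Hf [K [rho [Hrho HK]]] g h Hg Hh Jg Jh.
  set (K1 := Rabs K + 1). assert (HKa := Rabs_pos K).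
  assert (HK1 : 0 < K1) by (unfold K1; lra).
  assert (HKle : K <= K1) by (unfold K1; pose proof (Rle_abs K); lra).
  assert (Hp := pos_INR p). assert (Hn := pos_INR n).
  assert (Jnil : forall g, jet_eq n p 1 Sigma f g -> exists d, 0 < d /\
     forall x, Sigma x -> normv n x < d -> forall j, (j < p)%nat -> f x j = g x j).
  { intros u [d [Hd J]]. exists d. split; [assumption|]. intros x Hx Hxn j Hj.
    apply (J x Hx Hxn nil); [constructor|simpl; lia|assumption]. }
  destruct (Jnil g Jg) as [dg [Hdg Ig]]. destruct (Jnil h Jh) as [dh [Hdh Ih]].
  (* At the threshold [1 / (2 K1)] the term [K1 D kappa] is at most [D / 2], which the left side of
     the condition absorbs. *)
  destruct (classic (exists d, 0 < d /\ forall x, in_Rn n x -> normv n x < d ->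
                       kappa n p f x <= / (2 * K1))) as [[d [Hd Hsmall]]|Hbig].
  (* At a zero of a realisation [u] one has [|f| = |f - u| <= p e D], and [e] is chosen so that
     [K1 |f| <= D / 4]. Altogether [D <= 3 D / 4], hence [D = 0]. *)
  - assert (Hin : forall u, in_E n p 1 u -> jet_eq n p 1 Sigma f u -> exists d, 0 < d /\
       forall x, in_Rn n x -> normv n x < d -> (forall j, (j < p)%nat -> u x j = 0) -> Sigma x).
    { intros u Hu Ju. set (e := / (4 * K1 * (INR p + 1))).
      assert (Hden : 0 < 4 * K1 * (INR p + 1)) by (apply Rmult_lt_0_compat; lra).
      assert (He : 0 < e) by now apply Rinv_0_lt_compat.
      destruct (flat_estimate n p 1 Sigma f u HS Hcl H0 (Nat.le_refl 1) Hf Hu Ju e He) as [d' [Hd' Fl]].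
      exists (Rmin (Rmin d d') rho). split; [repeat apply Rmin_pos; assumption|].
      intros x Hx Hxn Hz.
      assert (B1 : normv n x < d) by
        (eapply Rlt_le_trans; [exact Hxn|eapply Rle_trans; [apply Rmin_l|apply Rmin_l]]).
      assert (B2 : normv n x < d') by
        (eapply Rlt_le_trans; [exact Hxn|eapply Rle_trans; [apply Rmin_l|apply Rmin_r]]).
      assert (B3 : normv n x < rho) by (eapply Rlt_le_trans; [exact Hxn|apply Rmin_r]).
      specialize (HK x Hx ltac:(lra)). specialize (Hsmall x Hx B1).
      assert (HF : normv p (f x) <= INR p * (e * distS n Sigma x)).
      { apply normv_le_coord. intros j Hj. destruct (Fl x Hx B2 j Hj) as [E _].
        rewrite Hz in E by assumption. rewrite pow_1, Rabs_minus_sym, Rminus_0_r in E. exact E. }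
      pose proof (distS_nonneg n Sigma x H0) as HD. pose proof (kappa_nonneg n p f x) as Hk0.
      pose proof (normv_nonneg p (f x)) as HF0.
      rewrite pow_1 in HK. set (D := distS n Sigma x) in *. set (F := normv p (f x)) in *.
      apply (distS_zero n); auto. fold D.
      assert (H1 : D <= K1 * (D * kappa n p f x + F)).
      { eapply Rle_trans; [exact HK|]. apply Rmult_le_compat_r; [|assumption].
        assert (0 <= D * kappa n p f x) by now apply Rmult_le_pos. lra. }
      assert (H2 : K1 * (D * kappa n p f x) <= D / 2).
      { apply Rle_trans with (K1 * (D * / (2 * K1))).
        - apply Rmult_le_compat_l; [lra|]. now apply Rmult_le_compat_l.
        - right. field. lra. }
      assert (H3 : K1 * F <= D / 4).
      { apply Rle_trans with (K1 * ((INR p + 1) * (e * D))).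
        - apply Rmult_le_compat_l; [lra|]. assert (0 <= e * D) by (apply Rmult_le_pos; lra). lra.
        - right. unfold e. field. lra. }
      lra. }
    destruct (Hin g Hg Jg) as [d1 [Hd1 Z1]]. destruct (Hin h Hh Jh) as [d2 [Hd2 Z2]].
    apply (SigmaV_equiv_of_rel n p Sigma g h (fun x y => in_Rn n x /\ y = x)
             (Rmin (Rmin d1 d2) (Rmin dg dh))).
    + repeat apply Rmin_pos; assumption.
    + assumption.
    + intros x y [Hx ->]. now split.
    + intros x Hx _. now exists x.
    + intros y Hy _. now exists y.
    + intros x y [Hx ->] _ eps Heps. exists eps. split; [assumption|]. intros x' y' [_ ->]. auto.
    + intros x y [Hx ->] _ eps Heps. exists eps. split; [assumption|]. intros x' y' [_ ->]. auto.
    + intros x y [Hx ->] Hxn _.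
      assert (B1 : normv n x < d1) by
        (eapply Rlt_le_trans; [exact Hxn|eapply Rle_trans; [apply Rmin_l|apply Rmin_l]]).
      assert (B2 : normv n x < d2) by
        (eapply Rlt_le_trans; [exact Hxn|eapply Rle_trans; [apply Rmin_l|apply Rmin_r]]).
      assert (B3 : normv n x < dg) by
        (eapply Rlt_le_trans; [exact Hxn|eapply Rle_trans; [apply Rmin_r|apply Rmin_l]]).
      assert (B4 : normv n x < dh) by
        (eapply Rlt_le_trans; [exact Hxn|eapply Rle_trans; [apply Rmin_r|apply Rmin_r]]).
      split; intros H j Hj.
      * rewrite <- Ih, Ig by (auto; now apply Z1). now apply H.
      * rewrite <- Ig, Ih by (auto; now apply Z2). now apply H.
    + intros x _ Hx _. now split.
  - set (a := fun j k => grad f j vzero k).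
    set (k0 := / (2 * K1)). assert (Hk0 : 0 < k0) by (apply Rinv_0_lt_compat; lra).
    (* A point with [kappa > k0] is picked where the gradients are within [e] of those at the
       origin. Passing to the origin costs at most [k0 / 2] because [n p^2 e <= k0 / 2]; the factor
       [p + 1] comes from [kappa_lower]. *)
    assert (Hnu : forall w, k0 / (2 * (INR p + 1)) * normv p w <= normv n (trv p a w)).
    { set (e := k0 / (2 * (INR n * INR p * INR p + 1))).
      assert (Hnp : 0 <= INR n * INR p * INR p) by (repeat apply Rmult_le_pos; assumption).
      assert (He : 0 < e) by (apply Rdiv_lt_0_compat; lra).
      assert (Ee : INR n * INR p * INR p * e <= k0 / 2).
      { assert ((INR n * INR p * INR p + 1) * e = k0 / 2) by (unfold e; field; lra). lra. }
      destruct Hf as [_ [rf [Hrf Hf]]].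
      destruct (finite_radius p (fun j d => forall k, (k < n)%nat -> forall z, in_Rn n z -> normv n z < d ->
         Rabs (grad f j z k - a j k) <= e)) as [d [Hd Hc]].
      { intros j u v H _ Huv k Hk z Hz Hzn. apply H; auto. lra. }
      { intros j Hj. apply (finite_radius n (fun k d => forall z, in_Rn n z -> normv n z < d ->
         Rabs (grad f j z k - a j k) <= e)).
        - intros k u v H _ Huv z Hz Hzn. apply H; auto. lra.
        - intros k Hk.
          destruct (Hf j Hj (k :: nil) ltac:(repeat constructor; assumption) ltac:(simpl; lia)
             vzero (in_Rn_vzero n) ltac:(unfold ball; now rewrite normv_vzero)) as [Hc _].
          destruct (Hc e He) as [d [Hd Kd]]. exists d. split; [assumption|].
          intros z Hz Hzn. left. apply Kd; [assumption|]. now rewrite normv_sub_zero. }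
      assert (Hx : exists x, in_Rn n x /\ normv n x < d /\ k0 < kappa n p f x).
      { apply NNPP. intros C. apply Hbig. exists d. split; [assumption|]. intros x Hx Hxn.
        destruct (Rle_or_lt (kappa n p f x) k0) as [L|L]; [assumption|].
        exfalso. apply C. now exists x. }
      destruct Hx as [x [Hx [Hxn Hkx]]]. intros w.
      pose proof (kappa_lower n p f x w) as Hl.
      pose proof (trv_close n p (fun j k => grad f j x k) a e w
        ltac:(intros j k Hj Hk; apply Hc; assumption)) as Ht.
      pose proof (normv_nonneg p w) as Hw.
      assert (H1 : k0 * normv p w <= kappa n p f x * normv p w) by (apply Rmult_le_compat_r; lra).
      apply (Rmult_le_compat_l (INR p)) in Ht; [|assumption].
      apply (Rmult_le_compat_r (normv p w)) in Ee; [|assumption].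
      pose proof (normv_nonneg n (trv p a w)) as HN.
      apply (Rmult_le_reg_l (INR p + 1)); [lra|].
      replace ((INR p + 1) * (k0 / (2 * (INR p + 1)) * normv p w)) with (k0 / 2 * normv p w) by (field; lra).
      lra. }
    set (nu := k0 / (2 * (INR p + 1))) in *.
    assert (Hnu0 : 0 < nu) by (apply Rdiv_lt_0_compat; lra).
    assert (Hgr : forall u, jet_eq n p 1 Sigma f u ->
       forall j k, (j < p)%nat -> (k < n)%nat -> grad u j vzero k = a j k).
    { intros u [d [Hd J]] j k Hj Hk. symmetry.
      apply (J vzero H0 ltac:(now rewrite normv_vzero) (k :: nil)); [now repeat constructor|simpl; lia|assumption]. }
    apply (SigmaV_equiv_submersion n p Sigma a (nu ^ 2) (Rmin dg dh)).
    + apply pow_lt; assumption.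
    + assumption.
    + intros w. rewrite dot_gram, <- Rpow_mult_distr. apply pow_incr.
      split; [apply Rmult_le_pos; [lra|apply normv_nonneg]|apply Hnu].
    + apply C1_strict_diff with 1%nat; auto.
    + apply C1_strict_diff with 1%nat; auto.
    + apply Hg.
    + now apply Rmin_pos.
    + intros x Hx Hxn j Hj. rewrite <- Ig, <- Ih; auto;
        (eapply Rlt_le_trans; [exact Hxn|]); [apply Rmin_r|apply Rmin_l].
Qed.

(** * Bounded Lipschitz functions *)

(** Boundedness is built in because Lipschitz functions alone are not closed under products. *)
Definition BL {Z : Type} (dst : Z -> Z -> R) (phi : Z -> R) : Prop :=
  exists L, forall z z', Rabs (phi z) <= L /\ Rabs (phi z - phi z') <= L * dst z z'.

Lemma BL_const {Z : Type} (dst : Z -> Z -> R) (c : R) :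
  (forall z z', 0 <= dst z z') -> BL dst (fun _ => c).
Proof.
  intros Hd. exists (Rabs c). intros z z'. split; [lra|]. rewrite Rminus_diag, Rabs_R0.
  apply Rmult_le_pos; [apply Rabs_pos|apply Hd].
Qed.

Lemma BL_plus {Z : Type} (dst : Z -> Z -> R) (phi psi : Z -> R) :
  BL dst phi -> BL dst psi -> BL dst (fun z => phi z + psi z).
Proof.
  intros [L H] [M K]. exists (L + M). intros z z'.
  destruct (H z z') as [H1 H2], (K z z') as [K1 K2]. split.
  - eapply Rle_trans; [apply Rabs_triang|]. lra.
  - replace (phi z + psi z - (phi z' + psi z')) with ((phi z - phi z') + (psi z - psi z')) by ring.
    eapply Rle_trans; [apply Rabs_triang|]. lra.
Qed.

Lemma BL_mult {Z : Type} (dst : Z -> Z -> R) (phi psi : Z -> R) :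
  (forall z z', 0 <= dst z z') ->
  BL dst phi -> BL dst psi -> BL dst (fun z => phi z * psi z).
Proof.
  intros Hd [L H] [M K]. exists (L * M + L * M). intros z z'.
  destruct (H z z') as [H1 H2], (K z z') as [K1 K2]. destruct (H z' z) as [H3 _].
  specialize (Hd z z').
  pose proof (Rabs_pos (phi z)). pose proof (Rabs_pos (psi z)). pose proof (Rabs_pos (phi z')).
  assert (0 <= L * M) by (apply Rmult_le_pos; lra).
  split.
  - rewrite Rabs_mult. assert (Rabs (phi z) * Rabs (psi z) <= L * M) by (apply Rmult_le_compat; lra). lra.
  - replace (phi z * psi z - phi z' * psi z') with ((phi z - phi z') * psi z + phi z' * (psi z - psi z')) by ring.
    eapply Rle_trans; [apply Rabs_triang|]. rewrite !Rabs_mult.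
    assert (Rabs (phi z - phi z') * Rabs (psi z) <= (L * dst z z') * M)
      by (apply Rmult_le_compat; try apply Rabs_pos; lra).
    assert (Rabs (phi z') * Rabs (psi z - psi z') <= L * (M * dst z z'))
      by (apply Rmult_le_compat; try apply Rabs_pos; lra).
    lra.
Qed.

Lemma BL_opp {Z : Type} (dst : Z -> Z -> R) (phi : Z -> R) :
  BL dst phi -> BL dst (fun z => - phi z).
Proof.
  intros [L H]. exists L. intros z z'. destruct (H z z') as [H1 H2]. rewrite Rabs_Ropp.
  split; [assumption|]. replace (- phi z - - phi z') with (- (phi z - phi z')) by ring.
  now rewrite Rabs_Ropp.
Qed.

Lemma BL_minus {Z : Type} (dst : Z -> Z -> R) (phi psi : Z -> R) :
  BL dst phi -> BL dst psi -> BL dst (fun z => phi z - psi z).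
Proof. intros H K. apply (BL_plus dst phi (fun z => - psi z)); [assumption|now apply BL_opp]. Qed.

Lemma BL_sumR {Z : Type} (dst : Z -> Z -> R) (m : nat) (F : Z -> nat -> R) :
  (forall z z', 0 <= dst z z') ->
  (forall i, (i < m)%nat -> BL dst (fun z => F z i)) -> BL dst (fun z => sumR m (F z)).
Proof.
  intros Hd. induction m as [|m IH]; intros H.
  - apply (BL_const dst 0 Hd).
  - apply (BL_plus dst (fun z => sumR m (F z)) (fun z => F z m)).
    + apply IH. intros; apply H; lia.
    + apply H; lia.
Qed.

Lemma BL_Rmax0 {Z : Type} (dst : Z -> Z -> R) (phi : Z -> R) :
  BL dst phi -> BL dst (fun z => Rmax 0 (phi z)).
Proof.
  intros [L H]. exists L. intros z z'. destruct (H z z') as [H1 H2]. split.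
  - eapply Rle_trans; [|exact H1]. unfold Rmax, Rabs. repeat destruct Rle_dec; repeat destruct Rcase_abs; lra.
  - eapply Rle_trans; [|exact H2]. unfold Rmax, Rabs. repeat destruct Rle_dec; repeat destruct Rcase_abs; lra.
Qed.

Lemma BL_uniform {Z : Type} (dst : Z -> Z -> R) (m : nat) (F : Z -> nat -> R) :
  (forall z z', 0 <= dst z z') -> (forall i, (i < m)%nat -> BL dst (fun z => F z i)) ->
  exists L, 0 <= L /\ forall i, (i < m)%nat ->
    forall z z', Rabs (F z i) <= L /\ Rabs (F z i - F z' i) <= L * dst z z'.
Proof.
  intros Hd H.
  apply (finite_bound m (fun i L => forall z z', Rabs (F z i) <= L /\ Rabs (F z i - F z' i) <= L * dst z z'));
    [|exact H].
  intros i a b K Hab z z'. destruct (K z z') as [K1 K2]. split; [lra|].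
  eapply Rle_trans; [exact K2|]. apply Rmult_le_compat_r; [apply Hd|assumption].
Qed.

(** Uniform coercivity bounds [w], and it bounds increments through [b z (w z - w z') = (v z - v z')
    + (b z' - b z) w z']. This gives regularity of a solution without any formula for the inverse
    matrix. *)
Lemma BL_solution {Z : Type} (dst : Z -> Z -> R) (p : nat) (b : Z -> nat -> nat -> R)
    (v w : Z -> vec) (m : R) :
  (forall z z', 0 <= dst z z') -> 0 < m -> (forall z, coercive p (b z) m) ->
  (forall j k, (j < p)%nat -> (k < p)%nat -> BL dst (fun z => b z j k)) ->
  (forall j, (j < p)%nat -> BL dst (fun z => v z j)) ->
  (forall z j, (j < p)%nat -> mulv p (b z) (w z) j = v z j) ->
  forall j, (j < p)%nat -> BL dst (fun z => w z j).
Proof.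
  intros Hd Hm Hco Hb Hv Hw.
  assert (Hb' : exists L, 0 <= L /\ forall j, (j < p)%nat -> forall k, (k < p)%nat ->
     forall z z', Rabs (b z j k - b z' j k) <= L * dst z z').
  { apply (finite_bound p (fun j L => forall k, (k < p)%nat ->
      forall z z', Rabs (b z j k - b z' j k) <= L * dst z z')).
    - intros j a c K Hac k Hk z z'. eapply Rle_trans; [apply K; assumption|].
      apply Rmult_le_compat_r; [apply Hd|assumption].
    - intros j Hj. destruct (BL_uniform dst p (fun z k => b z j k) Hd (fun k Hk => Hb j k Hj Hk)) as [L [_ HL]].
      exists L. intros k Hk z z'. now apply HL. }
  destruct Hb' as [L1 [HL1 Kb]].
  destruct (BL_uniform dst p v Hd Hv) as [L2 [HL2 Kv]].
  assert (Hp := pos_INR p).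
  set (M := INR p * L2 / m).
  assert (HM : forall z, normv p (w z) <= M).
  { intros z. apply (Rmult_le_reg_l m); [assumption|].
    replace (m * M) with (INR p * L2) by (unfold M; field; lra).
    eapply Rle_trans; [apply (coercive_lower p (b z)); apply Hco|].
    apply normv_le_coord. intros j Hj. rewrite Hw by assumption. now apply (Kv j Hj z z). }
  assert (HM0 : 0 <= M) by (unfold M; apply Rdiv_le_0_compat; [now apply Rmult_le_pos|assumption]).
  set (N := INR p * (L2 + INR p * (L1 * M)) / m).
  assert (HN : forall z z', normv p (vsub (w z) (w z')) <= N * dst z z').
  { intros z z'. apply (Rmult_le_reg_l m); [assumption|].
    replace (m * (N * dst z z')) with (INR p * ((L2 + INR p * (L1 * M)) * dst z z')) by (unfold N; field; lra).
    eapply Rle_trans; [apply (coercive_lower p (b z)); apply Hco|].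
    apply normv_le_coord. intros j Hj. rewrite mulv_sub, Hw by assumption.
    replace (v z j - mulv p (b z) (w z') j)
      with ((v z j - v z' j) + sumR p (fun k => (b z' j k - b z j k) * w z' k)).
    - eapply Rle_trans; [apply Rabs_triang|].
      destruct (Kv j Hj z z') as [_ K2].
      assert (Rabs (sumR p (fun k => (b z' j k - b z j k) * w z' k)) <= INR p * (L1 * dst z z' * M)).
      { eapply Rle_trans; [apply sumR_abs|]. rewrite <- sumR_const. apply sumR_le. intros k Hk.
        rewrite Rabs_mult. apply Rmult_le_compat; try apply Rabs_pos.
        - rewrite Rabs_minus_sym. now apply Kb.
        - eapply Rle_trans; [apply (coord_le_normv p (w z') k Hk)|apply HM]. }
      lra.
    - rewrite <- (Hw z' j) by assumption. unfold mulv.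
      rewrite (sumR_ext p (fun k => (b z' j k - b z j k) * w z' k)
                 (fun k => b z' j k * w z' k - b z j k * w z' k)) by (intros; ring).
      rewrite sumR_minus. ring. }
  assert (HN0 : 0 <= N).
  { unfold N. apply Rdiv_le_0_compat; [|assumption]. apply Rmult_le_pos; [assumption|].
    assert (0 <= INR p * (L1 * M)); [|lra]. apply Rmult_le_pos; [|apply Rmult_le_pos]; assumption. }
  intros j Hj. exists (M + N). intros z z'. specialize (Hd z z'). split.
  - eapply Rle_trans; [apply (coord_le_normv p (w z) j Hj)|]. specialize (HM z). lra.
  - eapply Rle_trans; [apply (coord_le_normv p (vsub (w z) (w z')) j Hj)|].
    eapply Rle_trans; [apply HN|]. apply Rmult_le_compat_r; [assumption|lra].
Qed.

(** * The regularised vector field *)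

Definition Ft (g h : vec -> vec) (t : R) (x : vec) : vec := fun j => interp t (g x j) (h x j).

Definition At (g h : vec -> vec) (t : R) (x : vec) : nat -> nat -> R :=
  fun j k => interp t (grad g j x k) (grad h j x k).

(* The Tikhonov-type system [D^2 A A^T w + mu w = D^2 u]: with [mu = |F|^2] it is solvable
   wherever [D |A^T w| + |F| |w|] is bounded below, not only near the zero set of [F]. *)
Definition Bmat (n : nat) (D mu : R) (a : nat -> nat -> R) : nat -> nat -> R :=
  fun j l => D ^ 2 * gram n a j l + (if Nat.eqb l j then mu else 0).

(** Where the matrix is coercive, the coordinates below [p], the only ones that enter later sums,
    are determined by the system, so the choice is harmless. *)
Definition wsol (n p : nat) (D mu : R) (a : nat -> nat -> R) (u : vec) : vec :=
  epsilon (inhabits vzero) (fun w => forall j, (j < p)%nat -> mulv p (Bmat n D mu a) w j = D ^ 2 * u j).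

(** The second term acts only at distance below [del] from [Sigma], where the remaining matrix may
    degenerate. *)
Definition mut (n p : nat) (Sigma : vec -> Prop) (g h : vec -> vec) (del t : R) (x : vec) : R :=
  sumR p (fun j => Ft g h t x j * Ft g h t x j) + Rmax 0 (del - distS n Sigma x).

Definition wfield (n p : nat) (Sigma : vec -> Prop) (g h : vec -> vec) (del t : R) (x : vec) : vec :=
  wsol n p (distS n Sigma x) (mut n p Sigma g h del t x) (At g h t x) (fun j => h x j - g x j).

(** With this sign, [u + A X = u - A A^T w = mu w / D^2] off [Sigma], the derivative of [F_t] along
    the flow. *)
Definition field (n p : nat) (Sigma : vec -> Prop) (g h : vec -> vec) (del t : R) (x : vec) : vec :=
  fun k => - trv p (At g h t x) (wfield n p Sigma g h del t x) k.

Lemma mulv_Bmat (n p : nat) (D mu : R) (a : nat -> nat -> R) (w : vec) (j : nat) : (j < p)%nat ->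
  mulv p (Bmat n D mu a) w j = D ^ 2 * mulv p (gram n a) w j + mu * w j.
Proof.
  intros Hj. unfold mulv, Bmat. rewrite <- sumR_scal.
  rewrite <- (sumR_delta p j (fun l => mu * w l)) by assumption.
  rewrite <- sumR_plus. apply sumR_ext. intros l Hl. destruct (Nat.eqb l j); ring.
Qed.

Lemma dot_Bmat (n p : nat) (D mu : R) (a : nat -> nat -> R) (w : vec) :
  dot p (mulv p (Bmat n D mu a) w) w = D ^ 2 * normv n (trv p a w) ^ 2 + mu * normv p w ^ 2.
Proof.
  rewrite <- dot_gram, normv_dot. unfold dot. rewrite <- !sumR_scal, <- sumR_plus.
  apply sumR_ext. intros j Hj. rewrite mulv_Bmat by assumption. ring.
Qed.

Lemma nondeg_sqr (n p r : nat) (c D : R) (a : nat -> nat -> R) (F : vec) (w : vec) :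
  0 <= c -> 0 <= D -> nondeg_at n p r c D a F ->
  (c * D ^ r * normv p w) ^ 2
    <= 2 * (D ^ 2 * normv n (trv p a w) ^ 2 + normv p F ^ 2 * normv p w ^ 2).
Proof.
  intros Hc HD H. specialize (H w).
  assert (H0 : 0 <= c * D ^ r * normv p w).
  { repeat apply Rmult_le_pos; [assumption|now apply pow_le|apply normv_nonneg]. }
  eapply Rle_trans; [apply pow_incr; split; [exact H0|exact H]|].
  set (P := D * normv n (trv p a w)). set (Q := normv p F * normv p w).
  replace (D ^ 2 * normv n (trv p a w) ^ 2) with (P ^ 2) by (unfold P; ring).
  replace (normv p F ^ 2 * normv p w ^ 2) with (Q ^ 2) by (unfold Q; ring).
  pose proof (pow2_ge_0 (P - Q)). nra.
Qed.

Definition mdel (r : nat) (c del : R) : R := Rmin (c ^ 2 * (del / 2) ^ (2 * r) / 2) (del / 2).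

Lemma mdel_pos (r : nat) (c del : R) : 0 < c -> 0 < del -> 0 < mdel r c del.
Proof.
  intros Hc Hd. apply Rmin_pos; [|lra].
  assert (0 < c ^ 2 * (del / 2) ^ (2 * r)); [|lra].
  apply Rmult_lt_0_compat; apply pow_lt; lra.
Qed.

(** Two regimes, matching the two entries of [mdel]: for [D >= del / 2] the squared nondegeneracy
    gives the modulus [c^2 D^(2 r) / 2], and for smaller [D] the cutoff alone is at least
    [del / 2]. *)
Lemma Bmat_coercive (n p r : nat) (c D del : R) (a : nat -> nat -> R) (F : vec) :
  0 < c -> 0 < del -> 0 <= D -> nondeg_at n p r c D a F ->
  coercive p (Bmat n D (sumR p (fun j => F j * F j) + Rmax 0 (del - D)) a) (mdel r c del).
Proof.
  intros Hc Hdel HD Hnd w. rewrite dot_Bmat.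
  change (sumR p (fun j => F j * F j)) with (dot p F F). rewrite <- normv_dot.
  assert (HW := pow2_ge_0 (normv p w)). assert (HN := pow2_ge_0 (normv n (trv p a w))).
  assert (HF := pow2_ge_0 (normv p F)). assert (HD2 := pow2_ge_0 D).
  assert (HDN : 0 <= D ^ 2 * normv n (trv p a w) ^ 2) by now apply Rmult_le_pos.
  assert (HFW : 0 <= normv p F ^ 2 * normv p w ^ 2) by now apply Rmult_le_pos.
  destruct (Rle_or_lt (del / 2) D) as [H|H].
  - pose proof (nondeg_sqr n p r c D a F w ltac:(lra) HD Hnd) as K.
    assert (Hm : mdel r c del <= c ^ 2 * D ^ (2 * r) / 2).
    { eapply Rle_trans; [apply Rmin_l|].
      assert ((del / 2) ^ (2 * r) <= D ^ (2 * r)) by (apply pow_incr; lra).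
      assert (0 <= c ^ 2) by apply pow2_ge_0. nra. }
    apply (Rmult_le_compat_r (normv p w ^ 2)) in Hm; [|assumption].
    assert (E : (c * D ^ r * normv p w) ^ 2 = c ^ 2 * D ^ (2 * r) * normv p w ^ 2).
    { rewrite Nat.mul_comm, pow_mult. ring. }
    rewrite E in K. pose proof (Rmax_l 0 (del - D)).
    assert (0 <= Rmax 0 (del - D) * normv p w ^ 2) by now apply Rmult_le_pos.
    lra.
  - assert (Hm : mdel r c del <= del / 2) by apply Rmin_r.
    pose proof (Rmax_r 0 (del - D)).
    apply (Rmult_le_compat_r (normv p w ^ 2)) in Hm; [|assumption].
    assert (del / 2 * normv p w ^ 2 <= Rmax 0 (del - D) * normv p w ^ 2)
      by (apply Rmult_le_compat_r; [assumption|lra]).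
    lra.
Qed.

Lemma wsol_spec (n p : nat) (D mu m : R) (a : nat -> nat -> R) (u : vec) :
  0 < m -> coercive p (Bmat n D mu a) m ->
  forall j, (j < p)%nat -> mulv p (Bmat n D mu a) (wsol n p D mu a u) j = D ^ 2 * u j.
Proof.
  intros Hm Hco. unfold wsol. apply epsilon_spec.
  exact (coercive_solve p (Bmat n D mu a) m (fun j => D ^ 2 * u j) Hm Hco).
Qed.

(* Pairing the system with [w] gives [D^2 |A^T w|^2 + mu |w|^2 <= D^2 |u| |w|], and the
   nondegeneracy bounds the left side from below by [c^2 D^(2r) |w|^2 / 2]. *)
Lemma solution_bound (n p r : nat) (c D E mu m : R) (a : nat -> nat -> R) (F u w : vec) :
  0 < c -> 0 <= D -> 0 <= E -> 0 < m -> normv p F ^ 2 <= mu ->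
  nondeg_at n p r c D a F -> coercive p (Bmat n D mu a) m ->
  (forall j, (j < p)%nat -> mulv p (Bmat n D mu a) w j = D ^ 2 * u j) ->
  normv p u <= E * D ^ r ->
  normv n (trv p a w) <= 2 * E / c * D.
Proof.
  intros Hc HD HE Hm Hmu Hnd Hco Hw Hu.
  set (W := normv p w). set (N := normv n (trv p a w)). set (U := normv p u) in *.
  assert (HW : 0 <= W) by apply normv_nonneg. assert (HN : 0 <= N) by apply normv_nonneg.
  assert (HU : 0 <= U) by apply normv_nonneg.
  assert (Hpair : D ^ 2 * N ^ 2 + mu * W ^ 2 <= D ^ 2 * (U * W)).
  { unfold N, W. rewrite <- dot_Bmat.
    replace (dot p (mulv p (Bmat n D mu a) w) w) with (D ^ 2 * dot p u w).
    - apply Rmult_le_compat_l; [apply pow2_ge_0|apply dot_le].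
    - unfold dot. rewrite <- sumR_scal. apply sumR_ext. intros j Hj. rewrite Hw by assumption. ring. }
  destruct (Req_dec D 0) as [E0|E0].
  (* On [Sigma] the factor [D^2] cannot be cancelled; there the right side of the pairing is zero
     and coercivity forces [w] to vanish. *)
  - assert (Hz : W <= 0).
    { specialize (Hco w). rewrite dot_Bmat in Hco. fold W N in Hco. rewrite E0 in *.
      destruct (Rle_or_lt W 0) as [L|L]; [assumption|].
      assert (0 < m * W ^ 2) by (apply Rmult_lt_0_compat; [|apply pow_lt]; assumption). lra. }
    unfold N. rewrite normv_zero; [rewrite E0; lra|].
    intros k Hk. unfold trv. apply sumR_zero. intros j Hj.
    rewrite (normv_eq0 p w Hz) by assumption. ring.
  - assert (HD0 : 0 < D) by lra.
    assert (HDr : 0 < D ^ r) by now apply pow_lt.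
    pose proof (nondeg_sqr n p r c D a F w ltac:(lra) HD Hnd) as K. fold W N in K.
    assert (Hmu' : normv p F ^ 2 * W ^ 2 <= mu * W ^ 2)
      by (apply Rmult_le_compat_r; [apply pow2_ge_0|assumption]).
    assert (K2 : (c * D ^ r * W) ^ 2 <= 2 * (D ^ 2 * (U * W))) by lra.
    assert (HFW : 0 <= mu * W ^ 2).
    { apply Rmult_le_pos; [|apply pow2_ge_0]. eapply Rle_trans; [apply pow2_ge_0|exact Hmu]. }
    assert (HNU : N ^ 2 <= U * W).
    { assert (0 < D ^ 2) by now apply pow_lt. apply (Rmult_le_reg_l (D ^ 2)); [assumption|]. lra. }
    assert (HUW : U * W <= E * D ^ r * W) by (apply Rmult_le_compat_r; assumption).
    (* Cancelling one factor [D^r W] bounds [|w|]; inserted in [N^2 <= E D^r W] it yields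
       [N^2 <= 2 E^2 D^2 / c^2]. *)
    assert (K3 : c ^ 2 * (D ^ r * W) <= 2 * (D ^ 2 * E)).
    { destruct (Req_dec W 0) as [EW|EW].
      - rewrite EW, !Rmult_0_r. assert (0 <= D ^ 2 * E) by (apply Rmult_le_pos; [apply pow2_ge_0|assumption]). lra.
      - apply (Rmult_le_reg_r (D ^ r * W)); [apply Rmult_lt_0_compat; lra|].
        replace (c ^ 2 * (D ^ r * W) * (D ^ r * W)) with ((c * D ^ r * W) ^ 2) by ring.
        eapply Rle_trans; [exact K2|].
        replace (2 * (D ^ 2 * E) * (D ^ r * W)) with (2 * (D ^ 2 * (E * D ^ r * W))) by ring.
        apply Rmult_le_compat_l; [lra|]. apply Rmult_le_compat_l; [apply pow2_ge_0|assumption]. }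
    apply sqr_le_reg.
    + apply Rmult_le_pos; [|assumption]. apply Rdiv_le_0_compat; lra.
    + apply (Rmult_le_reg_l (c ^ 2)); [now apply pow_lt|].
      replace (c ^ 2 * (2 * E / c * D) ^ 2) with (4 * (D ^ 2 * E ^ 2)) by (field; lra).
      apply Rle_trans with (c ^ 2 * (E * (D ^ r * W))).
      * apply Rmult_le_compat_l; [apply pow2_ge_0|]. lra.
      * apply (Rmult_le_compat_l E) in K3; [|assumption].
        assert (0 <= D ^ 2 * E ^ 2) by (apply Rmult_le_pos; apply pow2_ge_0). lra.
Qed.

(** Coordinatewise retraction onto a cube: it is 1-Lipschitz for the Euclidean norm by inspection,
    fixes the ball of radius [a] in [R^n], and has image in the ball of radius [n a]. *)
Definition cube (n : nat) (a : R) (x : vec) : vec :=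
  fun k => if Nat.ltb k n then clamp (- a) a (x k) else 0.

Lemma cube_in_Rn (n : nat) (a : R) (x : vec) : in_Rn n (cube n a x).
Proof. intros k Hk. unfold cube. destruct (Nat.ltb_spec k n); [lia|reflexivity]. Qed.

Lemma cube_norm (n : nat) (a : R) (x : vec) : 0 <= a -> normv n (cube n a x) <= INR n * a.
Proof.
  intros Ha. apply normv_le_coord. intros k Hk. unfold cube. destruct (Nat.ltb_spec k n); [|lia].
  apply Rabs_le. apply clamp_in. lra.
Qed.

Lemma cube_id (n : nat) (a : R) (x : vec) : in_Rn n x -> normv n x <= a -> cube n a x = x.
Proof.
  intros Hx Hn. apply functional_extensionality. intros k. unfold cube.
  destruct (Nat.ltb_spec k n) as [Hk|Hk]; [|symmetry; now apply Hx].
  pose proof (coord_le_normv n x k Hk) as H. apply clamp_id.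
  apply Rabs_le_between. lra.
Qed.

Lemma cube_lip (n : nat) (a : R) (x y : vec) :
  normv n (vsub (cube n a x) (cube n a y)) <= normv n (vsub x y).
Proof.
  apply normv_mono. intros k Hk. unfold vsub, cube. destruct (Nat.ltb_spec k n); [|lia].
  apply clamp_lip.
Qed.

Definition lipb (n : nat) (rho : R) (phi : vec -> R) : Prop :=
  exists M, forall x y, in_Rn n x -> in_Rn n y -> normv n x < rho -> normv n y < rho ->
    Rabs (phi x) <= M /\ Rabs (phi x - phi y) <= M * normv n (vsub x y).

(** All that the flow argument uses of the two realisations; [f] has disappeared, and the constants
    [c] and [E] are uniform in [t]. *)
Definition flow_data (n p r : nat) (Sigma : vec -> Prop) (g h : vec -> vec) (rho c E : R) : Prop :=
  0 < c /\ 0 <= E /\ Sigma vzero /\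
  (forall j, (j < p)%nat -> lipb n rho (fun x => g x j) /\ lipb n rho (fun x => h x j) /\
     forall k, (k < n)%nat -> lipb n rho (fun x => grad g j x k) /\ lipb n rho (fun x => grad h j x k)) /\
  (forall j, (j < p)%nat -> C1grad n rho (fun x => g x j) (fun k x => grad g j x k) /\
     C1grad n rho (fun x => h x j) (fun k x => grad h j x k)) /\
  (forall t x, 0 <= t <= 1 -> in_Rn n x -> normv n x < rho ->
     nondeg_at n p r c (distS n Sigma x) (At g h t x) (Ft g h t x)) /\
  (forall x, in_Rn n x -> normv n x < rho ->
     normv p (fun j => h x j - g x j) <= E * distS n Sigma x ^ r).

Definition gfield (n p : nat) (Sigma : vec -> Prop) (g h : vec -> vec) (a del t : R) (x : vec) : vec :=
  field n p Sigma g h del (clamp 0 1 t) (cube n a x).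

Definition tdist (n : nat) (z z' : R * vec) : R :=
  Rabs (fst z - fst z') + normv n (vsub (snd z) (snd z')).

Lemma tdist_nonneg (n : nat) (z z' : R * vec) : 0 <= tdist n z z'.
Proof. unfold tdist. pose proof (Rabs_pos (fst z - fst z')). pose proof (normv_nonneg n (vsub (snd z) (snd z'))). lra. Qed.

Lemma BL_lipb_cube (n : nat) (rho a : R) (phi : vec -> R) :
  0 <= a -> INR n * a < rho -> lipb n rho phi ->
  BL (tdist n) (fun z => phi (cube n a (snd z))).
Proof.
  intros Ha Har [M H]. exists M. intros [t x] [t' x']. unfold tdist. simpl.
  pose proof (cube_norm n a x Ha) as B. pose proof (cube_norm n a x' Ha) as B'.
  destruct (H (cube n a x) (cube n a x')) as [H1 H2]; try apply cube_in_Rn; try lra.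
  split; [assumption|]. eapply Rle_trans; [exact H2|].
  apply Rmult_le_compat_l; [eapply Rle_trans; [apply Rabs_pos|exact H1]|].
  pose proof (cube_lip n a x x'). pose proof (Rabs_pos (t - t')). lra.
Qed.

Lemma BL_clamp_time (n : nat) : BL (tdist n) (fun z => clamp 0 1 (fst z)).
Proof.
  exists 1. intros [t x] [t' x']. unfold tdist. simpl.
  pose proof (clamp_in 0 1 t ltac:(lra)). split; [rewrite Rabs_pos_eq; lra|].
  pose proof (clamp_lip 0 1 t t'). pose proof (normv_nonneg n (vsub x x')). lra.
Qed.

Lemma lipb_distS (n : nat) (Sigma : vec -> Prop) (rho : R) :
  0 < rho -> Sigma vzero -> lipb n rho (distS n Sigma).
Proof.
  intros Hrho H0. exists (rho + 1). intros x y Hx Hy Bx By.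
  pose proof (distS_nonneg n Sigma x H0). pose proof (distS_le_norm n Sigma x H0). split.
  - rewrite Rabs_pos_eq; lra.
  - pose proof (distS_lip n Sigma x y H0). pose proof (distS_lip n Sigma y x H0) as K.
    rewrite normv_sub_sym in K. pose proof (normv_nonneg n (vsub x y)).
    apply Rabs_le. nra.
Qed.

Lemma gfield_solves (n p r : nat) (Sigma : vec -> Prop) (g h : vec -> vec) (rho c E del t : R) (x : vec) :
  flow_data n p r Sigma g h rho c E -> 0 < del -> 0 <= t <= 1 -> in_Rn n x -> normv n x < rho ->
  coercive p (Bmat n (distS n Sigma x) (mut n p Sigma g h del t x) (At g h t x)) (mdel r c del) /\
  forall j, (j < p)%nat ->
    mulv p (Bmat n (distS n Sigma x) (mut n p Sigma g h del t x) (At g h t x))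
      (wfield n p Sigma g h del t x) j = distS n Sigma x ^ 2 * (h x j - g x j).
Proof.
  intros [Hc [HE [H0 [_ [_ [Hnd _]]]]]] Hdel Ht Hx Hn.
  assert (Hco : coercive p (Bmat n (distS n Sigma x) (mut n p Sigma g h del t x) (At g h t x)) (mdel r c del)).
  { apply Bmat_coercive; auto. now apply distS_nonneg. }
  split; [assumption|].
  intros j Hj. apply (wsol_spec n p _ _ (mdel r c del) _ (fun j => h x j - g x j)); auto.
  now apply mdel_pos.
Qed.

(** The cutoff makes the coercivity modulus uniform, so [BL_solution] applies on the whole space.
    The constant depends on [del]. *)
Lemma gfield_lip (n p r : nat) (Sigma : vec -> Prop) (g h : vec -> vec) (rho c E a del : R) :
  flow_data n p r Sigma g h rho c E -> 0 < del -> 0 <= a -> INR n * a < rho ->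
  exists L, 0 <= L /\ lip_field n (gfield n p Sigma g h a del) L.
Proof.
  intros HF Hdel Ha Har. pose proof HF as [Hc [HE [H0 [Hlip [_ [Hnd _]]]]]].
  assert (Hrho : 0 < rho).
  { assert (0 <= INR n * a) by (apply Rmult_le_pos; [apply pos_INR|assumption]). lra. }
  pose proof (tdist_nonneg n) as Hd.
  set (T := fun z : R * vec => clamp 0 1 (fst z)).
  set (X := fun z : R * vec => cube n a (snd z)).
  assert (HX : forall z, in_Rn n (X z)) by (intros; apply cube_in_Rn).
  assert (BX : forall z, normv n (X z) < rho).
  { intros z. eapply Rle_lt_trans; [apply cube_norm|]; assumption. }
  assert (HT : forall z, 0 <= T z <= 1) by (intros; apply clamp_in; lra).
  assert (Hint : forall phi psi, BL (tdist n) phi -> BL (tdist n) psi ->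
            BL (tdist n) (fun z => interp (T z) (phi z) (psi z))).
  { intros phi psi H1 H2.
    apply (BL_plus _ (fun z => (1 - T z) * phi z) (fun z => T z * psi z)).
    - apply (BL_mult _ (fun z => 1 - T z)); auto.
      apply (BL_minus _ (fun _ => 1)); [now apply BL_const|apply BL_clamp_time].
    - apply BL_mult; auto. apply BL_clamp_time. }
  assert (Hg : forall j, (j < p)%nat -> BL (tdist n) (fun z => g (X z) j)).
  { intros j Hj. apply (BL_lipb_cube n rho a (fun x => g x j)); auto. now apply Hlip. }
  assert (Hh : forall j, (j < p)%nat -> BL (tdist n) (fun z => h (X z) j)).
  { intros j Hj. apply (BL_lipb_cube n rho a (fun x => h x j)); auto. now apply Hlip. }
  assert (HFt : forall j, (j < p)%nat -> BL (tdist n) (fun z => Ft g h (T z) (X z) j)).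
  { intros j Hj. apply Hint; auto. }
  assert (HAt : forall j k, (j < p)%nat -> (k < n)%nat -> BL (tdist n) (fun z => At g h (T z) (X z) j k)).
  { intros j k Hj Hk. apply Hint.
    - apply (BL_lipb_cube n rho a (fun x => grad g j x k)); auto. now apply Hlip.
    - apply (BL_lipb_cube n rho a (fun x => grad h j x k)); auto. now apply Hlip. }
  assert (HD : BL (tdist n) (fun z => distS n Sigma (X z))).
  { apply (BL_lipb_cube n rho a (distS n Sigma)); auto. now apply lipb_distS. }
  assert (HD2 : BL (tdist n) (fun z => distS n Sigma (X z) ^ 2)).
  { apply (BL_mult _ (fun z => distS n Sigma (X z))); auto.
    apply (BL_mult _ (fun z => distS n Sigma (X z))); auto. now apply BL_const. }
  assert (Hmu : BL (tdist n) (fun z => mut n p Sigma g h del (T z) (X z))).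
  { apply (BL_plus _ (fun z => sumR p (fun j => Ft g h (T z) (X z) j * Ft g h (T z) (X z) j))).
    - apply (BL_sumR _ p (fun z j => Ft g h (T z) (X z) j * Ft g h (T z) (X z) j)); auto.
      intros j Hj. apply BL_mult; auto.
    - apply (BL_Rmax0 _ (fun z => del - distS n Sigma (X z))).
      apply (BL_minus _ (fun _ => del)); [now apply BL_const|assumption]. }
  assert (Hw : forall j, (j < p)%nat -> BL (tdist n) (fun z => wfield n p Sigma g h del (T z) (X z) j)).
  { apply (BL_solution _ p (fun z => Bmat n (distS n Sigma (X z)) (mut n p Sigma g h del (T z) (X z)) (At g h (T z) (X z)))
       (fun z j => distS n Sigma (X z) ^ 2 * (h (X z) j - g (X z) j)) _ (mdel r c del)).
    - assumption.
    - now apply mdel_pos.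
    - intros z. apply (gfield_solves n p r Sigma g h rho c E del (T z) (X z)); auto.
    - intros j k Hj Hk.
      apply (BL_plus _ (fun z => distS n Sigma (X z) ^ 2 * gram n (At g h (T z) (X z)) j k)).
      + apply BL_mult; auto.
        apply (BL_sumR _ n (fun z i => At g h (T z) (X z) j i * At g h (T z) (X z) k i)); auto.
        intros i Hi. apply BL_mult; auto.
      + destruct (Nat.eqb k j); [assumption|now apply BL_const].
    - intros j Hj. apply BL_mult; auto. apply BL_minus; auto.
    - intros z. apply (gfield_solves n p r Sigma g h rho c E del (T z) (X z)); auto. }
  destruct (BL_uniform (tdist n) n (fun z => gfield n p Sigma g h a del (fst z) (snd z)) Hd) as [L [HL K]].
  { intros k Hk. apply BL_opp.
    apply (BL_sumR _ p (fun z j => At g h (T z) (X z) j k * wfield n p Sigma g h del (T z) (X z) j)); auto.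
    intros j Hj. apply BL_mult; auto. }
  exists (INR n * L). split; [apply Rmult_le_pos; [apply pos_INR|assumption]|].
  intros t x t' x'. rewrite Rmult_assoc. apply normv_le_coord. intros k Hk.
  apply (K k Hk (t, x) (t', x')).
Qed.

(** The constant does not involve [del], and the bound holds at every [x]: a point [y] of norm at
    most [a] is fixed by the cube retraction, which therefore brings [x] no farther from [y]. *)
Lemma gfield_bound (n p r : nat) (Sigma : vec -> Prop) (g h : vec -> vec) (rho c E a del t : R) (x y : vec) :
  flow_data n p r Sigma g h rho c E -> 0 < del -> 0 <= a -> INR n * a < rho ->
  Sigma y -> in_Rn n y -> normv n y <= a ->
  normv n (gfield n p Sigma g h a del t x) <= 2 * E / c * normv n (vsub x y).
Proof.
  intros HF Hdel Ha Har Hy Hyn Hya. pose proof HF as [Hc [HE [H0 [_ [_ [Hnd Hu]]]]]].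
  pose proof (clamp_in 0 1 t ltac:(lra)) as Ht.
  pose proof (cube_in_Rn n a x) as Hx. pose proof (cube_norm n a x Ha) as Bx.
  assert (Bx' : normv n (cube n a x) < rho) by lra.
  set (t' := clamp 0 1 t) in *. set (x' := cube n a x) in *.
  destruct (gfield_solves n p r Sigma g h rho c E del t' x' HF Hdel Ht Hx Bx') as [Hco Hw].
  assert (Hb : normv n (trv p (At g h t' x') (wfield n p Sigma g h del t' x')) <= 2 * E / c * distS n Sigma x').
  { apply (solution_bound n p r c (distS n Sigma x') E (mut n p Sigma g h del t' x') (mdel r c del)
      (At g h t' x') (Ft g h t' x') (fun j => h x' j - g x' j)); auto.
    - now apply distS_nonneg.
    - now apply mdel_pos.
    - unfold mut. rewrite normv_dot. pose proof (Rmax_l 0 (del - distS n Sigma x')). unfold dot. lra. }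
  assert (En : normv n (gfield n p Sigma g h a del t x)
             = normv n (trv p (At g h t' x') (wfield n p Sigma g h del t' x'))).
  { unfold normv. f_equal. apply sumR_ext. intros k _. unfold gfield, field. fold t' x'. ring. }
  rewrite En. eapply Rle_trans; [exact Hb|].
  apply Rmult_le_compat_l; [apply Rdiv_le_0_compat; lra|].
  eapply Rle_trans; [apply (distS_le n Sigma x' y H0 Hy)|].
  rewrite <- (cube_id n a y Hyn Hya) at 1. apply cube_lip.
Qed.

Lemma gfield_del (n p : nat) (Sigma : vec -> Prop) (g h : vec -> vec) (a del del' t : R) (x : vec) :
  del <= distS n Sigma (cube n a x) -> del' <= distS n Sigma (cube n a x) ->
  gfield n p Sigma g h a del t x = gfield n p Sigma g h a del' t x.
Proof.
  intros H H'. unfold gfield, field, wfield, mut.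
  now rewrite !(Rmax_left 0) by lra.
Qed.

(** * Trajectories *)

Definition traj (n : nat) (X : R -> vec -> vec) (gam : R -> vec) : Prop :=
  (forall t, in_Rn n (gam t)) /\ cont_curve n gam /\
  forall t i, 0 < t < 1 -> (i < n)%nat -> derivable_pt_lim (fun s => gam s i) t (X t (gam t) i).

(** Gronwall is applied to the squared distance, which is differentiable even where the curves meet;
    the rate [2 C] becomes [C] after the square root. *)
Lemma curves_gronwall (n : nat) (gam bet v w : R -> vec) (C s t : R) :
  0 <= C -> cont_curve n gam -> cont_curve n bet ->
  (forall x i, 0 < x < 1 -> (i < n)%nat -> derivable_pt_lim (fun y => gam y i) x (v x i)) ->
  (forall x i, 0 < x < 1 -> (i < n)%nat -> derivable_pt_lim (fun y => bet y i) x (w x i)) ->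
  (forall x, 0 < x < 1 -> normv n (vsub (v x) (w x)) <= C * normv n (vsub (gam x) (bet x))) ->
  0 <= s <= 1 -> 0 <= t <= 1 ->
  normv n (vsub (gam t) (bet t)) <= exp C * normv n (vsub (gam s) (bet s)).
Proof.
  intros HC Hg Hb Dg Db Hvw Hs Ht.
  assert (K : sumR n (fun i => (gam t i - bet t i) ^ 2)
          <= exp (2 * C) * sumR n (fun i => (gam s i - bet s i) ^ 2)).
  { apply (gronwall (fun x => sumR n (fun i => (gam x i - bet x i) ^ 2))
            (fun x => sumR n (fun i => 2 * (gam x i - bet x i) * (v x i - w x i)))); try assumption.
    - lra.
    - intros x. apply sumR_nonneg. intros; apply pow2_ge_0.
    - intros x _. apply (continuity_pt_sumR n (fun i x => (gam x i - bet x i) ^ 2)).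
      intros i Hi. simpl.
      assert (Hm : continuity_pt (fun x => gam x i - bet x i) x)
        by (apply (continuity_pt_minus (fun x => gam x i) (fun x => bet x i)); auto).
      apply (continuity_pt_mult (fun x => gam x i - bet x i)); [assumption|].
      apply (continuity_pt_mult (fun x => gam x i - bet x i)); [assumption|].
      apply continuity_pt_const. intros a b. reflexivity.
    - intros x Hx. apply (derivable_pt_lim_sumR n (fun i x => (gam x i - bet x i) ^ 2)).
      intros i Hi.
      assert (Hm : derivable_pt_lim (fun x => gam x i - bet x i) x (v x i - w x i))
        by (apply (derivable_pt_lim_minus (fun x => gam x i) (fun x => bet x i)); auto).
      pose proof (derivable_pt_lim_mult (fun x => gam x i - bet x i) (fun x => gam x i - bet x i) x _ _ Hm Hm) as P.
      replace (2 * (gam x i - bet x i) * (v x i - w x i))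
        with ((v x i - w x i) * (gam x i - bet x i) + (gam x i - bet x i) * (v x i - w x i)) by ring.
      replace (fun x => (gam x i - bet x i) ^ 2)
        with (mult_fct (fun x => gam x i - bet x i) (fun x => gam x i - bet x i)); [exact P|].
      apply functional_extensionality. intros y. unfold mult_fct. ring.
    - intros x Hx.
      replace (sumR n (fun i => 2 * (gam x i - bet x i) * (v x i - w x i)))
        with (2 * dot n (vsub (gam x) (bet x)) (vsub (v x) (w x)))
        by (unfold dot; rewrite <- sumR_scal; apply sumR_ext; intros; unfold vsub; ring).
      change (fun i => (gam x i - bet x i) ^ 2) with (fun i => vsub (gam x) (bet x) i ^ 2).
      rewrite <- normv_sqr, Rabs_mult, (Rabs_pos_eq 2) by lra.
      pose proof (dot_abs_le n (vsub (gam x) (bet x)) (vsub (v x) (w x))).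
      specialize (Hvw x Hx). pose proof (normv_nonneg n (vsub (gam x) (bet x))). nra. }
  change (fun i => (gam t i - bet t i) ^ 2) with (fun i => vsub (gam t) (bet t) i ^ 2) in K.
  change (fun i => (gam s i - bet s i) ^ 2) with (fun i => vsub (gam s) (bet s) i ^ 2) in K.
  rewrite <- !normv_sqr in K.
  apply sqr_le_reg; [apply Rmult_le_pos; [left; apply exp_pos|apply normv_nonneg]|].
  rewrite Rpow_mult_distr. replace (exp C ^ 2) with (exp (2 * C)); [assumption|].
  replace (2 * C) with (C + C) by ring. rewrite exp_plus. ring.
Qed.

Lemma traj_lip (n : nat) (X : R -> vec -> vec) (L : R) (gam bet : R -> vec) (s t : R) :
  0 <= L -> lip_field n X L -> traj n X gam -> traj n X bet -> 0 <= s <= 1 -> 0 <= t <= 1 ->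
  normv n (vsub (gam t) (bet t)) <= exp L * normv n (vsub (gam s) (bet s)).
Proof.
  intros HL0 HL [_ [Cg Dg]] [_ [Cb Db]] Hs Ht.
  apply (curves_gronwall n gam bet (fun t => X t (gam t)) (fun t => X t (bet t))); auto.
  intros x Hx. eapply Rle_trans; [apply HL|]. rewrite Rminus_diag, Rabs_R0. lra.
Qed.

(** Comparison with the constant curve [y], a stationary solution because the bound makes the field
    vanish there. *)
Lemma traj_point (n : nat) (X : R -> vec -> vec) (C : R) (gam : R -> vec) (y : vec) (s t : R) :
  0 <= C -> (forall t x, normv n (X t x) <= C * normv n (vsub x y)) ->
  traj n X gam -> 0 <= s <= 1 -> 0 <= t <= 1 ->
  normv n (vsub (gam t) y) <= exp C * normv n (vsub (gam s) y).
Proof.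
  intros HC HX [_ [Cg Dg]] Hs Ht.
  apply (curves_gronwall n gam (fun _ => y) (fun t => X t (gam t)) (fun _ => vzero)); auto.
  - intros i x Hi. apply continuity_pt_const. intros a b. reflexivity.
  - intros x i Hx Hi. apply derivable_pt_lim_const.
  - intros x Hx. rewrite normv_sub_zero. apply HX.
Qed.

Lemma traj_exists (n : nat) (X : R -> vec -> vec) (L : R) (x0 : vec) (s : R) :
  0 <= L -> lip_field n X L -> in_Rn n x0 -> s = 0 \/ s = 1 ->
  exists gam, traj n X gam /\ gam s = x0.
Proof.
  intros HL0 HL Hx0 [-> | ->].
  - destruct (picard n X L x0 HL0 HL Hx0) as [gam [H1 [H2 [H3 H4]]]].
    exists gam. split; [|assumption]. repeat split; assumption.
  (* A condition at time 1 is turned into an initial one by reversing time in the field. *)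
  - destruct (picard n (fun t x k => - X (1 - t) x k) L x0 HL0) as [gam [H1 [H2 [H3 H4]]]]; [|assumption|].
    + intros t x t' x'.
      replace (Rabs (t - t')) with (Rabs ((1 - t) - (1 - t')))
        by (rewrite Rabs_minus_sym; f_equal; ring).
      eapply Rle_trans; [|apply HL]. rewrite normv_sub_sym. right. apply normv_ext.
      intros k _. unfold vsub. ring.
    + exists (fun t => gam (1 - t)). split; [|rewrite <- H3; f_equal; ring].
      split; [intros; apply H1|]. split.
      * intros i t Hi. apply (continuity_pt_comp (fun t => 1 - t) (fun s => gam s i)).
        -- apply derivable_continuous_pt. eexists. apply is_derive_Reals. auto_derive; [trivial|reflexivity].
        -- now apply H2.
      * intros t i Ht Hi.
        pose proof (H4 (1 - t) i ltac:(lra) Hi) as D. simpl in D.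
        replace (1 - (1 - t)) with t in D by ring.
        assert (D1 : derivable_pt_lim (fun t => 1 - t) t (-1)).
        { apply is_derive_Reals. auto_derive; [trivial|ring]. }
        pose proof (derivable_pt_lim_comp (fun t => 1 - t) (fun s => gam s i) t _ _ D1 D) as P.
        replace (X t (gam (1 - t)) i) with (- X t (gam (1 - t)) i * -1) by ring. exact P.
Qed.

Lemma cont_at_curve (n : nat) (g : vec -> R) (gam : R -> vec) (t : R) :
  cont_at n g (gam t) -> (forall s, in_Rn n (gam s)) -> cont_curve n gam ->
  continuity_pt (fun s => g (gam s)) t.
Proof.
  intros Hg HR Hc eps Heps. destruct (Hg eps Heps) as [d [Hd K]].
  assert (HG : continuity_pt (fun s => sumR n (fun k => Rabs (gam s k - gam t k))) t).
  { apply (continuity_pt_sumR n (fun k s => Rabs (gam s k - gam t k))).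
    intros k Hk. apply (continuity_pt_dist (fun s => gam s k)). now apply Hc. }
  destruct (HG d Hd) as [d' [Hd' K']]. exists d'. split; [assumption|].
  intros s Hs. specialize (K' s Hs). simpl in *. unfold Rdist in *. apply K; [apply HR|].
  eapply Rle_lt_trans; [apply normv_le_sum|]. unfold vsub.
  rewrite (sumR_zero n (fun k => Rabs (gam t k - gam t k))), Rminus_0_r in K'
    by (intros; now rewrite Rminus_diag, Rabs_R0).
  eapply Rle_lt_trans; [apply Rle_abs|exact K'].
Qed.

Lemma C1grad_cont_at (n : nat) (rho : R) (g : vec -> R) (Dg : nat -> vec -> R) (x : vec) :
  C1grad n rho g Dg -> in_Rn n x -> ball n rho x -> cont_at n g x.
Proof.
  intros H Hx Hb eps Heps.
  destruct (C1grad_diff n rho g Dg x H Hx Hb 1 Rlt_0_1) as [d [Hd K]].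
  set (A := sumR n (fun i => Rabs (Dg i x) + 1)).
  assert (HA : 0 <= A).
  { apply sumR_nonneg. intros i _. pose proof (Rabs_pos (Dg i x)). lra. }
  exists (Rmin d (eps / (A + 1))).
  split; [apply Rmin_pos; [assumption|apply Rdiv_lt_0_compat; lra]|]. intros y Hy Hn.
  pose proof (Rlt_le_trans _ _ _ Hn (Rmin_l _ _)) as B1.
  pose proof (Rlt_le_trans _ _ _ Hn (Rmin_r _ _)) as B2.
  specialize (K y Hy B1).
  assert (Hle : Rabs (g y - g x) <= A * normv n (vsub y x)).
  { replace (g y - g x) with ((g y - g x - sumR n (fun i => Dg i x * (y i - x i)))
      + sumR n (fun i => Dg i x * (y i - x i))) by ring.
    eapply Rle_trans; [apply Rabs_triang|].
    eapply Rle_trans; [apply Rplus_le_compat; [exact K|apply sumR_abs]|].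
    rewrite Rmult_1_l, <- sumR_plus. unfold A. rewrite <- sumR_scal_r. apply sumR_le. intros i Hi.
    rewrite Rabs_mult. pose proof (coord_le_normv n (vsub y x) i Hi) as Hc. unfold vsub at 1 in Hc.
    apply (Rmult_le_compat_l (Rabs (Dg i x) + 1)) in Hc; [lra|].
    pose proof (Rabs_pos (Dg i x)). lra. }
  apply (Rmult_lt_compat_l (A + 1)) in B2; [|lra].
  replace ((A + 1) * (eps / (A + 1))) with eps in B2 by (field; lra).
  pose proof (normv_nonneg n (vsub y x)). lra.
Qed.

(* Along a trajectory with [D >= del] the regularisation reduces to [mu = |F|^2], so that
   [D^2 F' = |F|^2 w] and [q = |F|^2] satisfies [|q'| <= C q]. *)
Lemma traj_conserves_zeros (n p r : nat) (Sigma : vec -> Prop) (g h : vec -> vec)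
    (rho c E a del s t : R) (gam : R -> vec) :
  flow_data n p r Sigma g h rho c E -> 0 < del -> a < rho ->
  traj n (gfield n p Sigma g h a del) gam ->
  (forall x, 0 <= x <= 1 -> normv n (gam x) <= a /\ del <= distS n Sigma (gam x)) ->
  0 <= s <= 1 -> 0 <= t <= 1 ->
  (forall j, (j < p)%nat -> Ft g h s (gam s) j = 0) ->
  forall j, (j < p)%nat -> Ft g h t (gam t) j = 0.
Proof.
  intros HF Hdel Har [HR [Hcc Hder]] Hin Hs Ht Hz.
  pose proof HF as [Hc [HE [H0 [Hlip [HC1 [Hnd Hu]]]]]].
  assert (HM : exists M, 0 <= M /\ forall j, (j < p)%nat -> forall x, in_Rn n x -> normv n x < rho ->
     Rabs (g x j) <= M /\ Rabs (h x j) <= M).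
  { apply (finite_bound p (fun j M => forall x, in_Rn n x -> normv n x < rho ->
     Rabs (g x j) <= M /\ Rabs (h x j) <= M)).
    - intros j u v H Huv x Hx Bx. destruct (H x Hx Bx). split; lra.
    - intros j Hj. destruct (Hlip j Hj) as [[M1 K1] [[M2 K2] _]]. exists (Rmax M1 M2).
      intros x Hx Bx. destruct (K1 x x Hx Hx Bx Bx) as [L1 _]. destruct (K2 x x Hx Hx Bx Bx) as [L2 _].
      split; [eapply Rle_trans; [exact L1|apply Rmax_l]|eapply Rle_trans; [exact L2|apply Rmax_r]]. }
  destruct HM as [M [HM0 HM]].
  set (m := mdel r c del). assert (Hm : 0 < m) by now apply mdel_pos.
  assert (Hp := pos_INR p).
  set (X := fun x => gfield n p Sigma g h a del x (gam x)).
  set (dF := fun x j => (h (gam x) j - g (gam x) j) + sumR n (fun k => At g h x (gam x) j k * X x k)).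
  (* From [D^2 q' = 2 q (F.w)], [|F| <= p M] and [m |w| <= D^2 p (2 M)]; the factors [D^2]
     cancel. *)
  set (C := 2 * (INR p * M) * (INR p * (2 * M)) / m).
  assert (HC : 0 <= C).
  { unfold C. apply Rdiv_le_0_compat; [|assumption].
    repeat (apply Rmult_le_pos; try lra). }
  assert (K : sumR p (fun j => Ft g h t (gam t) j * Ft g h t (gam t) j)
      <= exp C * sumR p (fun j => Ft g h s (gam s) j * Ft g h s (gam s) j)).
  { apply (gronwall (fun x => sumR p (fun j => Ft g h x (gam x) j * Ft g h x (gam x) j))
      (fun x => sumR p (fun j => dF x j * Ft g h x (gam x) j + Ft g h x (gam x) j * dF x j))); try assumption.
    - intros x. apply sumR_nonneg. intros j _. nra.
    - intros x Hx. apply (continuity_pt_sumR p (fun j x => Ft g h x (gam x) j * Ft g h x (gam x) j)).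
      intros j Hj. destruct (Hin x Hx) as [Bx _]. destruct (HC1 j Hj) as [Cg Ch].
      assert (Kg : continuity_pt (fun s => g (gam s) j) x).
      { apply (cont_at_curve n (fun y => g y j)); auto.
        eapply C1grad_cont_at; [exact Cg|apply HR|unfold ball; lra]. }
      assert (Kh : continuity_pt (fun s => h (gam s) j) x).
      { apply (cont_at_curve n (fun y => h y j)); auto.
        eapply C1grad_cont_at; [exact Ch|apply HR|unfold ball; lra]. }
      assert (Kid : continuity_pt (fun s => s) x) by apply derivable_continuous_pt, derivable_pt_id.
      assert (KF : continuity_pt (fun x => Ft g h x (gam x) j) x).
      { apply (continuity_pt_plus (fun x => (1 - x) * g (gam x) j) (fun x => x * h (gam x) j)).
        - apply (continuity_pt_mult (fun x => 1 - x)); [|assumption].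
          apply (continuity_pt_minus (fun _ => 1)); [|assumption].
          apply continuity_pt_const. intros u v. reflexivity.
        - apply (continuity_pt_mult (fun x => x)); assumption. }
      apply (continuity_pt_mult (fun x => Ft g h x (gam x) j)); assumption.
    - intros x Hx. apply (derivable_pt_lim_sumR p (fun j x => Ft g h x (gam x) j * Ft g h x (gam x) j)).
      intros j Hj. destruct (Hin x ltac:(lra)) as [Bx _]. destruct (HC1 j Hj) as [Cg Ch].
      assert (Dg := chain_rule n rho _ _ gam x (X x) Cg HR ltac:(unfold ball; lra) (fun i Hi => Hder x i Hx Hi)).
      assert (Dh := chain_rule n rho _ _ gam x (X x) Ch HR ltac:(unfold ball; lra) (fun i Hi => Hder x i Hx Hi)).
      assert (D1 : derivable_pt_lim (fun t => 1 - t) x (-1)).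
      { apply is_derive_Reals. auto_derive; [trivial|ring]. }
      assert (DF : derivable_pt_lim (fun x => Ft g h x (gam x) j) x (dF x j)).
      { replace (dF x j) with
          ((-1 * g (gam x) j + (1 - x) * sumR n (fun k => grad g j (gam x) k * X x k))
           + (1 * h (gam x) j + x * sumR n (fun k => grad h j (gam x) k * X x k))).
        - apply (derivable_pt_lim_plus (fun x => (1 - x) * g (gam x) j) (fun x => x * h (gam x) j)).
          + apply (derivable_pt_lim_mult (fun x => 1 - x) (fun x => g (gam x) j)); assumption.
          + apply (derivable_pt_lim_mult (fun x => x) (fun x => h (gam x) j)); [|assumption].
            apply derivable_pt_lim_id.
        - unfold dF, At, interp.
          rewrite (sumR_ext n (fun k => ((1 - x) * grad g j (gam x) k + x * grad h j (gam x) k) * X x k)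
            (fun k => (1 - x) * (grad g j (gam x) k * X x k) + x * (grad h j (gam x) k * X x k)))
            by (intros; ring).
          rewrite sumR_plus, !sumR_scal. ring. }
      apply (derivable_pt_lim_mult (fun x => Ft g h x (gam x) j) (fun x => Ft g h x (gam x) j)); assumption.
    - intros x Hx. destruct (Hin x ltac:(lra)) as [Bx Dx].
      assert (Bx' : normv n (gam x) < rho) by lra.
      destruct (gfield_solves n p r Sigma g h rho c E del x (gam x) HF Hdel ltac:(lra) (HR x) Bx') as [Hco Hw].
      set (w := wfield n p Sigma g h del x (gam x)) in *.
      set (D := distS n Sigma (gam x)) in *.
      set (q := sumR p (fun j => Ft g h x (gam x) j * Ft g h x (gam x) j)).
      assert (Emu : mut n p Sigma g h del x (gam x) = q).
      { unfold mut. fold D q. rewrite Rmax_left by lra. ring. }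
      rewrite Emu in Hw, Hco.
      assert (EX : forall k, X x k = - trv p (At g h x (gam x)) w k).
      { intros k. unfold X, gfield, field.
        rewrite clamp_id by lra. rewrite cube_id by (auto; apply HR). reflexivity. }
      assert (EdF : forall j, (j < p)%nat -> D ^ 2 * dF x j = q * w j).
      { intros j Hj. specialize (Hw j Hj). rewrite mulv_Bmat in Hw by assumption.
        rewrite mulv_gram in Hw. unfold dF.
        rewrite (sumR_ext n _ (fun k => (-1) * (At g h x (gam x) j k * trv p (At g h x (gam x)) w k)))
          by (intros; rewrite EX; ring).
        rewrite sumR_scal. unfold dot in Hw. lra. }
      assert (HD : 0 < D ^ 2) by (apply pow_lt; lra).
      assert (Hq : 0 <= q) by (apply sumR_nonneg; intros; nra).
      assert (HFn : normv p (Ft g h x (gam x)) <= INR p * M).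
      { apply normv_le_coord. intros j Hj. destruct (HM j Hj (gam x) (HR x) Bx') as [M1 M2].
        apply Rabs_le_between in M1. apply Rabs_le_between in M2.
        unfold Ft, interp. apply Rabs_le. nra. }
      assert (Hun : normv p (fun j => h (gam x) j - g (gam x) j) <= INR p * (2 * M)).
      { apply normv_le_coord. intros j Hj. destruct (HM j Hj (gam x) (HR x) Bx') as [M1 M2].
        apply Rabs_le_between in M1. apply Rabs_le_between in M2. apply Rabs_le. lra. }
      assert (Hwn : m * normv p w <= D ^ 2 * (INR p * (2 * M))).
      { eapply Rle_trans; [apply (coercive_lower p _ m w Hco)|].
        rewrite (normv_ext p _ (fun j => D ^ 2 * (h (gam x) j - g (gam x) j))) by assumption.
        rewrite normv_scal, Rabs_pos_eq by lra. apply Rmult_le_compat_l; lra. }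
      apply (Rmult_le_reg_l (m * D ^ 2)); [now apply Rmult_lt_0_compat|].
      assert (Edq : D ^ 2 * sumR p (fun j => dF x j * Ft g h x (gam x) j + Ft g h x (gam x) j * dF x j)
                = 2 * q * dot p (Ft g h x (gam x)) w).
      { unfold dot. rewrite <- !sumR_scal. apply sumR_ext. intros j Hj.
        replace (D ^ 2 * (dF x j * Ft g h x (gam x) j + Ft g h x (gam x) j * dF x j))
          with (2 * Ft g h x (gam x) j * (D ^ 2 * dF x j)) by ring.
        rewrite EdF by assumption. ring. }
      replace (m * D ^ 2 * Rabs (sumR p (fun j => dF x j * Ft g h x (gam x) j + Ft g h x (gam x) j * dF x j)))
        with (m * Rabs (2 * q * dot p (Ft g h x (gam x)) w))
        by (rewrite <- Edq, (Rabs_mult (D ^ 2)), (Rabs_pos_eq (D ^ 2)) by lra; ring).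
      rewrite !Rabs_mult, (Rabs_pos_eq 2), (Rabs_pos_eq q) by lra.
      pose proof (dot_abs_le p (Ft g h x (gam x)) w) as Hdot.
      pose proof (normv_nonneg p (Ft g h x (gam x))) as HF0. pose proof (normv_nonneg p w) as Hw0.
      assert (P1 : m * Rabs (dot p (Ft g h x (gam x)) w) <= (INR p * M) * (D ^ 2 * (INR p * (2 * M)))).
      { apply Rle_trans with (normv p (Ft g h x (gam x)) * (m * normv p w)).
        - apply Rle_trans with (m * (normv p (Ft g h x (gam x)) * normv p w)); [|right; ring].
          apply Rmult_le_compat_l; lra.
        - apply Rmult_le_compat; try assumption. apply Rmult_le_pos; lra. }
      replace (m * D ^ 2 * (C * q)) with (2 * q * ((INR p * M) * (D ^ 2 * (INR p * (2 * M)))))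
        by (unfold C; field; lra).
      replace (m * (2 * q * Rabs (dot p (Ft g h x (gam x)) w)))
        with (2 * q * (m * Rabs (dot p (Ft g h x (gam x)) w))) by ring.
      apply Rmult_le_compat_l; [lra|exact P1]. }
  rewrite (sumR_zero p (fun j => Ft g h s (gam s) j * Ft g h s (gam s) j)), Rmult_0_r in K
    by (intros j Hj; rewrite Hz by assumption; ring).
  intros j Hj.
  assert (K2 : Ft g h t (gam t) j * Ft g h t (gam t) j <= 0).
  { eapply Rle_trans; [|exact K].
    apply (sumR_term_le p (fun j => Ft g h t (gam t) j * Ft g h t (gam t) j)); [intros; nra|assumption]. }
  nra.
Qed.

(** * The flow relation *)

(** [del] is quantified per trajectory, since none works up to [Sigma]. The condition [del <= D]
    means that the curve never feels the cutoff, and [|gam u| <= a] that it never feels the cube. *)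
Definition flow_rel (n p : nat) (Sigma : vec -> Prop) (g h : vec -> vec) (a s t : R) (x y : vec) : Prop :=
  in_Rn n x /\ in_Rn n y /\
  ((distS n Sigma x = 0 /\ y = x) \/
   exists del gam, 0 < del /\ traj n (gfield n p Sigma g h a del) gam /\
     (forall u, 0 <= u <= 1 -> normv n (gam u) <= a /\ del <= distS n Sigma (gam u)) /\
     gam s = x /\ gam t = y).

Lemma flow_rel_sym (n p : nat) (Sigma : vec -> Prop) (g h : vec -> vec) (a s t : R) (x y : vec) :
  flow_rel n p Sigma g h a s t x y -> flow_rel n p Sigma g h a t s y x.
Proof.
  intros [Hx [Hy [[H1 H2]|[del [gam [H1 [H2 [H3 [H4 H5]]]]]]]]].
  - subst y. split; [assumption|]. split; [assumption|]. left. now split.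
  - split; [assumption|]. split; [assumption|]. right. exists del, gam. tauto.
Qed.

Lemma traj_near_Sigma (n p r : nat) (Sigma : vec -> Prop) (g h : vec -> vec)
    (rho c E a del s t : R) (gam : R -> vec) (y : vec) :
  flow_data n p r Sigma g h rho c E -> 0 < del -> 0 <= a -> INR n * a < rho ->
  traj n (gfield n p Sigma g h a del) gam -> 0 <= s <= 1 -> 0 <= t <= 1 ->
  Sigma y -> in_Rn n y -> normv n y <= a ->
  normv n (vsub (gam t) y) <= exp (2 * E / c) * normv n (vsub (gam s) y).
Proof.
  intros HF Hdel Ha Har HT Hs Ht Hy Hyn Hya.
  apply (traj_point n (gfield n p Sigma g h a del)); auto.
  - destruct HF as [Hc [HE _]]. apply Rdiv_le_0_compat; lra.
  - intros u x. now apply (gfield_bound n p r Sigma g h rho c E a).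
Qed.

Lemma traj_dist (n p r : nat) (Sigma : vec -> Prop) (g h : vec -> vec)
    (rho c E a del s t : R) (gam : R -> vec) :
  (forall x, Sigma x -> in_Rn n x) ->
  flow_data n p r Sigma g h rho c E -> 0 < del -> 0 <= a -> INR n * a < rho ->
  traj n (gfield n p Sigma g h a del) gam -> 0 <= s <= 1 -> 0 <= t <= 1 ->
  2 * normv n (gam s) < a ->
  distS n Sigma (gam t) <= exp (2 * E / c) * distS n Sigma (gam s).
Proof.
  intros HS HF Hdel Ha Har HT Hs Ht Hsm. pose proof HF as [Hc [HE [H0 _]]].
  set (Ec := exp (2 * E / c)). assert (HEc : 0 < Ec) by apply exp_pos.
  apply Rle_of_le_eps. intros e He.
  (* The second bound keeps [y] in the ball of radius [a], as [|y| <= |gam s - y| + |gam s|] and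
     [D <= |gam s|]. *)
  destruct (distS_approx n Sigma (gam s) (Rmin (e / Ec) (a - 2 * normv n (gam s))) H0) as [y [Hy Hl]].
  { apply Rmin_pos; [now apply Rdiv_lt_0_compat|lra]. }
  pose proof (Rmin_l (e / Ec) (a - 2 * normv n (gam s))) as L1.
  pose proof (Rmin_r (e / Ec) (a - 2 * normv n (gam s))) as L2.
  pose proof (distS_le_norm n Sigma (gam s) H0) as L3.
  pose proof (normv_le_sub n y (gam s)) as L4. rewrite normv_sub_sym in L4.
  pose proof (traj_near_Sigma n p r Sigma g h rho c E a del s t gam y HF Hdel Ha Har HT Hs Ht Hy (HS y Hy)
    ltac:(lra)) as K. fold Ec in K.
  pose proof (distS_le n Sigma (gam t) y H0 Hy) as L5.
  assert (Ec * normv n (vsub (gam s) y) <= Ec * (distS n Sigma (gam s) + e / Ec))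
    by (apply Rmult_le_compat_l; lra).
  replace (Ec * (distS n Sigma (gam s) + e / Ec)) with (Ec * distS n Sigma (gam s) + e) in H by (field; lra).
  lra.
Qed.

Lemma traj_norm (n p r : nat) (Sigma : vec -> Prop) (g h : vec -> vec)
    (rho c E a del s t : R) (gam : R -> vec) :
  flow_data n p r Sigma g h rho c E -> 0 < del -> 0 <= a -> INR n * a < rho ->
  traj n (gfield n p Sigma g h a del) gam -> 0 <= s <= 1 -> 0 <= t <= 1 ->
  normv n (gam t) <= exp (2 * E / c) * normv n (gam s).
Proof.
  intros HF Hdel Ha Har HT Hs Ht. rewrite <- (normv_sub_zero n (gam t)), <- (normv_sub_zero n (gam s)).
  apply (traj_near_Sigma n p r Sigma g h rho c E a del); auto; [apply HF|apply in_Rn_vzero|].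
  now rewrite normv_vzero.
Qed.

Lemma flow_rel_exists (n p r : nat) (Sigma : vec -> Prop) (g h : vec -> vec)
    (rho c E a s t : R) (x : vec) :
  (forall x, Sigma x -> in_Rn n x) ->
  flow_data n p r Sigma g h rho c E -> 0 <= a -> INR n * a < rho -> s = 0 \/ s = 1 ->
  in_Rn n x -> 4 * (exp (2 * E / c) * normv n x) < a ->
  exists y, flow_rel n p Sigma g h a s t x y.
Proof.
  intros HS HF Ha Har Hs Hx Hsm. pose proof HF as [Hc [HE [H0 _]]].
  set (Ec := exp (2 * E / c)) in *. assert (HEc : 0 < Ec) by apply exp_pos.
  pose proof (distS_nonneg n Sigma x H0) as HD.
  destruct (Req_dec (distS n Sigma x) 0) as [E0|E0].
  { exists x. split; [assumption|]. split; [assumption|]. left. now split. }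
  (* The factor [Ec] is independent of [del], so it may be used to choose [del]. Estimating from
     time [u] back to [s] gives [D(x) <= Ec D(gam u)], that is [del <= D(gam u)]. That estimate
     needs [2 |gam u| < a], which the factor 4 in the hypothesis provides. *)
  set (del := distS n Sigma x / Ec).
  assert (Hdel : 0 < del) by (apply Rdiv_lt_0_compat; lra).
  destruct (gfield_lip n p r Sigma g h rho c E a del HF Hdel Ha Har) as [L [HL0 HL]].
  destruct (traj_exists n _ L x s HL0 HL Hx Hs) as [gam [HT Hgs]].
  assert (Hs' : 0 <= s <= 1) by (destruct Hs; lra).
  exists (gam t). split; [assumption|]. split; [apply HT|]. right. exists del, gam.
  split; [assumption|]. split; [assumption|]. split; [|now split].
  intros u Hu.
  pose proof (traj_norm n p r Sigma g h rho c E a del s u gam HF Hdel Ha Har HT Hs' Hu) as K.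
  fold Ec in K. rewrite Hgs in K. pose proof (normv_nonneg n (gam u)). split; [lra|].
  pose proof (traj_dist n p r Sigma g h rho c E a del u s gam HS HF Hdel Ha Har HT Hu Hs' ltac:(lra)) as K2.
  fold Ec in K2. rewrite Hgs in K2.
  apply (Rmult_le_reg_l Ec); [assumption|]. unfold del.
  replace (Ec * (distS n Sigma x / Ec)) with (distS n Sigma x) by (field; lra). assumption.
Qed.

(** Brings two trajectories with different cutoffs under one field, so that their distance can be
    compared. *)
Lemma traj_change_del (n p : nat) (Sigma : vec -> Prop) (g h : vec -> vec) (a del del' : R) (gam : R -> vec) :
  traj n (gfield n p Sigma g h a del) gam ->
  (forall u, 0 <= u <= 1 -> normv n (gam u) <= a) ->
  (forall u, 0 <= u <= 1 -> del <= distS n Sigma (gam u)) ->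
  (forall u, 0 <= u <= 1 -> del' <= distS n Sigma (gam u)) ->
  traj n (gfield n p Sigma g h a del') gam.
Proof.
  intros [HR [Hc Hd]] Ha H H'. split; [assumption|]. split; [assumption|]. intros t i Ht Hi.
  rewrite (gfield_del n p Sigma g h a del' del).
  - now apply Hd.
  - rewrite cube_id by (auto; apply Ha; lra). apply H'; lra.
  - rewrite cube_id by (auto; apply Ha; lra). apply H; lra.
Qed.

Lemma flow_rel_continuous (n p r : nat) (Sigma : vec -> Prop) (g h : vec -> vec)
    (rho c E a s t : R) (x y : vec) :
  (forall x, Sigma x -> in_Rn n x) -> closed_n n Sigma ->
  flow_data n p r Sigma g h rho c E -> 0 <= a -> INR n * a < rho -> 0 <= s <= 1 -> 0 <= t <= 1 ->
  4 * (exp (2 * E / c) * normv n x) < a ->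
  flow_rel n p Sigma g h a s t x y ->
  forall eps, 0 < eps -> exists d, 0 < d /\ forall x' y',
    flow_rel n p Sigma g h a s t x' y' -> 4 * (exp (2 * E / c) * normv n x') < a ->
    normv n (vsub x' x) < d -> normv n (vsub y' y) < eps.
Proof.
  intros HS Hcl HF Ha Har Hs Ht Hsm HR eps Heps. pose proof HF as [Hc [HE [H0 _]]].
  set (Ec := exp (2 * E / c)) in *.
  assert (HEc : 1 <= Ec).
  { unfold Ec. pose proof (exp_ineq1_le (2 * E / c)). assert (0 <= 2 * E / c) by (apply Rdiv_le_0_compat; lra). lra. }
  destruct HR as [Hx [Hy [[HD0 Exy]|[del [gam [Hdel [HT [Hin [Egs Egt]]]]]]]]].
  (* At a point of [Sigma] the Lipschitz constants of the fields are useless; the estimate relative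
     to a fixed point of [Sigma] is uniform in the cutoff of the neighbouring trajectory. *)
  - subst y. assert (HSx : Sigma x) by (apply (distS_zero n); auto; lra).
    pose proof (normv_nonneg n x) as Hxn.
    exists (eps / Ec). split; [apply Rdiv_lt_0_compat; lra|].
    intros x' y' [Hx' [Hy' HR']] Hsm' Hd.
    assert (Hle : normv n (vsub y' x) <= Ec * normv n (vsub x' x)).
    { destruct HR' as [[_ Exy]|[del [gam [Hdel [HT [_ [Egs Egt]]]]]]].
      - subst y'. pose proof (normv_nonneg n (vsub x' x)). nra.
      - subst x' y'. apply (traj_near_Sigma n p r Sigma g h rho c E a del); auto. nra. }
    apply (Rmult_lt_compat_l Ec) in Hd; [|lra].
    replace (Ec * (eps / Ec)) with eps in Hd by (field; lra). lra.
  (* A point within [del / 2] of [x] has distance at least [del / 2] from [Sigma], and its whole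
     trajectory at least [del / (2 Ec)]. This one cutoff thus serves all neighbouring
     trajectories. *)
  - set (del0 := del / (2 * Ec)).
    assert (Hdel0 : 0 < del0) by (apply Rdiv_lt_0_compat; lra).
    assert (Edel : Ec * del0 = del / 2) by (unfold del0; field; lra).
    assert (Hdd : del0 <= del) by nra.
    destruct (gfield_lip n p r Sigma g h rho c E a del0 HF Hdel0 Ha Har) as [L [HL0 HL]].
    pose proof (exp_pos L) as HeL.
    exists (Rmin (del / 2) (eps / exp L)).
    split; [apply Rmin_pos; [lra|now apply Rdiv_lt_0_compat]|].
    intros x' y' [Hx' [Hy' HR']] Hsm' Hd.
    pose proof (Rlt_le_trans _ _ _ Hd (Rmin_l _ _)) as B1.
    pose proof (Rlt_le_trans _ _ _ Hd (Rmin_r _ _)) as B2.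
    assert (HDx : del <= distS n Sigma x) by (rewrite <- Egs; now apply Hin).
    pose proof (distS_lip n Sigma x x' H0) as HDl. rewrite normv_sub_sym in HDl.
    destruct HR' as [[HD0' _]|[del' [gam' [Hdel' [HT' [Hin' [Egs' Egt']]]]]]]; [lra|].
    assert (T1 : traj n (gfield n p Sigma g h a del0) gam).
    { apply (traj_change_del n p Sigma g h a del); auto; intros u Hu; destruct (Hin u Hu); lra. }
    assert (T2 : traj n (gfield n p Sigma g h a del0) gam').
    { apply (traj_change_del n p Sigma g h a del'); auto; intros u Hu; destruct (Hin' u Hu) as [I1 I2]; try lra.
      pose proof (traj_norm n p r Sigma g h rho c E a del' s u gam' HF Hdel' Ha Har HT' Hs Hu) as K.
      fold Ec in K. rewrite Egs' in K. pose proof (normv_nonneg n (gam' u)).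
      pose proof (traj_dist n p r Sigma g h rho c E a del' u s gam' HS HF Hdel' Ha Har HT' Hu Hs ltac:(lra)) as K2.
      fold Ec in K2. rewrite Egs' in K2.
      apply (Rmult_le_reg_l Ec); lra. }
    pose proof (traj_lip n _ L gam' gam s t HL0 HL T2 T1 Hs Ht) as K.
    rewrite Egs, Egt, Egs', Egt' in K.
    apply (Rmult_lt_compat_l (exp L)) in B2; [|assumption].
    replace (exp L * (eps / exp L)) with eps in B2 by (field; lra). lra.
Qed.

Lemma SigmaV_equiv_flow (n p r : nat) (Sigma : vec -> Prop) (g h : vec -> vec) (rho rj c E : R) :
  (forall x, Sigma x -> in_Rn n x) -> closed_n n Sigma -> 0 < rho ->
  flow_data n p r Sigma g h rho c E ->
  0 < rj -> (forall x, Sigma x -> normv n x < rj -> forall j, (j < p)%nat -> g x j = h x j) ->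
  SigmaV_equiv n p Sigma g h.
Proof.
  intros HS Hcl Hrho HF Hrj Hgh. pose proof HF as [Hc [HE [H0 _]]].
  assert (Hn := pos_INR n).
  (* Small enough that the cube of half-side [a], whose points have norm at most [n a], lies in the
     ball of radius [rho]. *)
  set (a := rho / (2 * (INR n + 1))).
  assert (Ha : 0 < a) by (apply Rdiv_lt_0_compat; lra).
  assert (Ea : (INR n + 1) * a = rho / 2) by (unfold a; field; lra).
  assert (Har : INR n * a < rho) by lra.
  assert (Har' : a < rho) by nra.
  set (Ec := exp (2 * E / c)). assert (HEc : 0 < Ec) by apply exp_pos.
  set (rf := Rmin rj (a / (4 * Ec))).
  assert (Hrf : forall x, normv n x < rf -> 4 * (Ec * normv n x) < a).
  { intros x Hx. pose proof (Rlt_le_trans _ _ _ Hx (Rmin_r _ _)) as B.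
    apply (Rmult_lt_compat_l (4 * Ec)) in B; [|lra].
    replace (4 * Ec * (a / (4 * Ec))) with a in B by (field; lra). lra. }
  assert (H01 : 0 <= 0 <= 1) by lra. assert (H11 : 0 <= 1 <= 1) by lra.
  apply (SigmaV_equiv_of_rel n p Sigma g h (flow_rel n p Sigma g h a 0 1) rf).
  - apply Rmin_pos; [assumption|]. apply Rdiv_lt_0_compat; lra.
  - assumption.
  - intros x y [Hx [Hy _]]. now split.
  - intros x Hx Hxn. apply (flow_rel_exists n p r Sigma g h rho c E);
      [assumption|assumption|lra|assumption|now left|assumption|exact (Hrf x Hxn)].
  - intros y Hy Hyn.
    destruct (flow_rel_exists n p r Sigma g h rho c E a 1 0 y HS HF ltac:(lra) Har
      ltac:(now right) Hy (Hrf y Hyn)) as [x Hx].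
    exists x. now apply flow_rel_sym.
  - intros x y HR Hxn eps Heps.
    destruct (flow_rel_continuous n p r Sigma g h rho c E a 0 1 x y HS Hcl HF ltac:(lra) Har H01 H11
      (Hrf x Hxn) HR eps Heps) as [d [Hd K]].
    exists d. split; [assumption|]. intros x' y' HR' Hn' Hd'. exact (K x' y' HR' (Hrf x' Hn') Hd').
  - intros x y HR Hyn eps Heps.
    destruct (flow_rel_continuous n p r Sigma g h rho c E a 1 0 y x HS Hcl HF ltac:(lra) Har H11 H01
      (Hrf y Hyn) (flow_rel_sym _ _ _ _ _ _ _ _ _ _ HR) eps Heps) as [d [Hd K]].
    exists d. split; [assumption|]. intros x' y' HR' Hn' Hd'.
    exact (K y' x' (flow_rel_sym _ _ _ _ _ _ _ _ _ _ HR') (Hrf y' Hn') Hd').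
  - assert (F0 : forall x j, Ft g h 0 x j = g x j) by (intros; unfold Ft, interp; ring).
    assert (F1 : forall x j, Ft g h 1 x j = h x j) by (intros; unfold Ft, interp; ring).
    intros x y [Hx [Hy HR]] Hxn Hyn.
    destruct HR as [[HD ->]|[del [gam [Hdel [HT [Hin [<- <-]]]]]]].
    + assert (HSx : Sigma x) by (apply (distS_zero n); auto; lra).
      pose proof (Rlt_le_trans _ _ _ Hxn (Rmin_l _ _)) as B.
      split; intros H j Hj; [rewrite <- Hgh by assumption|rewrite Hgh by assumption]; now apply H.
    + split; intros H j Hj.
      * rewrite <- F1. apply (traj_conserves_zeros n p r Sigma g h rho c E a del 0 1 gam); auto.
        intros i Hi. rewrite F0. now apply H.
      * rewrite <- F0. apply (traj_conserves_zeros n p r Sigma g h rho c E a del 1 0 gam); auto.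
        intros i Hi. rewrite F1. now apply H.
  - intros x HSx Hx Hxn. split; [assumption|]. split; [assumption|]. left.
    split; [now apply distS_Sigma|reflexivity].
Qed.

(** * Local Lipschitz bounds and orders at least two *)

Lemma Cr_lipb (n r : nat) (rho : R) (g : vec -> R) (l : list nat) :
  0 < rho -> Cr_on n r (ball n rho) g -> Forall (fun i => (i < n)%nat) l -> (length l < r)%nat ->
  exists d, 0 < d /\ lipb n d (pdiff l g).
Proof.
  intros Hrho Hg Hl Hlen.
  assert (B0 : ball n rho vzero) by (unfold ball; now rewrite normv_vzero).
  destruct (cont_at_bounded n (pdiff l g)) as [M0 [d0 [Hd0 K0]]].
  { apply (Hg l Hl ltac:(lia) vzero (in_Rn_vzero n) B0). }
  destruct (finite_radius n (fun i d => exists M, forall x, in_Rn n x -> normv n x < d ->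
     Rabs (pdiff (i :: l) g x) <= M)) as [d1 [Hd1 K1]].
  { intros i u v [M H] _ Huv. exists M. intros x Hx Hn. apply H; [assumption|lra]. }
  { intros i Hi. destruct (cont_at_bounded n (pdiff (i :: l) g)) as [M [d [Hd K]]].
    - apply (Hg (i :: l) ltac:(now constructor) ltac:(simpl; lia) vzero (in_Rn_vzero n) B0).
    - exists d. split; [assumption|]. now exists M. }
  apply (finite_bound n (fun i M => forall x, in_Rn n x -> normv n x < d1 ->
     Rabs (pdiff (i :: l) g x) <= M)) in K1.
  2:{ intros i u v H Huv x Hx Hn. eapply Rle_trans; [now apply H|assumption]. }
  destruct K1 as [M1 [HM1 K1]].
  set (d := Rmin (Rmin d0 d1) rho).
  assert (L0 : d <= d0) by (eapply Rle_trans; [apply Rmin_l|apply Rmin_l]).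
  assert (L1 : d <= d1) by (eapply Rle_trans; [apply Rmin_l|apply Rmin_r]).
  assert (L2 : d <= rho) by apply Rmin_r.
  exists d. split; [repeat apply Rmin_pos; assumption|].
  exists (Rmax M0 (INR n * M1)). intros x y Hx Hy Bx By. split.
  - eapply Rle_trans; [apply K0; [assumption|lra]|apply Rmax_l].
  - rewrite Rabs_minus_sym, normv_sub_sym.
    eapply Rle_trans; [apply (C1grad_increment n d _ (fun i => pdiff (i :: l) g) x y M1)|]; auto.
    + intros z Hz Bz. apply (C1grad_pdiff n r rho g l Hg Hl Hlen z Hz). unfold ball in *. lra.
    + intros z i Hz Bz _ Hi. unfold ball in Bz. apply K1; auto. lra.
    + apply Rmult_le_compat_r; [apply normv_nonneg|apply Rmax_r].
Qed.

Lemma lipb_mono (n : nat) (rho rho' : R) (phi : vec -> R) :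
  rho' <= rho -> lipb n rho phi -> lipb n rho' phi.
Proof.
  intros Hle [M H]. exists M. intros x y Hx Hy Bx By. apply H; auto; lra.
Qed.

(** The place where [r >= 2] enters: the entries of the gradient are then themselves of class C1,
    hence Lipschitz near the origin. *)
Lemma in_E_lipb (n p r : nat) (g : vec -> vec) :
  (2 <= r)%nat -> in_E n p r g -> exists d, 0 < d /\ forall j, (j < p)%nat ->
    lipb n d (fun x => g x j) /\ C1grad n d (fun x => g x j) (fun k x => grad g j x k) /\
    forall k, (k < n)%nat -> lipb n d (fun x => grad g j x k).
Proof.
  intros Hr [_ [rho [Hrho Hg]]].
  destruct (finite_radius p (fun j d => lipb n d (fun x => g x j) /\
     forall k, (k < n)%nat -> lipb n d (fun x => grad g j x k))) as [d [Hd K]].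
  - intros j u v [H1 H2] _ Huv. split; [now apply (lipb_mono n v)|].
    intros k Hk. apply (lipb_mono n v); auto.
  - intros j Hj.
    destruct (Cr_lipb n r rho (fun x => g x j) nil Hrho (Hg j Hj) ltac:(constructor) ltac:(simpl; lia))
      as [d1 [Hd1 K1]].
    destruct (finite_radius n (fun k d => lipb n d (fun x => grad g j x k))) as [d2 [Hd2 K2]].
    + intros k u v H _ Huv. now apply (lipb_mono n v).
    + intros k Hk.
      apply (Cr_lipb n r rho (fun x => g x j) (k :: nil) Hrho (Hg j Hj)); [now repeat constructor|simpl; lia].
    + exists (Rmin d1 d2). split; [now apply Rmin_pos|]. split.
      * apply (lipb_mono n d1); [apply Rmin_l|assumption].
      * intros k Hk. apply (lipb_mono n d2); [apply Rmin_r|auto].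
  - exists (Rmin d rho). split; [now apply Rmin_pos|]. intros j Hj. destruct (K j Hj) as [K1 K2].
    split; [apply (lipb_mono n d); [apply Rmin_l|assumption]|]. split.
    + intros x Hx Bx. apply (C1grad_pdiff n r rho (fun x => g x j) nil); auto; [simpl; lia|].
      eapply Rlt_le_trans; [exact Bx|apply Rmin_r].
    + intros k Hk. apply (lipb_mono n d); [apply Rmin_l|auto].
Qed.

Lemma V_sufficient_higher_order (n p r : nat) (Sigma : vec -> Prop) (f : vec -> vec) :
  (forall x, Sigma x -> in_Rn n x) -> closed_n n Sigma -> Sigma vzero -> (2 <= r)%nat ->
  in_E n p r f -> cond_K n p r Sigma f -> V_sufficient n p r Sigma f.
Proof.
  intros HS Hcl H0 Hr Hf HK g h Hg Hh Jg Jh.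
  destruct (cond_K_nondeg n p r Sigma f H0 HK) as [c [r0 [Hc [Hr0 Hnd]]]].
  assert (Hp := pos_INR p). assert (Hn := pos_INR n).
  (* The perturbation from [f] to the interpolation then costs at most half of [c]. The same [e]
     gives [E = p (2 e)], since [h - g] is a sum of two errors relative to [f]. *)
  set (e := c / (2 * (INR n * INR p + INR p + 1))).
  assert (Hnp : 0 <= INR n * INR p) by now apply Rmult_le_pos.
  assert (He : 0 < e) by (apply Rdiv_lt_0_compat; lra).
  assert (Ee : (INR n * INR p + INR p) * e <= c / 2).
  { assert ((INR n * INR p + INR p + 1) * e = c / 2) by (unfold e; field; lra). lra. }
  destruct (flat_estimate n p r Sigma f g HS Hcl H0 ltac:(lia) Hf Hg Jg e He) as [r1 [Hr1 Fg]].
  destruct (flat_estimate n p r Sigma f h HS Hcl H0 ltac:(lia) Hf Hh Jh e He) as [r2 [Hr2 Fh]].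
  destruct (in_E_lipb n p r g Hr Hg) as [r3 [Hr3 Lg]].
  destruct (in_E_lipb n p r h Hr Hh) as [r4 [Hr4 Lh]].
  set (rho := Rmin r0 (Rmin (Rmin r1 r2) (Rmin r3 r4))).
  assert (L0 : rho <= r0) by apply Rmin_l.
  assert (L' : rho <= Rmin (Rmin r1 r2) (Rmin r3 r4)) by apply Rmin_r.
  assert (L1 : rho <= r1) by (eapply Rle_trans; [exact L'|eapply Rle_trans; [apply Rmin_l|apply Rmin_l]]).
  assert (L2 : rho <= r2) by (eapply Rle_trans; [exact L'|eapply Rle_trans; [apply Rmin_l|apply Rmin_r]]).
  assert (L3 : rho <= r3) by (eapply Rle_trans; [exact L'|eapply Rle_trans; [apply Rmin_r|apply Rmin_l]]).
  assert (L4 : rho <= r4) by (eapply Rle_trans; [exact L'|eapply Rle_trans; [apply Rmin_r|apply Rmin_r]]).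
  assert (Hrho : 0 < rho) by (repeat apply Rmin_pos; assumption).
  assert (Jnil : forall g, jet_eq n p r Sigma f g -> exists d, 0 < d /\
     forall x, Sigma x -> normv n x < d -> forall j, (j < p)%nat -> f x j = g x j).
  { intros u [d [Hd J]]. exists d. split; [assumption|]. intros x Hx Hxn j Hj.
    apply (J x Hx Hxn nil); [constructor|simpl; lia|assumption]. }
  destruct (Jnil g Jg) as [dg [Hdg Ig]]. destruct (Jnil h Jh) as [dh [Hdh Ih]].
  apply (SigmaV_equiv_flow n p r Sigma g h rho (Rmin dg dh) (c / 2) (INR p * (2 * e))); auto.
  - split; [lra|]. split; [apply Rmult_le_pos; lra|]. split; [assumption|]. split; [|split; [|split]].
    + intros j Hj. destruct (Lg j Hj) as [A1 [_ A2]], (Lh j Hj) as [B1 [_ B2]].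
      split; [now apply (lipb_mono n r3)|]. split; [now apply (lipb_mono n r4)|].
      intros k Hk. split; [apply (lipb_mono n r3)|apply (lipb_mono n r4)]; auto.
    + intros j Hj. destruct (Lg j Hj) as [_ [A1 _]], (Lh j Hj) as [_ [B1 _]]. unfold ball in *.
      split; intros x Hx Bx; [apply A1|apply B1]; auto; unfold ball in *; lra.
    + intros t x Ht Hx Bx.
      assert (Q : nondeg_at n p r (c - (INR n * INR p + INR p) * e) (distS n Sigma x) (At g h t x) (Ft g h t x)).
      { apply (nondeg_perturb n p r c (distS n Sigma x) e (fun j k => grad f j x k) _ (f x)); [lia| | | |].
        - now apply distS_nonneg.
        - apply Hnd; [assumption|lra].
        - intros j Hj. apply interp_close; [assumption|apply Fg|apply Fh]; auto; lra.
        - intros j k Hj Hk.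
          apply interp_close; [assumption|apply Fg|apply Fh]; auto; lra. }
      intros w. eapply Rle_trans; [|apply Q].
      apply Rmult_le_compat_r; [apply normv_nonneg|].
      apply Rmult_le_compat_r; [|lra]. apply pow_le. now apply distS_nonneg.
    + intros x Hx Bx. rewrite Rmult_assoc. apply normv_le_coord. intros j Hj.
      destruct (Fg x Hx ltac:(lra) j Hj) as [A _]. destruct (Fh x Hx ltac:(lra) j Hj) as [B _].
      rewrite Rabs_minus_sym in A.
      replace (h x j - g x j) with ((h x j - f x j) + (f x j - g x j)) by ring.
      eapply Rle_trans; [apply Rabs_triang|]. lra.
  - now apply Rmin_pos.
  - intros x Hx Hxn j Hj. rewrite <- Ig, <- Ih; auto;
      (eapply Rlt_le_trans; [exact Hxn|]); [apply Rmin_r|apply Rmin_l].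
Qed.

Theorem theorem5p1 (n p r : nat) (Sigma : vec -> Prop) (f : vec -> vec) :
  (forall x, Sigma x -> in_Rn n x) ->
  closed_n n Sigma ->
  Sigma vzero ->
  (1 <= r)%nat ->
  (p <= n)%nat ->
  in_E n p r f ->
  cond_K n p r Sigma f ->
  V_sufficient n p r Sigma f.
Proof.
  intros HS Hcl H0 Hr _ Hf HK.
  destruct (Nat.eq_dec r 1) as [->|Hr1].
  - now apply V_sufficient_order_one.
  - apply V_sufficient_higher_order; auto. lia.
Qed.
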